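(* Assume $n\ge2k$. The collection of all nonzero spaces $eM_{\lambda,\mu}$, for $\lambda,\mu$ partitions of $r$ and $r=0,1,\dots,k$, is a complete set of pairwise nonisomorphic irreducible modules for the algebra $\mathcal C=\mathrm{End}_{\mathfrak g}(eM)\cong e\,\mathrm{End}_{\mathfrak g}(M)\,e|_{eM}\cong\mathrm{End}_{\mathfrak{sl}_n}(\mathfrak{sl}_n^{\otimes k})$.
   Context: $\mathfrak g=\mathfrak{gl}_n(\mathbb{C})$; $V=\mathbb{C}^n$ (basis $v_1,\dots,v_n$), $V^*$ (dual basis $v_1^*,\dots,v_n^*$), $\mathfrak g$ acting on $V$ by left multiplication and on $V^*$ by $w^*\mapsto-w^*x$; $M=V^{\otimes k}\otimes(V^* )^{\otimes k}$ with the tensor product action. For $1\le i,j\le k$ the contraction $c_{i,j}:M\to M$ is $c_{i,j}(u_1\otimes\cdots\otimes u_k\otimes w_1^*\otimes\cdots\otimes w_k^* )=(w_j^*u_i)\sum_{\ell=1}^n(\text{same tensor with }u_i\text{ replaced by }v_\ell\text{ and }w_j^*\text{ by }v_\ell^* )$; $p_i=\frac1nc_{i,i}$; $e=(\mathrm{id}-p_1)\cdots(\mathrm{id}-p_k)$, and $eM\cong\mathfrak{sl}_n^{\otimes k}$ (adjoint action on each factor). For $0\le r\le k$, $\underline s=(s_1<\cdots<s_{k-r})\subseteq\{1,\dots,k\}$ and $\underline t=(t_1,\dots,t_{k-r})$ distinct elements of $\{1,\dots,k\}$, $c_{\underline s,\underline t}=c_{s_1,t_1}\cdots c_{s_{k-r},t_{k-r}}$.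 For a standard tableau $T$ (rows, columns increasing) with entries in a subset of $\{1,\dots,k\}$, $y_T=(\sum_{\rho\in R_T}\rho)(\sum_{\gamma\in C_T}\mathrm{sgn}(\gamma)\gamma)$ where $R_T$, $C_T$ are the permutations of $\{1,\dots,k\}$ fixing non-entries and preserving each row, resp. column, of $T$; $y_T$ acts by place permutations on $V^{\otimes k}$, $y_{T^*}$ on $(V^* )^{\otimes k}$. $x'_{T,T^*,\underline s,\underline t}=u'_1\otimes\cdots\otimes u'_k\otimes(w_1^* )'\otimes\cdots\otimes(w_k^* )'$ with $u'_p=v_{r+i}$ if $p=s_i$, $u'_p=v_j$ if $p\notin\underline s$ is in row $j$ of $T$, $(w_p^* )'=v_{r+i}^*$ if $p=t_i$, $(w_p^* )'=v_{n-j+1}^*$ if $p\notin\underline t$ is in row $j$ of $T^*$. For partitions $\lambda,\mu$ of $r$, $M_{\lambda,\mu}$ is the span of all $y_Ty_{T^*}c_{\underline s,\underline t}x'_{T,T^*,\underline s,\underline t}$ over all such $\underline s,\underline t$ and standard tableaux $T$ of shape $\lambda$ with entries in $\{1,\dots,k\}\setminus\underline s$ and $T^*$ of shape $\mu$ with entries in $\{1,\dots,k\}\setminus\underline t$; $M_{\lambda,\mu}$ is an $\mathrm{End}_{\mathfrak g}(M)$-module, and $eM_{\lambda,\mu}$ is a module for $e\,\mathrm{End}_{\mathfrak g}(M)\,e$, hence (by restriction to $eM$) for $\mathcal C$. *)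

(* Defs.v *)
From HB Require Import structures.
From mathcomp Require Import all_boot all_order all_algebra.
From mathcomp Require Import fingroup perm.
Set Implicit Arguments. Unset Strict Implicit. Unset Printing Implicit Defensive.
Import GRing.Theory.
Local Open Scope ring_scope.

Section MixedTensors.
Variables (F : fieldType) (n k : nat).

(* Basis of M = V^{(x)k} (x) (V^* )^{(x)k}: the tensor
   v_{a 0} (x) ... (x) v_{a (k-1)} (x) v^*_{b 0} (x) ... (x) v^*_{b (k-1)}
   is indexed by (a, b).  Positions and basis indices are 0-based. *)
Definition idx := ({ffun 'I_k -> 'I_n} * {ffun 'I_k -> 'I_n})%type.
(* Elements of M, as coefficient functions on the basis. *)
Definition tens := {ffun idx -> F^o}.

Definition upd (a : {ffun 'I_k -> 'I_n}) (p : 'I_k) (m : 'I_n) :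
  {ffun 'I_k -> 'I_n} := [ffun q => if q == p then m else a q].

(* action of x in gl_n on M (x acts on V by left multiplication,
   on V^* by w^* |-> - w^* x, and on M by the tensor product action) *)
Definition gact (x : 'M[F]_n) (f : tens) : tens :=
  [ffun ab : idx =>
     (\sum_(p < k) \sum_(m < n) x (ab.1 p) m * f (upd ab.1 p m, ab.2))
   - (\sum_(q < k) \sum_(m < n) x m (ab.2 q) * f (ab.1, upd ab.2 q m))].

Definition contr (i j : 'I_k) (f : tens) : tens :=
  [ffun ab : idx => if ab.1 i == ab.2 j
     then \sum_(m < n) f (upd ab.1 i m, upd ab.2 j m) else 0].

Definition pproj (i : 'I_k) (f : tens) : tens := (n%:R : F)^-1 *: contr i i f.

Definition eproj (f : tens) : tens :=
  foldr (fun i w => w - pproj i w) f (enum 'I_k).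

(* place permutations (left action) on V^{(x)k}, resp. (V^* )^{(x)k} *)
Definition permL (s : 'S_k) (f : tens) : tens :=
  [ffun ab : idx => f ([ffun p => ab.1 (s p)], ab.2)].
Definition permR (s : 'S_k) (f : tens) : tens :=
  [ffun ab : idx => f (ab.1, [ffun p => ab.2 (s p)])].

(* Tableaux: list of rows, entries are positions 0..k-1 *)
Definition rowof (T : seq (seq nat)) (p : nat) : nat := find (fun row => p \in row) T.
Definition colof (T : seq (seq nat)) (p : nat) : nat := index p (nth [::] T (rowof T p)).

Definition is_partition (l : seq nat) : bool :=
  sorted geq l && all (fun x => 0 < x)%N l.

Definition std_tableau (T : seq (seq nat)) (lam : seq nat) (E : pred 'I_k) : Prop :=
  [/\ map size T = lam,
      uniq (flatten T) /\ all (fun x => x < k)%N (flatten T),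
      (forall p : 'I_k, (val p \in flatten T) = E p),
      all (sorted ltn) T &
      (forall j c, (c < size (nth [::] T j.+1))%N ->
         (nth 0%N (nth [::] T j) c < nth 0%N (nth [::] T j.+1) c)%N)].

Definition rowperm (T : seq (seq nat)) (s : 'S_k) : bool :=
  [forall p : 'I_k, if val p \in flatten T
     then (val (s p) \in flatten T) && (rowof T (s p) == rowof T p)
     else s p == p].
Definition colperm (T : seq (seq nat)) (s : 'S_k) : bool :=
  [forall p : 'I_k, if val p \in flatten T
     then (val (s p) \in flatten T) && (colof T (s p) == colof T p)
     else s p == p].

Definition yL (T : seq (seq nat)) (f : tens) : tens :=
  \sum_(rho : 'S_k | rowperm T rho)
     permL rho (\sum_(g : 'S_k | colperm T g) ((-1) ^+ odd_perm g : F) *: permL g f).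
Definition yR (T : seq (seq nat)) (f : tens) : tens :=
  \sum_(rho : 'S_k | rowperm T rho)
     permR rho (\sum_(g : 'S_k | colperm T g) ((-1) ^+ odd_perm g : F) *: permR g f).

Definition contrs (s t : seq 'I_k) (f : tens) : tens :=
  foldr (fun ij g => contr ij.1 ij.2 g) f (zip s t).

(* the basis tensor x'_{T,T^*,s,t} (0-based: v_{r+i} is index r+i-1, etc.) *)
Definition xprime (r : nat) (T Ts : seq (seq nat)) (s t : seq 'I_k) : tens :=
  [ffun ab : idx =>
    if [forall p : 'I_k,
          (val (ab.1 p) == (if p \in s then r + index p s else rowof T p)%N) &&
          (val (ab.2 p) == (if p \in t then r + index p t else n - (rowof Ts p).+1)%N)]
    then 1 else 0].

Definition gen (lam mu : seq nat) (v : tens) : Prop :=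
  exists (s t : seq 'I_k) (T Ts : seq (seq nat)),
    [/\ sorted ltn (map val s) /\ uniq t,
        size s = (k - sumn lam)%N /\ size t = (k - sumn lam)%N,
        std_tableau T lam (fun p => p \notin s),
        std_tableau Ts mu (fun p => p \notin t) &
        v = yL T (yR Ts (contrs s t (xprime (sumn lam) T Ts s t)))].

Definition Mlm (lam mu : seq nat) (v : tens) : Prop :=
  exists X : seq tens, (forall x, x \in X -> gen lam mu x) /\ v \in <<X>>%VS.

Definition eMlm (lam mu : seq nat) (w : tens) : Prop :=
  exists v, Mlm lam mu v /\ w = eproj v.

(* the algebra C = e End_g(M) e (acting on eM) *)
Definition Calg (f : 'End(tens)) : Prop :=
  [/\ forall (x : 'M[F]_n) v, f (gact x v) = gact x (f v),
      forall v, f (eproj v) = f v &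
      forall v, eproj (f v) = f v].

Definition index_ok (lam mu : seq nat) : bool :=
  [&& is_partition lam, is_partition mu, sumn lam == sumn mu & (sumn lam <= k)%N].

Definition nonzero (W : tens -> Prop) : Prop := exists w, W w /\ w <> 0.

Definition Csubmodule (W : tens -> Prop) : Prop :=
  forall f v, Calg f -> W v -> W (f v).

Definition Cirreducible (W : tens -> Prop) : Prop :=
  nonzero W /\
  forall U : {vspace tens}, (forall u, u \in U -> W u) ->
    (forall f u, Calg f -> u \in U -> f u \in U) ->
    U = 0%VS \/ (forall w, W w -> w \in U).

Definition Ciso (W W' : tens -> Prop) : Prop :=
  exists phi : 'End(tens),
    [/\ forall v, W v -> W' (phi v),
        forall v, W v -> phi v = 0 -> v = 0,
        forall w, W' w -> exists v, W v /\ phi v = w &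
        forall f v, Calg f -> W v -> phi (f v) = f (phi v)].

Definition is_Cmodule (vT : vectType F) (rho : 'End(tens) -> 'End(vT)) : Prop :=
  [/\ forall f g, Calg f -> Calg g -> rho (f \o g)%VF = (rho f \o rho g)%VF,
      forall f g, Calg f -> Calg g -> rho (f + g) = rho f + rho g,
      forall (a : F) f, Calg f -> rho (a *: f) = a *: rho f &
      forall u, Calg u -> (forall v, u v = eproj v) -> rho u = \1%VF].

Definition abs_irreducible (vT : vectType F) (rho : 'End(tens) -> 'End(vT)) : Prop :=
  (0 < \dim {: vT})%N /\
  forall U : {vspace vT}, (forall f, Calg f -> (rho f @: U <= U)%VS) ->
    U = 0%VS \/ U = fullv.

Definition abs_iso (vT : vectType F) (rho : 'End(tens) -> 'End(vT)) (W : tens -> Prop) : Prop :=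
  exists phi : 'Hom(vT, tens),
    [/\ forall u, phi u = 0 -> u = 0,
        forall w, W w <-> exists u, w = phi u &
        forall f u, Calg f -> phi (rho f u) = f (phi u)].

End MixedTensors.

(* Main.v *)
(* The algebra B = End_g(M) is spanned by the walled diagrams s c_{1,1}...c_{m,m} t
   with s, t in S_k x S_k (first fundamental theorem), and those with at least m
   caps span an ideal B_m.  For fillings of lam, mu by the positions > m, put
   D = Y_lam Y_mu c_{1,1}...c_{m,m} with Y = R C R built from the row and column
   symmetrizers.  Then D B D lies in F D + B_{m+1}, the module M_{lam,mu} is
   generated by the tensor u0 of polytabloids capped by m copies of
   sum_l v_l (x) v_l^*, it is killed by B_{m+1} (this uses n >= 2k), and D maps it
   onto F u0.  In characteristic 0 the standard bilinear form is nondegenerate on a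
   space spanned by integral vectors; so, D being symmetric, D s p <> 0 for every
   p <> 0 in M_{lam,mu} and some s, whence irreducibility.  Modules with
   different indices are separated by some D, by the number of caps or by comparing
   the first row where the shapes differ.  Each B_m is spanned by the b D b' with at
   least m caps, so a simple module W of C = e B e has a vector w with
   e b D b' e w <> 0 and m maximal; then e x D b' e w |-> e x u0 is an isomorphism
   of W onto e M_{lam,mu}. *)

Require Import Defs.
From HB Require Import structures.
From mathcomp Require Import all_boot all_order all_algebra.
From mathcomp Require Import fingroup perm.
From mathcomp Require Import zify ring.
From Stdlib Require Import Classical ClassicalEpsilon.
Import Order.TTheory GRing.Theory Num.Theory.
Local Open Scope ring_scope.

Set Implicit Arguments.
Unset Strict Implicit.
Unset Printing Implicit Defensive.

(** Over an algebraically closed field the dot product has isotropic vectors, so complements and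
    nonzero squares cannot come from positivity directly. But diagrams, row words and polytabloids
    have integer coordinates, and rational positivity passes to every field of characteristic 0
    through their Gram matrices. This principle replaces semisimplicity throughout: besides
    irreducibility, it shows that the scalar by which a Young symmetrizer multiplies its polytabloid
    is nonzero, and that the products h D h' span each ideal. It is also why D uses R C R and not
    the R C of y_T: R C R is self-adjoint, and on a tensor fixed by the row group the two agree up
    to a nonzero scalar. The bound n >= 2k has two uses. It provides a word with 2k distinct
    letters, at which an invariant operator is determined. It also separates the letters of the
    uncapped positions of a generator, which lie below k in V and at k or above in the dual, so that
    no further contraction survives. The generators of M_{lam,mu} use standard tableaux only, while
    the module u0 generates involves all fillings; highest weight vectors supply the straightening
    that bridges the gap. *)

Local Notation iv g := ((g^-1)%g : 'S__).

(** * Spans of integral vectors *)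

Section IntegralSpans.

Variable F : fieldType.
Hypothesis char0 : [pchar F] =i pred0.

Lemma intr_char0_eq0 (z : int) : (z%:~R == 0 :> F) = (z == 0).
Proof.
have H n : (n%:R == 0 :> F) = (n == 0)%N by exact: (pcharf0P F).1.
by case: z => n; [exact: H|rewrite NegzE rmorphN /= !oppr_eq0; exact: (H n.+1)].
Qed.

Lemma natr_char0_neq0 (n : nat) : (0 < n)%N -> (n%:R : F) != 0.
Proof. by move=> n0; rewrite ((pcharf0P F).1 char0) -lt0n. Qed.

Lemma row_norm0 (q : nat) (w : 'rV[rat]_q) : w *m w^T = 0 -> w = 0.
Proof.
move/matrixP/(_ 0 0); rewrite !mxE.
under eq_bigr do rewrite mxE -expr2.
move/eqP; rewrite psumr_eq0 => [/allP w0|i _]; last exact: sqr_ge0.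
apply/rowP => j; rewrite mxE; apply/eqP.
by have := w0 j; rewrite mem_index_enum sqrf_eq0 => /(_ isT).
Qed.

Lemma gram_rat (p q : nat) (A : 'M[rat]_(p, q)) : (A^T <= A *m A^T)%MS.
Proof.
rewrite -(geq_leqif (mxrank_leqif_sup (submxMl A A^T))).
rewrite mxrank_tr; suff /mxrankS: (kermx (A *m A^T) <= kermx A)%MS.
  by rewrite !mxrank_ker leq_sub2lE ?rank_leq_row.
apply/rV_subP => v /sub_kermxP vAA; apply/sub_kermxP.
apply: row_norm0; by rewrite trmx_mul mulmxA -(mulmxA v) vAA mul0mx.
Qed.

Lemma common_denominator (p q : nat) (A : 'M[rat]_(p, q)) :
  exists (d : int) (B : 'M[int]_(p, q)), d != 0 /\ d%:~R *: A = map_mx intr B.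
Proof.
pose d : int := \prod_i \prod_j denq (A i j).
have d0 : d != 0.
  by apply/prodf_neq0 => i _; apply/prodf_neq0 => j _; exact: denq_neq0.
have dA i j : exists z : int, d%:~R * A i j == z%:~R.
  exists (numq (A i j) * (\prod_(j' | j' != j) denq (A i j')) *
          \prod_(i' | i' != i) \prod_j' denq (A i' j')).
  by rewrite /d (bigD1 i) //= (bigD1 j) //= !intrM numqE; apply/eqP; ring.
exists d, (\matrix_(i, j) xchoose (dA i j)); split=> //.
by apply/matrixP => i j; rewrite !mxE; apply/eqP/(xchooseP (dA i j)).
Qed.

(* Over the rationals A and A A^T have the same row kernel by positivity of the
   sum of squares; clearing denominators transports this to F. *)
Lemma gram (p q : nat) (A : 'M[int]_(p, q)) : let M := map_mx intr A : 'M[F]_(p, q) in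
  exists K : 'M[F]_(q, p), M^T = K *m (M *m M^T).
Proof.
move=> M; have /submxP [K EK] := gram_rat (map_mx intr A).
have [d [B [d0 EB]]] := common_denominator K.
have E : d *: A^T = B *m (A *m A^T).
  have inj : injective (map_mx (intr : int -> rat) : 'M_(q, p) -> 'M_(q, p)).
    by move=> U W /matrixP UW; apply/matrixP => i j; have := UW i j; rewrite !mxE => /intr_inj.
  by apply: inj; rewrite map_mxZ !map_mxM -EB -scalemxAl -map_trmx {1}EK.
exists (d%:~R^-1 *: map_mx intr B); rewrite -scalemxAl.
have := congr1 (map_mx (intr : int -> F)) E.
rewrite map_mxZ !map_mxM -map_trmx -/M => <-.
by rewrite scalerA mulVf ?scale1r // intr_char0_eq0.
Qed.

Lemma span_ind (vT : vectType F) (X : seq vT) (P : vT -> Prop) :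
  P 0 -> (forall a x v, x \in X -> P v -> P (a *: x + v)) ->
  forall v, v \in <<X>>%VS -> P v.
Proof.
move=> P0 PD v vX; rewrite (coord_span (vX : v \in <<in_tuple X>>%VS)).
elim/big_rec: _ => [|i w _ Pw]; first exact: P0.
by apply: PD => //; apply: mem_nth.
Qed.

(** [gen] and [young_gen] are mere propositions, whereas a span needs a finite list. Vectors
    satisfying [P] outside the current span are added until none is left; the codimension bounds the
    number of steps. *)
Lemma span_of_pred (vT : vectType F) (P : vT -> Prop) :
  exists X : seq vT, (forall x, x \in X -> P x) /\ (forall x, P x -> x \in <<X>>%VS).
Proof.
have H d : forall X : seq vT, (forall x, x \in X -> P x) ->
   (\dim {: vT} - \dim <<X>> <= d)%N ->
   exists X : seq vT, (forall x, x \in X -> P x) /\ (forall x, P x -> x \in <<X>>%VS).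
  elim: d => [|d IH] X HX Hd.
    exists X; split=> // x _; have /eqP -> : <<X>>%VS == fullv; last exact: memvf.
    by rewrite eqEdim subvf; lia.
  case: (classic (forall x, P x -> x \in <<X>>%VS)) => [|N]; first by exists X.
  have [x Hx] := not_all_ex_not _ _ N.
  have [Px /negP xX] := imply_to_and _ _ Hx.
  apply: (IH (x :: X)); first by move=> y /[!inE] /predU1P [->|/HX].
  suff: (\dim <<X>> < \dim <<x :: X>>)%N by lia.
  rewrite ltn_neqAle dimvS; last by apply: sub_span => y yX; rewrite inE yX orbT.
  rewrite andbT; apply: contraNneq xX => E.
  have /eqP -> : <<X>>%VS == <<x :: X>>%VS.
    by rewrite eqEdim E leqnn andbT; apply: sub_span => y yX; rewrite inE yX orbT.
  by apply: memv_span; rewrite inE eqxx.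
by apply: (H _ [::] _ (leqnn _)).
Qed.

Section Coordinates.

Variables (I : finType) (vT : vectType F) (c : I -> vT -> F).
Hypothesis c_linear : forall i, scalar (c i).
Hypothesis c_inj : forall v, (forall i, c i v = 0) -> v = 0.

Definition cdot (v w : vT) : F := \sum_i c i v * c i w.

Lemma c0 i : c i 0 = 0.
Proof. by have := c_linear i (-1) 0 0; rewrite scaleN1r addr0 oppr0 mulN1r addNr. Qed.

Lemma cB i v w : c i (v - w) = c i v - c i w.
Proof. by rewrite addrC -scaleN1r c_linear mulN1r addrC. Qed.

Lemma csum (J : Type) (r : seq J) (a : J -> F) (x : J -> vT) i :
  c i (\sum_(j <- r) a j *: x j) = \sum_(j <- r) a j * c i (x j).
Proof.
elim: r => [|j r IH]; first by rewrite !big_nil c0.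
by rewrite !big_cons c_linear IH.
Qed.

Variable X : seq vT.
Hypothesis X_int : forall x, x \in X -> forall i, exists z : int, c i x = z%:~R.

Let N := size X.
Let X_ (j : 'I_N) := tnth (in_tuple X) j.

Lemma coord_matrix : exists A : 'M[int]_(N, #|I|),
  forall j i, c (enum_val i) (X_ j) = (A j i)%:~R.
Proof.
have H (ji : 'I_N * 'I_#|I|) : exists z : int, c (enum_val ji.2) (X_ ji.1) == z%:~R.
  by have [|z E] := @X_int (X_ ji.1) _ (enum_val ji.2); [apply: mem_tnth|exists z; apply/eqP].
by exists (\matrix_(j, i) xchoose (H (j, i))) => j i; rewrite mxE; apply/eqP/(xchooseP (H (j, i))).
Qed.

(** Orthogonal projection onto the span. If the rows of M are the coordinates of [X] and M^T = K M
    M^T, the projection is multiplication by K M, because (1 - K M) M^T = 0. *)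
Lemma int_span_decomposition (w : vT) :
  exists2 v, v \in <<X>>%VS & forall x, x \in X -> cdot (w - v) x = 0.
Proof.
have [A EA] := coord_matrix; have [K EK] := gram A.
set M := map_mx _ A in EK.
pose wr : 'rV[F]_#|I| := \row_i c (enum_val i) w.
pose v := \sum_(j < N) (wr *m K) 0 j *: X_ j.
have cv i : c (enum_val i) v = (wr *m K *m M) 0 i.
  by rewrite /v csum mxE; apply: eq_bigr => j _; rewrite EA [M _ _]mxE.
exists v.
  by apply: memv_suml => j _; rewrite memvZ // memv_span // mem_tnth.
move=> x xX; have [j ->] : exists j, x = X_ j by have /tnthP := (xX : x \in in_tuple X).
have /matrixP/(_ 0 j) : (wr - wr *m K *m M) *m M^T = 0.
  by rewrite mulmxBl -!mulmxA -EK subrr.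
rewrite !mxE => <-; rewrite /cdot (reindex (@enum_val I I)) /=; last exact: onW_bij (@enum_val_bij I).
by apply: eq_bigr => i _; rewrite cB cv EA !mxE.
Qed.

(** For v = a M, orthogonality says a M M^T = 0, and the transpose of [gram] gives M = M M^T K^T, so
    a M = 0. *)
Lemma int_span_nondegenerate (v : vT) :
  v \in <<X>>%VS -> (forall x, x \in X -> cdot v x = 0) -> v = 0.
Proof.
move=> vX v0; have [A EA] := coord_matrix; have [K EK] := gram A.
set M := map_mx _ A in EK.
have [a Ea] : exists a : 'rV[F]_N, v = \sum_j a 0 j *: X_ j.
  exists (\row_j coord (in_tuple X) j v); rewrite {1}(coord_span (X := in_tuple X) vX).
  by apply: eq_bigr => j _; rewrite mxE /X_ (tnth_nth 0).
have cv i : c (enum_val i) v = (a *m M) 0 i.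
  by rewrite Ea csum mxE; apply: eq_bigr => j _; rewrite EA [M _ _]mxE.
have aM0 : a *m M *m M^T = 0.
  apply/rowP => j; rewrite !mxE -[RHS](v0 (X_ j)) ?mem_tnth //.
  rewrite /cdot (reindex (@enum_val I I)) /=; last exact: onW_bij (@enum_val_bij I).
  by apply: eq_bigr => i _; rewrite cv EA !mxE.
have EM : M = M *m M^T *m K^T by have := congr1 trmx EK; rewrite !trmx_mul !trmxK.
apply: c_inj => i; rewrite -(enum_rankK i) cv.
by have -> : a *m M = a *m M *m M^T *m K^T; [rewrite -!mulmxA (mulmxA M) -EM|rewrite aM0 mul0mx mxE].
Qed.

End Coordinates.

End IntegralSpans.

(** * Sums over the subsets of a finite set *)

Section SubsetSums.

Variables (F : fieldType) (T : finType) (X : {set T}) (h : {set T} -> F) (s : nat).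
Hypothesis char0 : [pchar F] =i pred0.
Hypothesis up0 : forall S : {set T}, S \subset X ->
  \sum_(q in X :\: S) h (q |: S) = 0.

Let H (R Z : {set T}) : F :=
  \sum_(S : {set T} | [&& R \subset S, S \subset X, [disjoint S & Z] & #|S| == s]) h S.

(** Double counting: a set [S] of size [s] containing [R] arises once from each [q] in [S :\: R]. *)
Lemma sum_supersets_rec (R : {set T}) : (#|R| < s)%N ->
  \sum_(q in X :\: R) H (q |: R) set0 = H R set0 *+ (s - #|R|).
Proof.
move=> Rs; rewrite /H.
rewrite (exchange_big_dep (fun S : {set T} =>
  [&& R \subset S, S \subset X, [disjoint S & set0] & #|S| == s])) /=; last first.
  by move=> q S _ /and4P [/subUsetP [_ ->] -> -> ->].
rewrite -sumrMnl; apply: eq_bigr => S /and4P [RS SX S0 /eqP Ss].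
rewrite (eq_bigl (mem (S :\: R))); last first.
  move=> q; rewrite !inE subUset sub1set RS SX S0 Ss eqxx !andbT.
  by case: (boolP (q \in S)) => [/(subsetP SX) ->|_]; rewrite ?andbF ?andbT.
by rewrite sumr_const cardsD (setIidPr RS) Ss.
Qed.

(** Downward induction on the size of [R]. At size [s - 1] the sum over [q] is the one in [up0]; in
    general [sum_supersets_rec] is divided by [s - #|R|], which is where characteristic 0 enters. *)
Lemma sum_supersets0 (R : {set T}) : R \subset X -> (#|R| < s)%N -> H R set0 = 0.
Proof.
move: {2}(s - #|R|)%N (leqnn (s - #|R|)) => d; elim: d R => [|d IH] R; first by lia.
move=> Hd RX Rs; have E := sum_supersets_rec Rs.
suff E0 : \sum_(q in X :\: R) H (q |: R) set0 = 0.
  move: E; rewrite E0 => /esym /eqP; rewrite -mulr_natr mulf_eq0 => /orP [/eqP //|].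
  by rewrite (negPf (natr_char0_neq0 char0 _)) // subn_gt0.
have [R1|R1] := ltnP #|R|.+1 s.
  rewrite big1 // => q /setDP [qX qR]; apply: IH; rewrite ?cardsU1 ?qR //; first by lia.
  by rewrite subUset sub1set qX.
rewrite -[RHS](up0 RX); apply: eq_bigr => q /setDP [qX qR].
have cq : #|q |: R| = s by rewrite cardsU1 qR; lia.
rewrite /H (big_pred1 (q |: R)) // => S /=.
have -> : [disjoint S & set0] by rewrite -setI_eq0 setI0.
apply/and4P/eqP => [[RS SX _ /eqP Ss]|->]; last first.
  by rewrite subxx subUset sub1set qX RX cq eqxx.
by apply/esym/eqP; rewrite eqEcard RS cq Ss leqnn.
Qed.

(** Inclusion-exclusion, one element [z] of [Z] at a time: the sets avoiding [Z :\ z] split into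
    those that contain [z] and those that do not. *)
Lemma sum_avoiding0 (Z R : {set T}) : Z \subset X -> R \subset X ->
  [disjoint R & Z] -> (#|R| + #|Z| < s)%N -> H R Z = 0.
Proof.
move: {2}#|Z| (leqnn #|Z|) => d; elim: d Z R => [|d IH] Z R.
  rewrite leqn0 cards_eq0 => /eqP -> _ RX _; rewrite cards0 addn0.
  exact: sum_supersets0.
move=> Zd ZX RX RZ Hs.
have [->|[z zZ]] := set_0Vmem Z; first by apply: sum_supersets0 => //; lia.
have ZD := cardsD1 z Z; rewrite zZ in ZD.
have zX := subsetP ZX _ zZ.
have zR : z \notin R by rewrite (disjointFl RZ zZ).
have ZzX : Z :\ z \subset X by apply: subset_trans ZX; apply: subsetDl.
have RZz : [disjoint R & Z :\ z] by apply: disjointWr RZ; apply: subsetDl.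
have E1 : H R (Z :\ z) = 0 by apply: IH => //; lia.
have E2 : H (z |: R) (Z :\ z) = 0.
  apply: IH => //; first by lia.
  - by rewrite subUset sub1set zX.
  - rewrite -setI_eq0 setIUl setU_eq0 !setI_eq0 RZz andbT.
    by rewrite disjoints1 !inE eqxx.
  - by rewrite cardsU1 zR; lia.
move: E1; rewrite /H (bigID (fun S : {set T} => z \in S)) /=.
set A := (X in X + _); set B := (X in _ + X).
have -> : A = 0.
  rewrite -[RHS]E2; apply: eq_bigl => S.
  by rewrite subUset sub1set; case: (z \in S); rewrite ?andbT ?andbF.
rewrite add0r => E3; rewrite -[RHS]E3; apply: eq_bigl => S.
have -> : [disjoint S & Z] = [disjoint S & Z :\ z] && (z \notin S).
  rewrite -[in LHS](setD1K zZ) -!setI_eq0 setIUr setU_eq0 andbC; congr (_ && _).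
  by rewrite setI_eq0 disjoint_sym disjoints1.
by rewrite -!andbA; congr [&& _, _, _ & _]; exact: andbC.
Qed.

End SubsetSums.

(* Injectivity of the raising map above the middle of the Boolean lattice,
   by inclusion-exclusion on the complement of S0. *)
Lemma subset_sum_vanish (F : fieldType) (T : finType) (X : {set T}) (h : {set T} -> F) :
  [pchar F] =i pred0 ->
  (forall S : {set T}, S \subset X -> \sum_(q in X :\: S) h (q |: S) = 0) ->
  forall S0 : {set T}, S0 \subset X -> (#|X| < 2 * #|S0|)%N -> h S0 = 0.
Proof.
move=> char0 up0 S0 S0X big.
have cX := cardsID S0 X; rewrite (setIidPr S0X) in cX.
rewrite -[RHS](@sum_avoiding0 F T X h #|S0| char0 up0 (X :\: S0) set0) ?subsetDl ?sub0set //.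
- rewrite (big_pred1 S0) // => S /=; rewrite sub0set /=.
  apply/and3P/eqP => [[SX SD /eqP cS]|->]; last first.
    by rewrite S0X eqxx -setI_eq0 setDE setICA setICr setI0 eqxx.
  apply/eqP; rewrite eqEcard cS leqnn andbT; apply/subsetP => x xS.
  have := disjointFr SD xS; rewrite inE (subsetP SX _ xS) andbT.
  by move/negbFE.
- by rewrite -setI_eq0 set0I.
- by rewrite cards0 add0n; lia.
Qed.

(** Greedy choice of the largest possible letter, position by position. Lexicographic maximality is
    stated in the form in which it contradicts a competing word. *)
Lemma lex_max (k n : nat) (S : pred {ffun 'I_k -> 'I_n}) :
  (exists a, S a) -> exists2 a, S a &
  forall (p : 'I_k) a', S a' -> (forall q : 'I_k, (q < p)%N -> a' q = a q) -> (a' p <= a p)%N.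
Proof.
move=> Sne.
suff H m : exists2 a, S a & forall (p : 'I_k) a', (p < m)%N -> S a' ->
    (forall q : 'I_k, (q < p)%N -> a' q = a q) -> (a' p <= a p)%N.
  by have [a Sa Ha] := H k; exists a => // p a'; apply: Ha.
elim: m => [|m [a Sa Ha]]; first by have [a Sa] := Sne; exists a.
case: (ltnP m k) => mk; last by exists a => // p a' _; apply: Ha; have := ltn_ord p; lia.
pose p0 := Ordinal mk.
pose Q b := S b && [forall q : 'I_k, (q < m)%N ==> (b q == a q)].
have Qa : Q a by rewrite /Q Sa; apply/forallP => q; rewrite eqxx implybT.
case: (@arg_maxnP _ a Q (fun b => val (b p0)) Qa) => b /andP [Sb /forallP Hb] bmax.
have ba (q : 'I_k) : (q < m)%N -> b q = a q by move=> qm; have := Hb q; rewrite qm => /eqP.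
exists b => // p a'; rewrite ltnS leq_eqVlt => /predU1P [pm|pm] Sa' a'b.
  have -> : p = p0 by apply: val_inj.
  apply: bmax; rewrite /Q Sa'; apply/forallP => q; apply/implyP => qm.
  by rewrite a'b ?pm // ba.
rewrite ba //; apply: Ha => // q qp; rewrite a'b // ba //; exact: ltn_trans qp pm.
Qed.

Lemma lex_max_rev (k n : nat) (S : pred {ffun 'I_k -> 'I_n}) :
  (exists a, S a) -> exists2 a, S a &
  forall (p : 'I_k) a', S a' -> (forall q : 'I_k, (p < q)%N -> a' q = a q) -> (a' p <= a p)%N.
Proof.
move=> [a0 Sa0].
pose r (a : {ffun 'I_k -> 'I_n}) := [ffun p => a (rev_ord p)].
have rK : involutive r by move=> a; apply/ffunP => p; rewrite !ffunE rev_ordK.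
have [|a Sa Ha] := @lex_max k n (fun a => S (r a)); first by exists (r a0); rewrite rK.
exists (r a) => // p a' Sa' a'a; have := Ha (rev_ord p) (r a').
rewrite rK !ffunE rev_ordK; apply=> // q qp.
rewrite ffunE a'a; last by move: qp => /=; have := ltn_ord q; have := ltn_ord p; lia.
by rewrite ffunE rev_ordK.
Qed.

(** Used to compare arbitrary contracted positions with the first ones: the list is completed by the
    missing positions. *)
Lemma perm_of_uniq (k : nat) (s : seq 'I_k) : uniq s ->
  exists al : 'S_k, forall i : 'I_k, (i < size s)%N -> al i = nth i s i.
Proof.
move=> us; pose l := s ++ [seq p <- enum 'I_k | p \notin s].
have ul : uniq l.
  rewrite cat_uniq us filter_uniq ?enum_uniq // andbT /=.
  by apply/hasPn => p; rewrite mem_filter => /andP [].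
have sl : size l = k.
  rewrite -[RHS](size_enum_ord k); apply/perm_size/uniq_perm => //; first exact: enum_uniq.
  by move=> p; rewrite mem_cat mem_filter mem_enum andbT; case: (p \in s).
have inj : injective (fun i : 'I_k => nth i l i).
  move=> i j /=; rewrite (set_nth_default i j) ?sl // => /eqP.
  by rewrite nth_uniq ?sl // => /eqP /val_inj.
exists (perm inj) => i si; by rewrite permE nth_cat si.
Qed.

Lemma perm_of_set (k m : nat) (S : {set 'I_k}) : #|S| = m ->
  exists al : 'S_k, forall i : 'I_k, (i < m)%N = (al i \in S).
Proof.
move=> cS; have [al Hal] := perm_of_uniq (enum_uniq (mem S)).
rewrite -cardE cS in Hal.
have aS (i : 'I_k) : (i < m)%N -> al i \in S.
  by move=> im; rewrite Hal // -mem_enum mem_nth // -cardE cS.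
exists al => i; apply/idP/idP => [/aS //|iS]; rewrite ltnNge; apply/negP => mi.
have /nthP : al i \in enum S by rewrite mem_enum.
move=> /(_ i) [j]; rewrite -cardE cS => jm Ej.
have jk : (j < k)%N by apply: leq_trans jm _; rewrite -cS -[k in (_ <= k)%N]card_ord max_card.
have : al (Ordinal jk) = al i.
  by rewrite Hal // -Ej; apply: set_nth_default; rewrite -cardE cS.
by move/perm_inj/(congr1 val) => /= E; rewrite -E leqNgt jm in mi.
Qed.

(** * Row and column symmetrizers *)

Section PositionPermutations.

Variable k : nat.
Implicit Types (E : pred 'I_k) (f : 'I_k -> nat) (s t : 'S_k).

(** With [f] the row or column map of a tableau these are the groups R_T and C_T; a constant [f]
    gives the full symmetric group of [E]. *)
Definition keeps E f s :=
  [forall p, if E p then E (s p) && (f (s p) == f p) else s p == p].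

Definition supported E s := keeps E (fun=> 0%N) s.

Lemma keepsP E f s : reflect
  ((forall p, E p -> E (s p) /\ f (s p) = f p) /\ (forall p, ~~ E p -> s p = p))
  (keeps E f s).
Proof.
apply: (iffP forallP) => [H|[H1 H2] p].
  by split=> p Ep; have := H p; [rewrite Ep => /andP [-> /eqP ->]|rewrite (negPf Ep) => /eqP].
by case: ifPn => [/H1 [-> ->]|/H2 ->]; rewrite ?eqxx.
Qed.

Lemma eq_keeps E E' f f' s : E =1 E' -> (forall p, E p -> f p = f' p) ->
  keeps E f s = keeps E' f' s.
Proof.
move=> EE' ff'; apply/keepsP/keepsP => [[H1 H2]|[H1 H2]]; split=> p Ep.
- have E1 : E p by rewrite EE'.
  have [Es H] := H1 p E1; have Es' : E' (s p) by rewrite -EE'.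
  by split=> //; rewrite -!ff'.
- by apply: H2; rewrite EE'.
- have E1 : E' p by rewrite -EE'.
  have [Es H] := H1 p E1; have Es' : E (s p) by rewrite EE'.
  by split=> //; rewrite !ff'.
- by apply: H2; rewrite -EE'.
Qed.

Lemma keeps_supported E f s : keeps E f s -> supported E s.
Proof.
by move/keepsP => [H1 H2]; apply/keepsP; split=> // p /H1 [].
Qed.

Lemma keeps1 E f : keeps E f 1%g.
Proof. by apply/keepsP; split=> p; rewrite perm1. Qed.

Lemma keepsM E f s t : keeps E f s -> keeps E f t -> keeps E f (s * t)%g.
Proof.
move=> /keepsP [s1 s2] /keepsP [t1 t2]; apply/keepsP; split=> p Ep; rewrite permM.
  by have [Es <-] := s1 p Ep; apply: t1.
by rewrite s2 // t2.
Qed.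

Lemma keepsV E f s : keeps E f s -> keeps E f s^-1%g.
Proof.
(* The inverse is a power of [s], so closure under products suffices. *)
move=> ks; rewrite -(mulg1 s^-1%g) -(expg_order s).
have -> : (s^-1 * s ^+ #[s] = s ^+ #[s].-1)%g.
  by rewrite -{1}(prednK (order_gt0 s)) expgS mulKg.
by elim: (_.-1) => [|m IH]; rewrite ?keeps1 // expgS; apply: keepsM.
Qed.

Lemma keepsMr E f s t : keeps E f t -> keeps E f (s * t)%g = keeps E f s.
Proof.
by move=> kt; apply/idP/idP => ks; [rewrite -(mulgK t s)|]; apply: keepsM => //; apply: keepsV.
Qed.

Lemma keepsMl E f s t : keeps E f s -> keeps E f (s * t)%g = keeps E f t.
Proof.
by move=> ks; apply/idP/idP => kt; [rewrite -(mulKg s t)|]; apply: keepsM => //; apply: keepsV.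
Qed.

Lemma keepsVE E f s : keeps E f s^-1%g = keeps E f s.
Proof. by apply/idP/idP => /keepsV; rewrite ?invgK. Qed.

Lemma keeps_conj E f s g :
  keeps (fun p => E (iv g p)) (fun p => f (iv g p)) (s ^ g)%g = keeps E f s.
Proof.
apply/keepsP/keepsP => [[H1 H2]|[H1 H2]]; split=> p Ep.
- have := H1 (g p); rewrite permJ !permK; exact.
- by have := H2 (g p); rewrite permJ permK => /(_ Ep) /perm_inj.
- by rewrite -(permKV g p) permJ !permK; apply: H1.
- by rewrite -{1}(permKV g p) permJ H2 // permKV.
Qed.

Lemma keeps_tperm E f p q : E p -> E q -> f p = f q -> keeps E f (tperm p q).
Proof.
move=> Ep Eq fpq; apply/keepsP; split=> x Ex; case: tpermP => // Exy; subst => //.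
- by rewrite Ep in Ex.
- by rewrite Eq in Ex.
Qed.

(* A filling of the Young diagram of [lam] by the positions in [E], given by the
   row and the column of each position. *)
Definition diagram E (ro co : 'I_k -> nat) (lam : nat -> nat) :=
  [/\ forall p, E p -> (co p < lam (ro p))%N,
      forall p q, E p -> E q -> ro p = ro q -> co p = co q -> p = q &
      forall i j, (j < lam i)%N -> exists2 p, E p & ro p = i /\ co p = j].

Section Fill.

Variables (E : pred 'I_k) (ro co : 'I_k -> nat) (lam : nat -> nat).
Hypothesis lam_noninc : forall i j, (i <= j)%N -> (lam j <= lam i)%N.
Hypothesis dgm : diagram E ro co lam.

Lemma card_row j : #|[pred p | E p & ro p == j]| = lam j.
Proof.
have [d1 d2 d3] := dgm.
rewrite cardE -(size_map co) -[RHS](size_iota 0); apply: perm_size.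
apply: uniq_perm; rewrite ?iota_uniq //.
  rewrite map_inj_in_uniq ?enum_uniq // => p q; rewrite !mem_enum !inE.
  by move=> /andP [Ep /eqP rp] /andP [Eq /eqP rq]; apply: d2 => //; rewrite rp rq.
move=> c; rewrite mem_iota add0n /=; apply/mapP/idP => [[p]|/d3 [p Ep [rp cp]]].
  by rewrite mem_enum inE => /andP [/d1 + /eqP <-] ->.
by exists p => //; rewrite mem_enum inE Ep rp eqxx.
Qed.

(* Letters with distinct values in each column: the letters below i fill the
   cells of the first columns, so a letter i cannot sit beyond column lam i. *)
Lemma fill (w : 'I_k -> nat) (i : nat) :
  (forall p q, E p -> E q -> p != q -> co p = co q -> w p <> w q) ->
  (forall j, (j < i)%N -> #|[pred p | E p & w p == j]| = lam j) ->
  forall p, E p -> w p = i -> (co p < lam i)%N.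
Proof.
have [d1 d2 d3] := dgm.
move=> wcol; elim/ltn_ind: i => i IH wcnt p Ep wp.
have full j c : (j < i)%N -> (c < lam j)%N -> exists2 q, E q & w q = j /\ co q = c.
  move=> ji cj; set A := [pred p | E p & w p == j].
  have uA : uniq [seq co q | q <- enum A].
    rewrite map_inj_in_uniq ?enum_uniq // => q q'; rewrite !mem_enum !inE.
    move=> /andP [Eq /eqP wq] /andP [Eq' /eqP wq'] cq.
    by apply/eqP; apply/negPn/negP => qq'; apply: (wcol q q'); rewrite ?wq.
  have [] := @uniq_min_size _ [seq co q | q <- enum A] (iota 0 (lam j)) uA.
  - move=> x /mapP [q]; rewrite mem_enum inE => /andP [Eq /eqP wq] ->.
    rewrite mem_iota /=; apply: (IH j ji) => // j' j'j; apply: wcnt; exact: ltn_trans ji.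
  - by rewrite size_iota size_map -cardE wcnt.
  - move=> _ /(_ c); rewrite mem_iota /= cj => /mapP [q]; rewrite mem_enum inE.
    by move=> /andP [Eq /eqP wq] ->; exists q.
rewrite ltnNge; apply/negP => lc.
set c := co p in lc.
pose col := [pred q | E q & co q == c].
pose J := [seq j <- iota 0 i | (c < lam j)%N].
have cJ : (size [seq ro q | q <- enum col] <= size J)%N.
  apply: uniq_leq_size.
    rewrite map_inj_in_uniq ?enum_uniq // => q q'; rewrite !mem_enum !inE.
    by move=> /andP [Eq /eqP wq] /andP [Eq' /eqP wq'] rq; apply: d2 => //; rewrite wq.
  move=> x /mapP [q]; rewrite mem_enum inE => /andP [/d1 + /eqP cq] ->; rewrite cq => lq.
  rewrite mem_filter lq mem_iota /= add0n ltnNge; apply/negP => /lam_noninc.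
  by move/(leq_trans lq); rewrite ltnNge lc.
have : (size (i :: J) <= size [seq w q | q <- enum col])%N.
  apply: uniq_leq_size.
    by rewrite /= filter_uniq ?iota_uniq // mem_filter mem_iota add0n ltnn !andbF.
  move=> j; rewrite inE => /predU1P [->|].
    by apply/mapP; exists p => //; rewrite mem_enum inE Ep eqxx.
  rewrite mem_filter mem_iota /= add0n => /andP [cj ji].
  have [q Eq [wq cq]] := full j c ji cj.
  by apply/mapP; exists q => //; rewrite mem_enum inE Eq cq eqxx.
by rewrite size_map /=; rewrite size_map in cJ; rewrite ltnNge cJ.
Qed.

Lemma fill_card (w : 'I_k -> nat) (i : nat) :
  (forall p q, E p -> E q -> p != q -> co p = co q -> w p <> w q) ->
  (forall j, (j < i)%N -> #|[pred p | E p & w p == j]| = lam j) ->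
  (#|[pred p | E p & w p == i]| <= lam i)%N.
Proof.
move=> wcol wcnt; rewrite cardE -(size_map co) -[lam i](size_iota 0).
apply: uniq_leq_size.
  rewrite map_inj_in_uniq ?enum_uniq // => q q'; rewrite !mem_enum !inE.
  move=> /andP [Eq /eqP wq] /andP [Eq' /eqP wq'] cq.
  by apply/eqP; apply/negPn/negP => qq'; apply: (wcol q q'); rewrite ?wq.
move=> x /mapP [q]; rewrite mem_enum inE => /andP [Eq /eqP wq] ->.
by rewrite mem_iota /=; apply: (fill wcol wcnt).
Qed.

Lemma supported_card (f : 'I_k -> nat) g j : supported E g ->
  #|[pred p | E p & f (g p) == j]| = #|[pred p | E p & f p == j]|.
Proof.
move/keepsP => [g1 g2].
rewrite -(card_image (@perm_inj _ g)); apply: eq_card => q; rewrite [RHS]inE.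
apply/imageP/andP => [[p]|[Eq fq]].
  by rewrite inE => /andP [/g1 [Ep _] fp] ->.
exists (iv g q); rewrite ?permKV // inE permKV fq andbT.
by apply/negPn/negP => N; have := g2 _ N; rewrite permKV => Eg; rewrite -Eg Eq in N.
Qed.

(** The combinatorial core of von Neumann's lemma. The column permutation [s] moves each position
    within its column to the row into which [g] sends it; [fill] guarantees that this cell
    exists. *)
Lemma row_col_factor g : supported E g ->
  (forall p q, E p -> E q -> p != q -> co p = co q -> ro (g p) <> ro (g q)) ->
  exists2 s, keeps E co s & keeps E ro (s^-1 * g)%g.
Proof.
have [d1 d2 d3] := dgm; move=> gE gcol; have /keepsP [g1 g2] := gE.
have cell p : E p -> (co p < lam (ro (g p)))%N.
  move=> Ep; apply: (@fill (fun p => ro (g p))) => // j _.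
  by rewrite supported_card // card_row.
have ex p : exists q, if E p then [&& E q, ro q == ro (g p) & co q == co p] else q == p.
  case: (boolP (E p)) => [/cell /d3 [q Eq [rq cq]]|_]; last by exists p.
  by exists q; rewrite Eq rq cq !eqxx.
have [f fP] : exists f : 'I_k -> 'I_k, forall p,
    if E p then [&& E (f p), ro (f p) == ro (g p) & co (f p) == co p] else f p == p.
  by exists (fun p => xchoose (ex p)) => p; apply: (xchooseP (ex p)).
have fE p : E p -> [/\ E (f p), ro (f p) = ro (g p) & co (f p) = co p].
  by move=> Ep; have := fP p; rewrite Ep => /and3P [? /eqP ? /eqP].
have fN p : ~~ E p -> f p = p.
  by move=> Ep; have := fP p; rewrite (negPf Ep) => /eqP.
have finj : injective f.
  move=> p q fpq; case: (boolP (E p)) (boolP (E q)) => Ep [] Eq.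
  - have [_ rp cp] := fE _ Ep; have [_ rq cq] := fE _ Eq.
    apply/eqP/negPn/negP => /(gcol _ _ Ep Eq); rewrite -cp -cq fpq -rp -rq fpq.
    by move=> /(_ erefl).
  - by have [+ _ _] := fE _ Ep; rewrite fpq fN // (negPf Eq).
  - by have [+ _ _] := fE _ Eq; rewrite -fpq fN // (negPf Ep).
  - by rewrite -(fN _ Ep) -(fN _ Eq).
have kf : keeps E co (perm finj).
  apply/keepsP; split=> p Ep; rewrite permE; last exact: fN.
  by have [-> _ ->] := fE _ Ep.
exists (perm finj) => //; have /keepsP [k1 k2] := keepsV kf.
apply/keepsP; split=> p Ep; rewrite permM.
  have [Eq _] := k1 p Ep; have [Egq _] := g1 _ Eq; split=> //.
  have [_ <- _] := fE _ Eq; congr ro.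
  by have := permKV (perm finj) p; rewrite permE.
by rewrite k2 // g2.
Qed.

End Fill.

End PositionPermutations.

(** * Young symmetrizers in a representation of the symmetric group *)

Section Symmetrizers.

Variables (F : fieldType) (k : nat) (V : lmodType F) (pi : 'S_k -> V -> V).
Hypothesis char0 : [pchar F] =i pred0.
Hypothesis pi_linear : forall s, linear (pi s).
Hypothesis piM : forall s t v, pi s (pi t v) = pi (t * s)%g v.
Hypothesis pi1 : forall v, pi 1%g v = v.
Implicit Types (E : pred 'I_k) (ro co f : 'I_k -> nat) (s t g : 'S_k) (v : V).

Definition rowsym E ro v : V := \sum_(s | keeps E ro s) pi s v.
Definition colsym E co v : V := \sum_(s | keeps E co s) ((-1) ^+ odd_perm s : F) *: pi s v.

Lemma pi0 s : pi s 0 = 0.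
Proof. by have := pi_linear s (-1) 0 0; rewrite !scaleN1r addr0 oppr0 addNr. Qed.
Lemma piZ s a v : pi s (a *: v) = a *: pi s v.
Proof. by have := pi_linear s a v 0; rewrite pi0 !addr0. Qed.
Lemma piD s v w : pi s (v + w) = pi s v + pi s w.
Proof. by have := pi_linear s 1 v w; rewrite !scale1r. Qed.
Lemma pi_sum s (I : Type) (r : seq I) (P : pred I) (x : I -> V) :
  pi s (\sum_(i <- r | P i) x i) = \sum_(i <- r | P i) pi s (x i).
Proof. exact: (big_morph _ (piD s) (pi0 s)). Qed.

Lemma rowsym_linear E ro : linear (rowsym E ro).
Proof.
move=> a v w; rewrite /rowsym scaler_sumr -big_split /=.
by apply: eq_bigr => s _; rewrite pi_linear.
Qed.

Lemma colsym_linear E co : linear (colsym E co).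
Proof.
move=> a v w; rewrite /colsym scaler_sumr -big_split /=.
by apply: eq_bigr => s _; rewrite pi_linear scalerDr !scalerA mulrC.
Qed.

Lemma pi_rowsym E ro s v : keeps E ro s -> pi s (rowsym E ro v) = rowsym E ro v.
Proof.
move=> ks; rewrite /rowsym pi_sum [RHS](reindex_inj (mulIg s)) /=.
by apply: eq_big => t; rewrite ?keepsMr // piM.
Qed.

Lemma sign_sq (b : bool) : ((-1) ^+ b * (-1) ^+ b : F) = 1.
Proof. by rewrite -signr_addb addbb. Qed.

Lemma colsym_pi E co s v : keeps E co s ->
  colsym E co (pi s v) = (-1) ^+ odd_perm s *: colsym E co v.
Proof.
move=> ks; rewrite /colsym scaler_sumr [RHS](reindex_inj (mulgI s)) /=.
apply: eq_big => t; rewrite ?keepsMl // => kt.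
by rewrite piM scalerA odd_permM signr_addb mulrA sign_sq mul1r.
Qed.

Lemma rowsym_rowsym E ro v :
  rowsym E ro (rowsym E ro v) = #|[pred s | keeps E ro s]|%:R *: rowsym E ro v.
Proof.
rewrite {1}/rowsym (eq_bigr (fun=> rowsym E ro v)); last by move=> s /pi_rowsym.
by rewrite sumr_const scaler_nat.
Qed.

Lemma card_keeps_neq0 E f : (#|[pred s | keeps E f s]|%:R : F) != 0.
Proof.
apply: natr_char0_neq0 => //; apply/card_gt0P; exists 1%g.
by rewrite inE keeps1.
Qed.

Lemma colsym_fixed E co t v : keeps E co t -> odd_perm t -> pi t v = v ->
  colsym E co v = 0.
Proof.
move=> kt ot tv; have := colsym_pi v kt; rewrite tv ot expr1 scaleN1r => /eqP.
rewrite -addr_eq0 -mulr2n -scaler_nat scaler_eq0.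
by rewrite (negPf (natr_char0_neq0 char0 _)) => // /eqP.
Qed.

Lemma colsym_rowsym0 E ro co p q v :
  E p -> E q -> p != q -> ro p = ro q -> co p = co q ->
  colsym E co (rowsym E ro v) = 0.
Proof.
move=> Ep Eq pq rpq cpq; apply: (@colsym_fixed _ _ (tperm p q)).
- exact: keeps_tperm.
- by rewrite odd_tperm.
- by apply/pi_rowsym/keeps_tperm.
Qed.

Lemma pi_rowsym_conj E ro g v : pi g (rowsym E ro v) =
  rowsym (fun p => E (iv g p)) (fun p => ro (iv g p)) (pi g v).
Proof.
rewrite /rowsym pi_sum [RHS](reindex_inj (conjg_inj g)) /=.
by apply: eq_big => s; rewrite ?keeps_conj // !piM conjgE !mulgA mulgV mul1g.
Qed.

Lemma pi_colsym_conj E co g v : pi g (colsym E co v) =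
  colsym (fun p => E (iv g p)) (fun p => co (iv g p)) (pi g v).
Proof.
rewrite /colsym pi_sum [RHS](reindex_inj (conjg_inj g)) /=.
apply: eq_big => s; rewrite ?keeps_conj // !piM piZ piM conjgE !mulgA mulgV mul1g.
by rewrite !odd_permM odd_permV addbAC addbb.
Qed.

Lemma eq_rowsym E E' ro ro' v : E =1 E' -> (forall p, E p -> ro p = ro' p) ->
  rowsym E ro v = rowsym E' ro' v.
Proof. by move=> EE' rr; apply: eq_bigl => s; apply: eq_keeps. Qed.

Lemma eq_colsym E E' co co' v : E =1 E' -> (forall p, E p -> co p = co' p) ->
  colsym E co v = colsym E' co' v.
Proof. by move=> EE' rr; apply: eq_bigl => s; apply: eq_keeps. Qed.

Section Adjoint.

Variable dt : V -> V -> F.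
Hypothesis dtl : forall w, scalar (fun v => dt v w).
Hypothesis dtr : forall v, scalar (dt v).
Hypothesis dt_pi : forall s v w, dt (pi s v) w = dt v (pi (s^-1)%g w).

Lemma dt0l w : dt 0 w = 0.
Proof. by have := dtl w (-1) 0 0; rewrite scaleN1r addr0 oppr0 mulN1r addNr. Qed.
Lemma dt0r v : dt v 0 = 0.
Proof. by have := dtr v (-1) 0 0; rewrite scaleN1r addr0 oppr0 mulN1r addNr. Qed.
Lemma dtDl v1 v2 w : dt (v1 + v2) w = dt v1 w + dt v2 w.
Proof. by have := dtl w 1 v1 v2; rewrite scale1r mul1r. Qed.
Lemma dtDr v w1 w2 : dt v (w1 + w2) = dt v w1 + dt v w2.
Proof. by have := dtr v 1 w1 w2; rewrite scale1r mul1r. Qed.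
Lemma dtZl a v w : dt (a *: v) w = a * dt v w.
Proof. by have := dtl w a v 0; rewrite dt0l !addr0. Qed.
Lemma dtZr a v w : dt v (a *: w) = a * dt v w.
Proof. by have := dtr v a w 0; rewrite dt0r !addr0. Qed.

Lemma colsym_adj E co v w : dt (colsym E co v) w = dt v (colsym E co w).
Proof.
rewrite /colsym (big_morph (dt^~ w) (fun x y => dtDl x y w) (dt0l w)).
rewrite (big_morph (dt v) (dtDr v) (dt0r v)).
rewrite [RHS](reindex_inj invg_inj) /=; apply: eq_big => s; first by rewrite keepsVE.
by rewrite dtZl dtZr dt_pi odd_permV.
Qed.

Lemma rowsym_adj E ro v w : dt (rowsym E ro v) w = dt v (rowsym E ro w).
Proof.
rewrite /rowsym (big_morph (dt^~ w) (fun x y => dtDl x y w) (dt0l w)).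
rewrite (big_morph (dt v) (dtDr v) (dt0r v)).
rewrite [RHS](reindex_inj invg_inj) /=; apply: eq_big => s; first by rewrite keepsVE.
by rewrite dt_pi.
Qed.

End Adjoint.

Section Diagram.

Variables (E : pred 'I_k) (ro co : 'I_k -> nat) (lam : nat -> nat).
Hypothesis lam_noninc : forall i j, (i <= j)%N -> (lam j <= lam i)%N.
Hypothesis dgm : diagram E ro co lam.

(** Von Neumann's lemma. Either two positions of one column share a row of the filling moved by [g],
    and their transposition kills the product, or [g^-1] is a product of a column and a row
    permutation, which leaves only a sign. *)
Lemma colsym_pi_rowsym g : supported E g ->
  exists c : F, forall v, colsym E co (pi g (rowsym E ro v)) = c *: colsym E co (rowsym E ro v).
Proof.
move=> gE; have g'E := keepsV gE.
have [/existsP [p /existsP [q /and5P [Ep Eq pq /eqP cpq /eqP rpq]]]|N] :=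
  boolP [exists p, exists q, [&& E p, E q, p != q, co p == co q & ro (iv g p) == ro (iv g q)]].
  exists 0 => v; rewrite scale0r pi_rowsym_conj.
  rewrite -(@eq_colsym (fun p => E (iv g p)) E co) //; last first.
    move=> p0; apply/idP/idP => H; last by have /keepsP [/(_ _ H) []] := g'E.
    by have /keepsP [/(_ _ H) [+ _] _] := gE; rewrite permKV.
  apply: (@colsym_rowsym0 _ _ _ p q) => //.
    by have /keepsP [/(_ _ Ep) []] := g'E.
  by have /keepsP [/(_ _ Eq) []] := g'E.
have [||s ks kr] := row_col_factor lam_noninc dgm (g := g^-1%g).
- exact: g'E.
- move=> p q Ep Eq pq cpq /eqP rpq; case/negP: N.
  by apply/existsP; exists p; apply/existsP; exists q; rewrite Ep Eq pq cpq rpq eqxx.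
- exists ((-1) ^+ odd_perm s) => v.
  have -> : g = ((s^-1 * g^-1)^-1 * s^-1)%g by rewrite invMg !invgK mulgK.
  by rewrite -piM colsym_pi ?keepsV // pi_rowsym ?keepsV // odd_permV.
Qed.

(** Operators come with a weighted list of permutations so that the scalars extracted from them are
    the same for all vectors. *)
Definition in_group_algebra (op : V -> V) := exists r : seq (F * 'S_k),
  all (fun x => supported E x.2) r /\ forall v, op v = \sum_(x <- r) x.1 *: pi x.2 v.

Lemma in_group_algebra_comp op1 op2 :
  in_group_algebra op1 -> in_group_algebra op2 -> in_group_algebra (fun v => op1 (op2 v)).
Proof.
move=> [r1 [r1E H1]] [r2 [r2E H2]].
exists [seq (x.1 * y.1, (y.2 * x.2)%g) | x <- r1, y <- r2]; split.
  apply/allP => _ /allpairsP [[x y] [/= xr yr ->]] /=.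
  by apply: keepsM; [apply: (allP r2E)|apply: (allP r1E)].
move=> v; rewrite H1 big_allpairs_dep; apply: eq_bigr => x _.
by rewrite H2 pi_sum scaler_sumr; apply: eq_bigr => y _; rewrite piZ piM scalerA.
Qed.

Lemma in_group_algebra_pi g : supported E g -> in_group_algebra (pi g).
Proof.
by move=> gE; exists [:: (1, g)]; rewrite /= gE; split=> // v; rewrite big_seq1 scale1r.
Qed.

Lemma in_group_algebra_rowsym f : in_group_algebra (rowsym E f).
Proof.
exists [seq (1, s) | s <- enum [pred s | keeps E f s]]; split.
  by apply/allP => _ /mapP [s + ->] /=; rewrite mem_enum => /keeps_supported.
move=> v; rewrite big_map big_enum /=; apply: eq_bigr => s _; exact/esym/scale1r.
Qed.

Lemma in_group_algebra_colsym f : in_group_algebra (colsym E f).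
Proof.
exists [seq ((-1) ^+ odd_perm s, s) | s <- enum [pred s | keeps E f s]]; split.
  by apply/allP => _ /mapP [s + ->] /=; rewrite mem_enum => /keeps_supported.
by move=> v; rewrite big_map big_enum.
Qed.

Lemma colsym_alg_rowsym op : in_group_algebra op ->
  exists c : F, forall v, colsym E co (op (rowsym E ro v)) = c *: colsym E co (rowsym E ro v).
Proof.
have L := colsym_linear E co.
move=> [r [+ Hop]].
suff: all (fun x => supported E x.2) r -> exists c : F, forall v,
    colsym E co (\sum_(x <- r) x.1 *: pi x.2 (rowsym E ro v)) = c *: colsym E co (rowsym E ro v).
  by move=> + rE => /(_ rE) [c Hc]; exists c => v; rewrite Hop.
elim: r {Hop} => [_|x r IH /= /andP [xE /IH [c Hc]]].
  exists 0 => v; rewrite big_nil scale0r /colsym big1 // => s _.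
  by rewrite pi0 scaler0.
have [d Hd] := colsym_pi_rowsym xE.
by exists (x.1 * d + c) => v; rewrite big_cons L Hd Hc scalerA scalerDl.
Qed.

(** The self-adjoint variant R C R of the Young symmetrizer R C. *)
Definition young2 v := rowsym E ro (colsym E co (rowsym E ro v)).

Lemma rowsymZ f a v : rowsym E f (a *: v) = a *: rowsym E f v.
Proof. by rewrite /rowsym scaler_sumr; apply: eq_bigr => s _; rewrite piZ. Qed.

(** The product is R C (R g R C) R, and the bracketed factor lies in the group algebra, so that C (R
    g R C) R is a multiple of C R. *)
Lemma young2_pi_young2 g : supported E g ->
  exists c : F, forall v, young2 (pi g (young2 v)) = c *: young2 v.
Proof.
move=> gE.
have [c Hc] := colsym_alg_rowsym (in_group_algebra_comp (in_group_algebra_rowsym ro)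
  (in_group_algebra_comp (in_group_algebra_pi gE)
  (in_group_algebra_comp (in_group_algebra_rowsym ro) (in_group_algebra_colsym co)))).
by exists c => v; rewrite /young2 Hc rowsymZ.
Qed.

Lemma colrow_colrow : exists c : F, forall v,
  colsym E co (rowsym E ro (colsym E co (rowsym E ro v))) = c *: colsym E co (rowsym E ro v).
Proof.
have [c Hc] := colsym_alg_rowsym
  (in_group_algebra_comp (in_group_algebra_rowsym ro) (in_group_algebra_colsym co)).
by exists c.
Qed.

(* At the first row where the shapes differ the longer row of the second diagram
   cannot be spread over distinct columns of the first one. *)
Lemma colsym_pi_rowsym_shape ro' co' (lam' : nat -> nat) i g v :
  diagram E ro' co' lam' -> (forall j, (j < i)%N -> lam j = lam' j) ->
  (lam i < lam' i)%N -> supported E g -> colsym E co (pi g (rowsym E ro' v)) = 0.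
Proof.
move=> dgm' ll' li gE; have g'E := keepsV gE.
have cnt j : #|[pred p | E p & ro' (iv g p) == j]| = lam' j.
  by rewrite supported_card // (card_row dgm').
have [/existsP [p /existsP [q /and5P [Ep Eq pq /eqP cpq /eqP rpq]]]|N] :=
  boolP [exists p, exists q, [&& E p, E q, p != q, co p == co q & ro' (iv g p) == ro' (iv g q)]].
  rewrite pi_rowsym_conj.
  rewrite -(@eq_colsym (fun p => E (iv g p)) E co) //; last first.
    move=> p0; apply/idP/idP => H; last by have /keepsP [/(_ _ H) []] := g'E.
    by have /keepsP [/(_ _ H) [+ _] _] := gE; rewrite permKV.
  apply: (@colsym_rowsym0 _ _ _ p q) => //.
    by have /keepsP [/(_ _ Ep) []] := g'E.
  by have /keepsP [/(_ _ Eq) []] := g'E.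
have := fill_card lam_noninc dgm (w := fun p => ro' (iv g p)) (i := i).
rewrite cnt leqNgt li => H; suff: false by []; apply: H => [p q Ep Eq pq cpq /eqP rpq|j ji].
  case/negP: N; apply/existsP; exists p; apply/existsP; exists q.
  by rewrite Ep Eq pq cpq rpq eqxx.
by rewrite cnt ll'.
Qed.

End Diagram.

End Symmetrizers.

(** * Highest weight vectors and polytabloids *)

Section Words.

Variables (F : fieldType) (k n : nat).
Hypothesis char0 : [pchar F] =i pred0.

Definition word : finType := {ffun 'I_k -> 'I_n}.
Definition wordfun : vectType F := {ffun word -> F^o}.

Implicit Types (E : pred 'I_k) (ro co : 'I_k -> nat) (g : wordfun) (a b : word).

Definition wperm (s : 'S_k) (g : wordfun) : wordfun := [ffun a : word => g [ffun p => a (s p)]].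

Lemma wperm_linear s : linear (wperm s).
Proof. by move=> c g1 g2; apply/ffunP => a; rewrite !ffunE. Qed.

Lemma wpermM s t g : wperm s (wperm t g) = wperm (t * s)%g g.
Proof. by apply/ffunP => a; rewrite !ffunE; congr (g _); apply/ffunP => p; rewrite !ffunE permM. Qed.

Lemma wperm1 g : wperm 1%g g = g.
Proof. by apply/ffunP => a; rewrite !ffunE; congr (g _); apply/ffunP => p; rewrite !ffunE perm1. Qed.

Notation wrow := (rowsym wperm).
Notation wcol := (colsym wperm).

(** The letters off [E] are left free: the function is then [local] and can be combined with caps on
    those positions. *)
Definition rowword E ro : wordfun :=
  [ffun a : word => if [forall p, E p ==> (val (a p) == ro p)] then 1 else 0].

Definition polytab E ro co : wordfun := wrow E ro (wcol E co (rowword E ro)).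

Definition local E g := forall a b, (forall p, E p -> a p = b p) -> g a = g b.

(** The matrix unit E_ij acting on the positions in [E], in coordinates; for [j = i + 1] it is a
    simple raising operator. *)
Definition raise E (i j : 'I_n) g : wordfun :=
  [ffun a : word => \sum_(p | E p && (a p == i)) g (upd a p j)].

Definition highest E g := forall i j : 'I_n, val j = i.+1 -> raise E i j g = 0.

Definition has_weight E (lam : nat -> nat) g := forall a, g a != 0 ->
  forall i : 'I_n, #|[pred p | E p & a p == i]| = lam i.

(** Known as ballot or Yamanouchi words: recording the row of each entry of a standard tableau gives
    a word of this kind. *)
Definition lattice E a := [forall m : 'I_k.+1, forall i : 'I_n, forall j : 'I_n, (val j == i.+1) ==>
  (#|[pred q : 'I_k | [&& E q, (q < m)%N & a q == j]]| <= #|[pred q : 'I_k | [&& E q, (q < m)%N & a q == i]]|)%N].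

Lemma raise_linear E i j : linear (raise E i j).
Proof.
move=> c g1 g2; apply/ffunP => a; rewrite !ffunE scaler_sumr -big_split /=.
by apply: eq_bigr => p _; rewrite !ffunE.
Qed.

(* The lexicographically largest word (read from the end) of a highest weight
   vector is a lattice word: at a first violation the prefix would be a highest
   weight vector lying above the middle of a Boolean lattice. *)
Lemma highest_lattice E g : highest E g -> g <> 0 -> exists2 a, g a != 0 & lattice E a.
Proof.
move=> hg g0.
have [|a ga amax] := @lex_max_rev k n (fun a => g a != 0).
  apply: NNPP => N; apply: g0; apply/ffunP => a; rewrite ffunE; apply/eqP/negPn/negP => ga.
  by apply: N; exists a.
exists a => //; apply/forallP => m; apply/forallP => i; apply/forallP => j; apply/implyP => /eqP ji.
rewrite leqNgt; apply/negP => viol.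
have nij : (i == j) = false by apply/eqP => E1; move: ji; rewrite E1 /=; lia.
have nji : (j == i) = false by rewrite eq_sym.
pose X := [set q : 'I_k | [&& E q, (q < m)%N & (a q == i) || (a q == j)]].
pose S0 := [set q : 'I_k | [&& E q, (q < m)%N & a q == j]].
pose wd (S : {set 'I_k}) : word := [ffun q => if q \in X then (if q \in S then j else i) else a q].
have wd0 : wd S0 = a.
  apply/ffunP => q; rewrite ffunE !inE; case: ifP => // /and3P [-> -> /=].
  by case: eqP => [->|_] /=; rewrite ?nij // => /eqP ->; rewrite eqxx.
have S0X : S0 \subset X by apply/subsetP => q; rewrite !inE => /and3P [-> -> ->]; rewrite orbT.
(* With [j] written on [S] and [i] on the rest of [X], the highest weight equations become those of
   [subset_sum_vanish]; the violation says that [S0] fills more than half of [X]. *)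
suff : g (wd S0) = 0 by rewrite wd0 => E0; rewrite E0 eqxx in ga.
apply: (@subset_sum_vanish F _ X (fun S => g (wd S))) => // [S SX|]; last first.
  have -> : #|X| = (#|S0| + #|[pred q : 'I_k | [&& E q, (q < m)%N & a q == i]]|)%N.
    rewrite -[in LHS](cardsID S0 X) (setIidPr S0X); congr (_ + _)%N.
    rewrite -cardsE; apply: eq_card => q; rewrite !inE.
    case: (E q) => //=; case: (q < m)%N => //=.
    by case: eqP => [->|] /=; rewrite ?nij ?andbT ?andNb // => _; case: eqP.
  by rewrite cardsE mulSn mul1n ltn_add2l.
have := congr1 (fun f : wordfun => f (wd S)) (hg i j ji); rewrite !ffunE.
rewrite (bigID (fun p => p \in X)) /= [X in _ + X]big1 ?addr0 => [E1|p /andP [/andP [Ep wp] pX]].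
  rewrite -[RHS]E1. 
  apply: eq_big => [q|q /setDP [qX qS]].
    rewrite !inE ffunE inE; case: (boolP [&& E q, (q < m)%N & (a q == i) || (a q == j)]) => //=.
      by move=> /and3P [-> _ _]; case: (q \in S); rewrite ?andbF ?andbT //= ?eqxx ?nji.
    by rewrite !andbF.
  congr (g _); apply/ffunP => r; rewrite !ffunE in_setU1.
  by case: (r =P q) => [->|_] //=; rewrite qX.
move: wp; rewrite ffunE (negPf pX) => /eqP wp.
(* Raising beyond the prefix would put into the support a word larger than [a] when read from the
   end. *)
have mp : (m <= p)%N by rewrite leqNgt; apply: contra pX => pm; rewrite inE Ep pm wp eqxx.
apply/eqP/negPn/negP => gne.
have := amax p _ gne; rewrite ffunE eqxx ji wp ltnn => H; suff: false by [].
apply: H => q pq; rewrite !ffunE.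
have -> : (q == p) = false by apply/eqP => E1; rewrite E1 ltnn in pq.
by rewrite inE ltnNge (leq_trans mp (ltnW pq)) andbF.
Qed.

Lemma wperm_raise E s i j g : supported E s -> raise E i j (wperm s g) = wperm s (raise E i j g).
Proof.
move=> /keepsP [s1 s2]; apply/ffunP => a; rewrite !ffunE [LHS](reindex_inj (@perm_inj _ s)) /=.
have Es p : E (s p) = E p.
  apply/idP/idP => [Esp|/s1 [] //]; apply/negPn/negP => Ep.
  by rewrite s2 // (negPf Ep) in Esp.
apply: eq_big => p; first by rewrite Es !ffunE.
move=> _; rewrite !ffunE; congr (g _); apply/ffunP => q; rewrite !ffunE.
by rewrite (inj_eq perm_inj).
Qed.

Lemma wrow_raise E ro i j g : raise E i j (wrow E ro g) = wrow E ro (raise E i j g).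
Proof.
have R0 : raise E i j 0 = 0 by have := raise_linear E i j (-1) 0 0; rewrite !scaleN1r addr0 oppr0 addNr.
have RD g1 g2 : raise E i j (g1 + g2) = raise E i j g1 + raise E i j g2.
  by have := raise_linear E i j 1 g1 g2; rewrite !scale1r.
rewrite /rowsym (big_morph _ RD R0); apply: eq_bigr => s /keeps_supported; exact: wperm_raise.
Qed.

Lemma wcol_raise E co i j g : raise E i j (wcol E co g) = wcol E co (raise E i j g).
Proof.
have R0 : raise E i j 0 = 0 by have := raise_linear E i j (-1) 0 0; rewrite !scaleN1r addr0 oppr0 addNr.
have RD g1 g2 : raise E i j (g1 + g2) = raise E i j g1 + raise E i j g2.
  by have := raise_linear E i j 1 g1 g2; rewrite !scale1r.
rewrite /colsym (big_morph _ RD R0); apply: eq_bigr => s /keeps_supported sE.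
have := raise_linear E i j ((-1) ^+ odd_perm s) (wperm s g) 0; rewrite !addr0 => ->.
by rewrite R0 addr0 wperm_raise.
Qed.

Lemma local_wperm E s g : supported E s -> local E g -> local E (wperm s g).
Proof.
move=> /keepsP [s1 _] lg a b ab; rewrite !ffunE; apply: lg => p Ep; rewrite !ffunE.
by apply: ab; have [] := s1 p Ep.
Qed.

Lemma local_comb E (c : F) g1 g2 : local E g1 -> local E g2 -> local E (c *: g1 + g2).
Proof. by move=> l1 l2 a b ab; rewrite !ffunE (l1 _ _ ab) (l2 _ _ ab). Qed.

Lemma local0 E : local E 0.
Proof. by move=> a b _; rewrite !ffunE. Qed.

Lemma has_weight_comb E lam (c : F) g1 g2 :
  has_weight E lam g1 -> has_weight E lam g2 -> has_weight E lam (c *: g1 + g2).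
Proof.
move=> w1 w2 a; rewrite !ffunE => N.
have [z1|/w1 //] := eqVneq (g1 a) 0; have [z2|/w2 //] := eqVneq (g2 a) 0.
by rewrite z1 z2 scaler0 addr0 eqxx in N.
Qed.

Lemma has_weight0 E lam : has_weight E lam 0.
Proof. by move=> a; rewrite ffunE eqxx. Qed.

Lemma has_weight_wperm E lam s g : supported E s ->
  has_weight E lam g -> has_weight E lam (wperm s g).
Proof.
move=> sE wg a; rewrite ffunE => /wg H i; rewrite -[RHS]H.
rewrite -(supported_card (fun p => val (a p)) i sE); apply: eq_card => p.
by rewrite !inE ffunE.
Qed.

Lemma highest_comb E (c : F) g1 g2 : highest E g1 -> highest E g2 -> highest E (c *: g1 + g2).
Proof. by move=> h1 h2 i j ij; rewrite raise_linear h1 // h2 // scaler0 addr0. Qed.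

Lemma highest0 E : highest E 0.
Proof.
by move=> i j _; have := raise_linear E i j (-1) 0 0; rewrite !scaleN1r addr0 oppr0 addNr.
Qed.

Definition hwspace E lam g := [/\ local E g, highest E g & has_weight E lam g].

Lemma hwspace_comb E lam (c : F) g1 g2 :
  hwspace E lam g1 -> hwspace E lam g2 -> hwspace E lam (c *: g1 + g2).
Proof.
by move=> [? ? ?] [? ? ?]; split; [apply: local_comb|apply: highest_comb|apply: has_weight_comb].
Qed.

Lemma hwspace0 E lam : hwspace E lam 0.
Proof. by split; [apply: local0|apply: highest0|apply: has_weight0]. Qed.

Lemma hwspace_sum E lam (I : Type) (r : seq I) (c : I -> F) (x : I -> wordfun) :
  (forall i, hwspace E lam (x i)) -> hwspace E lam (\sum_(i <- r) c i *: x i).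
Proof.
move=> Hx; elim: r => [|i r IH]; first by rewrite big_nil; apply: hwspace0.
by rewrite big_cons; apply: hwspace_comb.
Qed.

(** * Polytabloids as highest weight vectors *)

Section Polytab.

Variables (E : pred 'I_k) (ro co : 'I_k -> nat) (lam : nat -> nat).
Hypothesis dgm : diagram E ro co lam.
Hypothesis lam_noninc : forall i j, (i <= j)%N -> (lam j <= lam i)%N.

Lemma rowword_weight : has_weight E lam (rowword E ro).
Proof.
move=> a; rewrite ffunE; case: ifP => [/forallP H _ i|]; last by rewrite eqxx.
rewrite -(card_row dgm); apply: eq_card => p; rewrite !inE.
by case: (boolP (E p)) => //= Ep; have := H p; rewrite Ep => /eqP <-; rewrite -val_eqE.
Qed.

Lemma rowword_local : local E (rowword E ro).
Proof.
move=> a b ab; rewrite !ffunE; congr (if _ then _ else _); apply: eq_forallb => p.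
by case: (boolP (E p)) => //= Ep; rewrite ab.
Qed.

Lemma has_weight_colsym g : has_weight E lam g -> has_weight E lam (wcol E co g).
Proof.
move=> wg; rewrite /colsym; apply: big_ind => [|g1 g2 w1 w2|s /keeps_supported sE].
- exact: has_weight0.
- by rewrite -[g1]scale1r; apply: has_weight_comb.
- by rewrite -[_ *: _]addr0; apply: has_weight_comb; [exact: has_weight_wperm|exact: has_weight0].
Qed.

(** Raising turns the letter at one position [p] of row [i + 1] into [i]. The cell of row [i] in the
    same column carries [i] too, so their transposition fixes the tensor and the column symmetrizer
    kills it. *)
Lemma colsym_rowword_highest : highest E (wcol E co (rowword E ro)).
Proof.
have [d1 d2 d3] := dgm.
move=> i j ij; rewrite wcol_raise.
pose G p : wordfun := [ffun a : word => if E p && (a p == i) then rowword E ro (upd a p j) else 0].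
have -> : raise E i j (rowword E ro) = \sum_p 1 *: G p.
  apply/ffunP => a; rewrite ffunE sum_ffunE big_mkcond; apply: eq_bigr => p _.
  by rewrite scale1r /G [RHS]ffunE.
have L := colsym_linear wperm_linear E co.
have C0 : wcol E co 0 = 0 by have := L (-1) 0 0; rewrite !scaleN1r addr0 oppr0 addNr.
suff H p : wcol E co (G p) = 0.
  elim: (index_enum _) => [|p r IH]; first by rewrite big_nil.
  by rewrite big_cons L H IH scaler0 addr0.
have nij : (i == j) = false by apply/eqP => E1; move: ij; rewrite E1 /=; lia.
case: (boolP (E p && (ro p == j))) => [/andP [Ep /eqP rp]|N]; last first.
  suff -> : G p = 0 by [].
  apply/ffunP => a; rewrite !ffunE; case: ifP => // /andP [Ep _]; case: ifP => // /forallP /(_ p).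
  by rewrite Ep ffunE eqxx /= eq_sym => rp; rewrite Ep rp in N.
have cp : (co p < lam i)%N.
  by apply: leq_trans (d1 p Ep) _; apply: lam_noninc; rewrite rp ij.
have [q Eq [rq cq]] := d3 _ _ cp.
have qp : q != p by apply/eqP => E1; move: rq; rewrite E1 rp ij; lia.
have fixG a : G p a != 0 -> a q = a p.
  rewrite ffunE; case: ifP; last by rewrite eqxx.
  move=> /andP [_ /eqP ->]; rewrite ffunE; case: ifP; last by rewrite eqxx.
  move=> /forallP /(_ q); rewrite Eq ffunE (negPf qp) rq => /eqP H _; exact: val_inj.
apply: (colsym_fixed char0 wpermM (t := tperm p q)).
- exact: keeps_tperm.
- by rewrite odd_tperm eq_sym.
apply/ffunP => a; rewrite [LHS]ffunE; set b := finfun _.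
have E1 : b p = a q by rewrite ffunE tpermL.
have E2 : b q = a p by rewrite ffunE tpermR.
have bE : a q = a p -> b = a.
  move=> aqp; apply/ffunP => r; rewrite ffunE.
  by case: tpermP => // ->.
have [Ga|/fixG /bE -> //] := eqVneq (G p a) 0.
have [->|/fixG H] := eqVneq (G p b) 0; first by rewrite Ga.
by rewrite bE // -E1 -E2.
Qed.

Hypothesis ron : forall p, E p -> (ro p < n)%N.

Lemma polytab_hwspace : hwspace E lam (polytab E ro co).
Proof.
have wl g : local E g -> local E (wcol E co g).
  move=> lg; rewrite /colsym; apply: big_ind => [|g1 g2 w1 w2|s /keeps_supported sE].
  - exact: local0.
  - by rewrite -[g1]scale1r; apply: local_comb.
  - by rewrite -[_ *: _]addr0; apply: local_comb; [exact: local_wperm|exact: local0].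
rewrite /polytab /rowsym; apply: big_ind => [|g1 g2 w1 w2|s /keeps_supported sE].
- exact: hwspace0.
- by rewrite -[g1]scale1r; apply: hwspace_comb.
split.
- exact/local_wperm/wl/rowword_local.
- by move=> i j ij; rewrite wperm_raise // colsym_rowword_highest //; apply/ffunP => a; rewrite !ffunE.
- exact/has_weight_wperm/has_weight_colsym/rowword_weight.
Qed.

Definition wdot (g1 g2 : wordfun) : F := \sum_a g1 a * g2 a.

Lemma wdotl g2 : scalar (fun g1 => wdot g1 g2).
Proof.
move=> c g g'; rewrite /wdot mulr_sumr -big_split /=.
by apply: eq_bigr => a _; rewrite !ffunE mulrDl mulrA.
Qed.

Lemma wdotr g1 : scalar (wdot g1).
Proof.
move=> c g g'; rewrite /wdot mulr_sumr -big_split /=.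
by apply: eq_bigr => a _; rewrite !ffunE mulrDr mulrCA.
Qed.

Lemma wdot_wperm s g1 g2 : wdot (wperm s g1) g2 = wdot g1 (wperm (s^-1)%g g2).
Proof.
pose r (a : word) : word := [ffun p => a (iv s p)].
have rinj : injective r.
  move=> a b /ffunP H; apply/ffunP => p; have := H (s p).
  by rewrite !ffunE permK.
rewrite /wdot (reindex_inj rinj); apply: eq_bigr => a _; rewrite !ffunE.
by congr (g1 _ * _); apply/ffunP => p; rewrite !ffunE permK.
Qed.

Definition integral g := forall a, exists z : int, g a = z%:~R.

Lemma integral_sum (I : Type) (r : seq I) (P : pred I) (x : I -> wordfun) :
  (forall i, P i -> integral (x i)) -> integral (\sum_(i <- r | P i) x i).
Proof.
move=> H; apply: big_ind => [a|g1 g2 h1 h2 a|//]; first by exists 0; rewrite ffunE.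
by have [z1 e1] := h1 a; have [z2 e2] := h2 a; exists (z1 + z2); rewrite ffunE e1 e2 intrD.
Qed.

Lemma polytab_integral : integral (polytab E ro co).
Proof.
apply: integral_sum => s _ a; rewrite ffunE; move: (finfun _) => {}a.
move: a; rewrite -/(integral _); apply: integral_sum => t _ a; rewrite !ffunE.
case: ifP => _; last by exists 0; rewrite /GRing.scale /= mulr0.
by exists ((-1) ^+ odd_perm t); rewrite rmorphXn rmorphN /GRing.scale /= mulr1 rmorph1.
Qed.

Lemma rowword_row : wrow E ro (rowword E ro) =
  #|[pred s | keeps E ro s]|%:R *: rowword E ro.
Proof.
rewrite /rowsym (eq_bigr (fun=> rowword E ro)); first by rewrite sumr_const scaler_nat.
move=> s /keepsP [s1 s2]; apply/ffunP => a; rewrite !ffunE; congr (if _ then _ else _).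
apply/forallP/forallP => H p; apply/implyP => Ep.
  have Es : E (iv s p).
    by apply/negPn/negP => N; have := s2 _ N; rewrite permKV => E1; rewrite -E1 Ep in N.
  have [_] := s1 _ Es; rewrite permKV => ->.
  by have := H (iv s p); rewrite Es ffunE permKV.
by rewrite ffunE; have [Es <-] := s1 _ Ep; have := H (s p); rewrite Es.
Qed.

Hypothesis n0 : (0 < n)%N.

(** Evaluation at a word equal to [ro] on [E]: for each row permutation only the identity of the
    column group contributes, since a permutation preserving rows and columns is trivial. The value
    is the order of the row group. *)
Lemma polytab_neq0 : polytab E ro co <> 0.
Proof.
have [w wE] : exists w : word, forall p, E p -> val (w p) = ro p.
  exists [ffun p => if insub (ro p) is Some i then i else Ordinal n0] => p Ep.
  by rewrite ffunE; case: insubP => [i _ -> //|]; rewrite ron.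
have [d1 d2 d3] := dgm.
move/(congr1 (fun f : wordfun => f w)); rewrite ffunE /polytab /rowsym sum_ffunE.
rewrite (eq_bigr (fun=> 1)) => [/eqP|s /keepsP [s1 s2]].
  by rewrite sumr_const (negPf (card_keeps_neq0 char0 E ro)).
rewrite ffunE /colsym sum_ffunE (bigD1 1%g) ?keeps1 //= big1 ?addr0 => [|t /andP [/keepsP [t1 t2] tn]].
  rewrite !ffunE odd_perm1 expr0 scale1r ifT //.
  apply/forallP => p; apply/implyP => Ep; rewrite !ffunE perm1.
  by have [Es <-] := s1 _ Ep; rewrite wE.
rewrite !ffunE ifF ?scaler0 //; apply/negP => /forallP H; case/eqP: tn; apply/permP => p.
rewrite perm1; case: (boolP (E p)) => [Ep|/t2 //].
have [Et cp] := t1 _ Ep; apply: d2 => //.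
have := H p; rewrite Ep !ffunE; have [Es <-] := s1 _ Et.
by rewrite wE // => /eqP.
Qed.

Lemma integral_wdot_eq0 g : integral g -> wdot g g = 0 -> g = 0.
Proof.
move=> ig g0; apply: (@int_span_nondegenerate F char0 word wordfun (fun a g => g a) _ _ [:: g]).
- by move=> a c g1 g2; rewrite !ffunE.
- by move=> g' H; apply/ffunP => a; rewrite H ffunE.
- by move=> x /[!inE] /eqP ->.
- by rewrite memv_span ?inE.
- by move=> x /[!inE] /eqP ->.
Qed.

Notation young g := (wrow E ro (wcol E co g)).

Let L := colsym_linear wperm_linear E co.
Let colZ c g : wcol E co (c *: g) = c *: wcol E co g.
Proof.
have C0 : wcol E co 0 = 0 by have := L (-1) 0 0; rewrite !scaleN1r addr0 oppr0 addNr.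
by have := L c g 0; rewrite !addr0 C0 addr0.
Qed.
Let rowZ c g : wrow E ro (c *: g) = c *: wrow E ro g := rowsymZ wperm_linear _ _ _ _.

(** For the row word w one has C R C w = h C w, which makes P = R C w an eigenvector. The square of
    P under the form is a multiple of [h], so [h = 0] would force P = 0 by integrality. *)
Lemma young_polytab : exists2 h : F, h != 0 & young (polytab E ro co) = h *: polytab E ro co.
Proof.
have R0 := card_keeps_neq0 char0 E ro; set r := _%:R in R0.
have [h Hh] := colrow_colrow char0 wperm_linear wpermM lam_noninc dgm.
have CRC : wcol E co (wrow E ro (wcol E co (rowword E ro))) = h *: wcol E co (rowword E ro).
  apply: (scalerI R0); rewrite -colZ -rowZ -colZ -rowword_row Hh rowword_row colZ.
  by rewrite !scalerA mulrC.
have YP : young (polytab E ro co) = h *: polytab E ro co by rewrite /polytab CRC rowZ.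
exists h => //; apply: contra_notN polytab_neq0 => /eqP h0.
apply: integral_wdot_eq0; first exact: polytab_integral.
rewrite /polytab (rowsym_adj wdotl wdotr wdot_wperm) (rowsym_rowsym wperm_linear wpermM).
rewrite (colsym_adj wdotl wdotr wdot_wperm) colZ CRC h0 scale0r scaler0.
by rewrite /wdot big1 // => a _; rewrite [X in _ * X]ffunE mulr0.
Qed.

End Polytab.

End Words.

(** * Standard tableaux *)

Section Tableaux.

Variable k : nat.
Implicit Types (T : seq (seq nat)) (lam : seq nat) (E : pred 'I_k).

Lemma mem_nth_flatten T x i : x \in nth [::] T i -> x \in flatten T.
Proof.
move=> xi; have [iT|Ti] := ltnP i (size T); last by rewrite nth_default in xi.
by apply/flattenP; exists (nth [::] T i) => //; apply: mem_nth.
Qed.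

Lemma rowof_nth T x i : uniq (flatten T) -> x \in nth [::] T i -> rowof T x = i.
Proof.
elim: T i => [|r T IH] [|i] //=; rewrite cat_uniq /rowof /= => /and3P [_ /hasPn rT uT] xi.
  by rewrite xi.
have /rT /negPf -> := mem_nth_flatten xi.
by congr _.+1; apply: IH.
Qed.

Lemma rowofP T x : x \in flatten T -> x \in nth [::] T (rowof T x).
Proof.
move=> /flattenP [r rT xr]; have H : has (fun r : seq nat => x \in r) T by apply/hasP; exists r.
exact: (nth_find [::] H).
Qed.

Lemma partition_noninc lam i j : is_partition lam -> (i <= j)%N -> (nth 0%N lam j <= nth 0%N lam i)%N.
Proof.
move=> /andP [/(sortedP 0%N) sl _]; elim: j => [|j IH]; first by rewrite leqn0 => /eqP ->.
rewrite leq_eqVlt => /predU1P [-> //|/IH H]; apply: leq_trans H.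
by have [/sl //|H] := ltnP j.+1 (size lam); rewrite [nth 0%N lam j.+1]nth_default.
Qed.

Lemma partition_size lam : is_partition lam -> (size lam <= sumn lam)%N.
Proof.
case/andP=> _; elim: lam => //= x l IH /andP [x0 /IH]; lia.
Qed.

Lemma partition_gt0 lam i : is_partition lam -> (0 < nth 0%N lam i)%N = (i < size lam)%N.
Proof.
move=> /andP [_ /all_nthP H]; have [iS|iS] := ltnP i (size lam); first exact: H.
by rewrite nth_default.
Qed.

Section Standard.

Variables (T : seq (seq nat)) (lam : seq nat) (E : pred 'I_k).
Hypotheses (stdT : std_tableau T lam E) (lamP : is_partition lam).

Lemma size_row i : size (nth [::] T i) = nth 0%N lam i.
Proof.
have [<- _ _ _ _] := stdT; have [iT|Ti] := ltnP i (size T); first by rewrite (nth_map [::]).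
by rewrite !nth_default ?size_map.
Qed.

Lemma std_cell i j : (j < nth 0%N lam i)%N -> exists2 p : 'I_k, E p &
  [/\ rowof T p = i, colof T p = j & val p = nth 0%N (nth [::] T i) j].
Proof.
have [_ [uT /allP bT] ET rT _] := stdT; rewrite -size_row => ji.
have xi := mem_nth 0%N ji; have xT := mem_nth_flatten xi; have xk := bT _ xT.
exists (Ordinal xk); first by rewrite -ET.
have ri := rowof_nth uT xi; rewrite /colof /= ri; split=> //.
apply: index_uniq => //; have iT : (i < size T)%N by rewrite ltnNge; apply: contraL ji => iT; rewrite nth_default.
apply: (@sorted_uniq _ ltn ltn_trans ltnn); exact: (all_nthP [::] rT).
Qed.

Lemma std_val (p : 'I_k) : E p -> val p = nth 0%N (nth [::] T (rowof T p)) (colof T p).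
Proof.
have [_ _ ET _ _] := stdT; rewrite -ET => /rowofP pr.
by rewrite /colof nth_index.
Qed.

Lemma std_diagram : diagram E (fun p => rowof T p) (fun p => colof T p) (nth 0%N lam).
Proof.
have [_ _ ET _ _] := stdT; split=> [p|p q Ep Eq rpq cpq|i j /std_cell [p Ep [rp cp _]]].
- by rewrite -ET => /rowofP; rewrite -index_mem size_row.
- by apply: val_inj; rewrite (std_val Ep) (std_val Eq) rpq cpq.
- by exists p.
Qed.

Lemma std_above (p : 'I_k) i : E p -> (i < rowof T p)%N ->
  exists q : 'I_k, [/\ E q, (q < p)%N, rowof T q = i & colof T q = colof T p].
Proof.
have [_ _ _ _ cT] := stdT; have [d1 _ _] := std_diagram.
move=> Ep ip; have cp := d1 _ Ep.
have [q Eq [rq cq vq]] := std_cell (leq_trans cp (partition_noninc lamP (ltnW ip))).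
exists q; split=> //; rewrite vq [X in (_ < X)%N](std_val Ep).
move: cp; elim: (rowof T p) ip => // r IH; rewrite ltnS leq_eqVlt => /predU1P [->|ir] cp.
  by apply: cT; rewrite size_row.
apply: ltn_trans (IH ir _) _; last by apply: cT; rewrite size_row.
by apply: leq_trans cp _; apply: partition_noninc.
Qed.

Lemma std_card : #|E| = sumn lam.
Proof.
have [<- [uT /allP bT] ET _ _] := stdT; rewrite -size_flatten cardE -(size_map val).
apply: perm_size; apply: uniq_perm => //; first by rewrite (map_inj_uniq val_inj) enum_uniq.
move=> x; apply/mapP/idP => [[p]|xT]; first by rewrite mem_enum => Ep ->; rewrite ET.
by exists (Ordinal (bT _ xT)) => //; rewrite mem_enum -topredE /= -ET.
Qed.

Lemma std_row_bound (p : 'I_k) : E p -> (rowof T p < sumn lam)%N.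
Proof.
have [d1 _ _] := std_diagram => /d1 H; apply: leq_trans (partition_size lamP).
by rewrite -partition_gt0 //; apply: leq_trans H.
Qed.

Lemma rowperm_keeps (s : 'S_k) : rowperm T s = keeps E (fun p => rowof T p) s.
Proof. by have [_ _ ET _ _] := stdT; apply: eq_forallb => p; rewrite !ET. Qed.

Lemma colperm_keeps (s : 'S_k) : colperm T s = keeps E (fun p => colof T p) s.
Proof. by have [_ _ ET _ _] := stdT; apply: eq_forallb => p; rewrite !ET. Qed.

End Standard.

Section Triangular.

Variables (T T' : seq (seq nat)) (lam : seq nat) (E : pred 'I_k).
Hypothesis stdT' : std_tableau T' lam E.
Hypothesis (lamP : is_partition lam).

(* The first entry p placed differently lies below a cell (row of p in T, column
   of p in T') which both tableaux fill with the same smaller entry. *)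
Lemma std_pair (p : 'I_k) : E p -> (rowof T p < rowof T' p)%N ->
  (forall q : 'I_k, E q -> (q < p)%N -> rowof T q = rowof T' q) ->
  exists q : 'I_k, [/\ E q, q != p, rowof T q = rowof T p & colof T' q = colof T' p].
Proof.
move=> Ep rp same; have [q [Eq qp rq cq]] := std_above stdT' lamP Ep rp.
exists q; split=> //; last by rewrite same.
by apply/eqP => E1; rewrite E1 ltnn in qp.
Qed.

End Triangular.

(** With [sorted_ltn_count_nth], this translates between prefix counts, as in [lattice], and row
    entries, as in the column condition of a standard tableau. *)
Lemma sorted_ltn_count (s : seq nat) c m : sorted ltn s -> (c < count (fun z => (z < m)%N) s)%N ->
  (c < size s)%N /\ (nth 0%N s c < m)%N.
Proof.
move=> ss cc; have cs : (c < size s)%N by apply: leq_trans cc (count_size _ _).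
split=> //; rewrite ltnNge; apply/negP => mc; move: cc; rewrite ltnNge => /negP; apply.
rewrite -(cat_take_drop c s) count_cat -[c in (_ <= c)%N]addn0; apply: leq_add.
  by apply: leq_trans (count_size _ _) _; rewrite size_take cs.
rewrite leqn0 -leqn0 leqNgt -has_count; apply/hasPn => z /(nthP 0%N) [i].
rewrite size_drop nth_drop => ic <-; rewrite -leqNgt; apply: leq_trans mc _.
rewrite leq_eqVlt; case: (posnP i) => [->|i0]; first by rewrite addn0 eqxx.
apply/orP; right; by apply: (sorted_ltn_nth ltn_trans 0%N ss); rewrite ?inE // -?ltn_subRL // -{1}[c]addn0 ltn_add2l.
Qed.

Lemma sorted_ltn_count_nth (s : seq nat) c : sorted ltn s -> (c < size s)%N ->
  (c < count (fun z => (z < (nth 0%N s c).+1)%N) s)%N.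
Proof.
move=> ss cs; rewrite -(cat_take_drop c.+1 s) count_cat.
apply: leq_trans (leq_addr _ _); rewrite -[X in (X < _)%N]/(c.+1.-1).
have -> : count (fun z => (z < (nth 0%N (take c.+1 s ++ drop c.+1 s) c).+1)%N) (take c.+1 s) = size (take c.+1 s).
  apply/eqP; rewrite -all_count; apply/(all_nthP 0%N) => i.
  rewrite size_takel // ltnS => ic; rewrite cat_take_drop nth_take ?ltnS // leq_eqVlt.
  case: (eqVneq i c) => [-> //|nic]; first by rewrite eqxx.
  apply/orP; right; by apply: (sorted_ltn_nth ltn_trans 0%N ss); rewrite ?inE //; [apply: leq_ltn_trans cs|rewrite ltn_neqAle nic].
by rewrite size_takel.
Qed.

(** Row [i] collects the positions of the letter [i], which inverts the passage from a standard
    tableau to its lattice word. *)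
Definition tab_of n E lam (a : {ffun 'I_k -> 'I_n}) : seq (seq nat) :=
  [seq [seq val p | p <- enum 'I_k & E p && (val (a p) == i)] | i <- iota 0 (size lam)].

(** * Standard tableaux from lattice words *)

Section TableauOfWord.

Variables (n : nat) (E : pred 'I_k) (lam : seq nat) (a : {ffun 'I_k -> 'I_n}).
Hypotheses (lamP : is_partition lam) (lat : lattice E a).
Hypothesis lam_n : (size lam <= n)%N.
Hypothesis cnt : forall i : 'I_n, #|[pred p | E p & a p == i]| = nth 0%N lam i.
Let T := tab_of E lam a.

Let row_bound p : E p -> (a p < size lam)%N.
Proof.
move=> Ep; rewrite -partition_gt0 // -cnt; apply/card_gt0P.
by exists p; rewrite inE Ep eqxx.
Qed.

Let nth_tab i : nth [::] T i = if (i < size lam)%N then [seq val p | p <- enum 'I_k & E p && (val (a p) == i)] else [::].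
Proof.
case: ltnP => H; last by rewrite nth_default // size_map size_iota.
by rewrite (nth_map 0%N) ?size_iota // nth_iota.
Qed.

Let mem_row (p : 'I_k) i : (val p \in nth [::] T i) = E p && (val (a p) == i).
Proof.
rewrite nth_tab; case: ifP => [_|/negP iS].
  by rewrite (mem_map val_inj) mem_filter mem_enum andbT.
by apply/esym/negP => /andP [/row_bound H /eqP H']; rewrite H' in H.
Qed.

Let row_sorted i : sorted ltn (nth [::] T i).
Proof.
rewrite nth_tab; case: ifP => // _.
have : subseq [seq val p | p <- enum 'I_k & E p && (val (a p) == i)] (iota 0 k).
  by rewrite -val_enum_ord; apply/map_subseq/filter_subseq.
by move/(subseq_sorted ltn_trans); apply; apply: iota_ltn_sorted.
Qed.

Let mem_tab (p : 'I_k) : (val p \in flatten T) = E p.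
Proof.
apply/idP/idP => [/rowofP|Ep]; first by rewrite mem_row => /andP [].
by apply: (@mem_nth_flatten _ _ (a p)); rewrite mem_row Ep eqxx.
Qed.

Let count_row (m : nat) (i : 'I_n) :
  #|[pred q : 'I_k | [&& E q, (q < m)%N & a q == i]]| = count (fun z => (z < m)%N) (nth [::] T i).
Proof.
rewrite nth_tab; case: ltnP => H.
  rewrite count_map count_filter cardE size_filter enumT; apply: eq_count => p /=.
  by rewrite !inE andbCA.
apply: eq_card0 => p; rewrite !inE; apply/negP => /and3P [/row_bound + _ /eqP E1].
by rewrite E1 ltnNge H.
Qed.

Lemma tab_of_std : std_tableau T lam E.
Proof.
split.
- apply: (@eq_from_nth _ 0%N); rewrite !size_map size_iota // => i iS.
  have iS' : (i < size T)%N by rewrite size_map size_iota.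
  have iN := leq_trans iS lam_n.
  rewrite (nth_map [::]) // -(cnt (Ordinal iN)) nth_tab iS size_map cardE size_filter enumT size_filter.
  by apply: eq_count => p; rewrite !inE.
- split; last first.
    apply/allP => x /flattenP [r /mapP [i _ ->] /mapP [p _ ->]]; exact: ltn_ord.
  have H m i : uniq (flatten [seq [seq val p | p <- enum 'I_k & E p && (val (a p) == j)] | j <- iota i m]).
    elim: m i => //= m IH i; rewrite cat_uniq IH andbT.
    rewrite (map_inj_uniq val_inj) filter_uniq ?enum_uniq //=.
    apply/hasPn => x /flattenP [r /mapP [j + ->] /mapP [p + ->]].
    rewrite mem_iota mem_filter => /andP [ij _] /andP [/andP [_ /eqP pj] _].
    rewrite (mem_map val_inj) mem_filter pj; apply/negP => /andP [/andP [_ /eqP E1] _].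
    by rewrite E1 ltnn in ij.
  exact: H.
- exact: mem_tab.
- apply/(all_nthP [::]) => i _; exact: row_sorted.
- move=> j c cj; have jS : (j.+1 < size lam)%N.
    by move: cj; rewrite nth_tab; case: (ltnP j.+1 (size lam)).
  have jn := leq_trans jS lam_n; have jn' := ltnW jn.
  pose J1 := Ordinal jn; pose J0 := Ordinal jn'.
  pose y := nth 0%N (nth [::] T j.+1) c; rewrite -/y.
  have yk : (y.+1 < k.+1)%N.
    have : y \in nth [::] T j.+1 by apply: mem_nth.
    by rewrite nth_tab jS => /mapP [p _ ->]; rewrite ltnS ltn_ord.
  (* The prefix of length [y + 1] includes the position [y] itself. It holds at least [c + 1]
     letters [j + 1], hence at least as many letters [j], so the entry above [y] is at most [y]. *)
  have := forallP (forallP (forallP lat (Ordinal yk)) J0) J1; rewrite eqxx /= !count_row /=.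
  have := sorted_ltn_count_nth (row_sorted j.+1) cj; rewrite -/y => H1 H2.
  have [c1 c2] := sorted_ltn_count (row_sorted j) (leq_trans H1 H2).
  rewrite ltn_neqAle -ltnS c2 andbT; apply/eqP => E1.
  have m0 := mem_nth 0%N c1; have m1 : y \in nth [::] T j.+1 by apply: mem_nth.
  rewrite E1 in m0; rewrite ltnS in yk; rewrite -[y]/(val (Ordinal yk)) in m0 m1.
  move: m0 m1; rewrite !mem_row => /andP [_ /eqP ->] /andP [_ /eqP]; lia.
Qed.

Lemma rowof_tab_of p : E p -> rowof T p = a p.
Proof.
by move=> Ep; have [_ [uT _] _ _ _] := tab_of_std; apply: rowof_nth => //; rewrite mem_row Ep eqxx.
Qed.

End TableauOfWord.

Lemma nth_filter_gt0 (s : seq nat) i : sorted geq s ->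
  nth 0%N [seq x <- s | (0 < x)%N] i = nth 0%N s i.
Proof.
elim: s i => //= x s IH i px; have ps := path_sorted px.
case: posnP => [x0|x0]; last by case: i => //= i; apply: IH.
have s0 y : y \in x :: s -> y = 0%N.
  rewrite inE x0 => /predU1P [//|ys]; have := order_path_min (rev_trans leq_trans) px.
  by move=> /allP /(_ _ ys) /=; rewrite x0 leqn0 => /eqP.
rewrite (_ : [seq x <- s | (0 < x)%N] = [::]).
  rewrite nth_nil; have [iS|iS] := ltnP i (size (x :: s)); last by rewrite nth_default.
  by apply/esym/s0/mem_nth.
apply/eqP; rewrite -size_eq0 size_filter -leqn0 leqNgt -has_count; apply/hasPn => y ys.
by rewrite (s0 y) // inE ys orbT.
Qed.

Lemma lattice_partition n E (a : {ffun 'I_k -> 'I_n}) : lattice E a ->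
  exists lam, [/\ is_partition lam, (size lam <= n)%N &
    forall i : 'I_n, #|[pred p | E p & a p == i]| = nth 0%N lam i].
Proof.
move=> lat; pose c (i : 'I_n) := #|[pred p | E p & a p == i]|.
pose s := [seq c i | i <- enum 'I_n].
have nths j (jn : (j < n)%N) : nth 0%N s j = c (Ordinal jn).
  rewrite (nth_map (Ordinal jn)) ?size_enum_ord //; congr c.
  by apply: val_inj; exact: nth_enum_ord.
have ss : sorted geq s.
  apply/(sortedP 0%N) => i; rewrite size_map size_enum_ord => i1.
  have i0 := ltnW i1; rewrite (nths _ i0) (nths _ i1).
  have := forallP (forallP (forallP lat ord_max) (Ordinal i0)) (Ordinal i1).
  rewrite eqxx /= /c; congr (_ <= _)%N; apply: eq_card => q; by rewrite !inE ltn_ord.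
exists [seq x <- s | (0 < x)%N]; split.
- rewrite /is_partition filter_all andbT.
  exact: (sorted_filter (rev_trans leq_trans)).
- by rewrite size_filter; apply: leq_trans (count_size _ _) _; rewrite size_map size_enum_ord.
- move=> i; rewrite nth_filter_gt0 // (nth_map i) ?size_enum_ord //.
  by rewrite /c nth_ord_enum.
Qed.

End Tableaux.

(** * Straightening *)

Section Straightening.

Variables (F : fieldType) (k n : nat) (E : pred 'I_k).
Hypotheses (char0 : [pchar F] =i pred0) (n0 : (0 < n)%N).

Notation word := (word k n).
Notation wordfun := (wordfun F k n).
Implicit Types g : wordfun.

Definition tabfun (T : seq (seq nat)) : wordfun :=
  polytab F n E (fun p => rowof T p) (fun p => colof T p).

Definition tabyoung (T : seq (seq nat)) (g : wordfun) : wordfun :=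
  rowsym (@wperm F k n) E (fun p => rowof T p)
    (colsym (@wperm F k n) E (fun p => colof T p) g).

Lemma tabyoung_linear T : linear (tabyoung T).
Proof.
move=> c g1 g2; rewrite /tabyoung (colsym_linear (@wperm_linear F k n)).
exact: (rowsym_linear (@wperm_linear F k n)).
Qed.

Lemma tabyoung0 T : tabyoung T 0 = 0.
Proof. by have := tabyoung_linear T (-1) 0 0; rewrite !scaleN1r addr0 oppr0 addNr. Qed.

Lemma tabyoungZ T c g : tabyoung T (c *: g) = c *: tabyoung T g.
Proof. by have := tabyoung_linear T c g 0; rewrite tabyoung0 !addr0. Qed.

Lemma tabyoungD T g1 g2 : tabyoung T (g1 + g2) = tabyoung T g1 + tabyoung T g2.
Proof. by have := tabyoung_linear T 1 g1 g2; rewrite !scale1r. Qed.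

Lemma tabyoung_sum T (I : Type) (r : seq I) (P : pred I) (x : I -> wordfun) :
  tabyoung T (\sum_(i <- r | P i) x i) = \sum_(i <- r | P i) tabyoung T (x i).
Proof. exact: (big_morph _ (tabyoungD T) (tabyoung0 T)). Qed.

Section FixedShape.

Variable lam : seq nat.
Hypotheses (lamP : is_partition lam) (lam_n : (size lam <= n)%N).

Lemma tabfun_hwspace T : std_tableau T lam E -> hwspace E (nth 0%N lam) (tabfun T).
Proof.
move=> stdT; apply: polytab_hwspace => //; first exact: std_diagram stdT.
by move=> i j; apply: partition_noninc.
Qed.

Lemma tabyoung_tabfun T : std_tableau T lam E ->
  exists2 h : F, h != 0 & tabyoung T (tabfun T) = h *: tabfun T.
Proof.
move=> stdT; apply: young_polytab => //; first exact: std_diagram stdT.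
  by move=> i j; apply: partition_noninc.
move=> p Ep; have [d1 _ _] := std_diagram stdT; apply: leq_trans lam_n.
by rewrite -partition_gt0 //; apply: leq_trans (d1 _ Ep).
Qed.

Lemma tabfun_neq0 T : std_tableau T lam E -> tabfun T <> 0.
Proof.
move=> stdT; apply: polytab_neq0 => //; first exact: std_diagram stdT.
move=> p Ep; have [d1 _ _] := std_diagram stdT; apply: leq_trans lam_n.
by rewrite -partition_gt0 //; apply: leq_trans (d1 _ Ep).
Qed.

(** The letter 0 off [E] singles out one representative among the words that agree on [E]. *)
Definition std_words : {set word} :=
  [set w : word | [&& lattice E w, [forall p, E p || (w p == Ordinal n0)] &
    [forall i : 'I_n, #|[pred p | E p & w p == i]| == nth 0%N lam i]]].

Notation tw w := (tab_of E lam w).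

Lemma std_word_tab w : w \in std_words ->
  std_tableau (tw w) lam E /\ forall p, E p -> rowof (tw w) p = w p.
Proof.
rewrite inE => /and3P [lw _ /forallP cw].
have cnt (i : 'I_n) : #|[pred p | E p & w p == i]| = nth 0%N lam i by apply/eqP.
by split=> [|p]; [apply: tab_of_std|apply: rowof_tab_of].
Qed.

(** This bounds the dimension from above: a nonzero highest weight vector has a lattice word in its
    support, and locality allows its letters off [E] to be normalized. *)
Lemma hwspace_eval0 g : hwspace E (nth 0%N lam) g ->
  (forall w, w \in std_words -> g w = 0) -> g = 0.
Proof.
move=> [lg hg wg] g0; apply: NNPP => gn0.
have [a ga la] := highest_lattice char0 hg gn0.
pose w : word := [ffun p => if E p then a p else Ordinal n0].
have wa p : E p -> w p = a p by move=> Ep; rewrite ffunE Ep.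
have E1 m (i : 'I_n) : #|[pred q : 'I_k | [&& E q, (q < m)%N & w q == i]]| =
    #|[pred q : 'I_k | [&& E q, (q < m)%N & a q == i]]|.
  by apply: eq_card => q; rewrite !inE; case: (boolP (E q)) => //= Eq; rewrite wa.
have wS : w \in std_words.
  rewrite inE; apply/and3P; split.
  - apply/forallP => m; apply/forallP => i; apply/forallP => j; rewrite !E1.
    exact: (forallP (forallP (forallP la m) i) j).
  - by apply/forallP => p; rewrite ffunE; case: (E p) => //=.
  - apply/forallP => i; rewrite -(wg _ ga i); apply/eqP.
    by apply: eq_card => q; rewrite !inE; case: (boolP (E q)) => //= Eq; rewrite wa.
by move/eqP: ga; apply; rewrite -(lg w) ?g0.
Qed.

(* At the lexicographically largest word w0 of the combination, the Young
   symmetrizer of w0 kills every other term. *)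
Lemma tabyoung_top (c : word -> F) w1 : w1 \in std_words -> c w1 != 0 ->
  exists w0, [/\ w0 \in std_words, c w0 != 0 &
    tabyoung (tw w0) (\sum_(w in std_words) c w *: tabfun (tw w)) =
      c w0 *: tabyoung (tw w0) (tabfun (tw w0))].
Proof.
move=> w1S cw1.
have [|w0 /andP [w0S cw0] wmax] := @lex_max k n (fun w => (w \in std_words) && (c w != 0)).
  by exists w1; rewrite w1S.
exists w0; split=> //; rewrite (bigD1 w0) //= tabyoungD tabyoungZ [X in _ + X]tabyoung_sum.
rewrite [X in _ + X]big1 ?addr0 // => w /andP [wS ww0]; rewrite tabyoungZ.
have [-> |cw] := eqVneq (c w) 0; first by rewrite scale0r.
have [std0 row0] := std_word_tab w0S; have [stdw roww] := std_word_tab wS.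
have [p0 p0w] : exists p, w p != w0 p.
  by apply/existsP; apply: contraNT ww0 => /existsPn H; apply/eqP/ffunP => p; apply/eqP/negPn.
have [p wp pmin] := @arg_minnP _ p0 (fun p => w p != w0 p) val p0w.
have lt_eq (q : 'I_k) : (q < p)%N -> w q = w0 q.
  by move=> qp; apply/eqP/negPn/negP => /pmin; rewrite leqNgt qp.
have lt_wp : (w p < w0 p)%N.
  rewrite ltn_neqAle val_eqE wp; apply: wmax => //; by rewrite wS.
have Ep : E p.
  apply/negPn/negP => Ep; move: wS w0S; rewrite !inE => /and3P [_ /forallP/(_ p) + _].
  rewrite (negPf Ep) => /= /eqP w_p /and3P [_ /forallP/(_ p) + _].
  by rewrite (negPf Ep) => /= /eqP w0_p; rewrite w_p w0_p eqxx in wp.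
have [||q [Eq qp rq cq]] := std_pair (T := tw w) std0 lamP Ep.
- by rewrite roww // row0.
- by move=> q Eq qp; rewrite roww // row0 // lt_eq.
rewrite /tabyoung /tabfun /polytab.
rewrite (@colsym_rowsym0 _ _ _ _ char0 (@wperm_linear F k n) (@wpermM F k n) E _ _ q p) //.
by rewrite /rowsym big1 ?scaler0 // => s _; rewrite (pi0 (@wperm_linear F k n)).
Qed.

Lemma tabfun_free (c : word -> F) : \sum_(w in std_words) c w *: tabfun (tw w) = 0 ->
  forall w, w \in std_words -> c w = 0.
Proof.
move=> c0 w wS; apply/eqP/negPn/negP => cw.
have [w0 [w0S cw0]] := tabyoung_top wS cw; rewrite c0 tabyoung0.
have [std0 _] := std_word_tab w0S; have [h h0 ->] := tabyoung_tabfun std0.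
move=> /esym /eqP; rewrite !scaler_eq0 (negPf cw0) (negPf h0) => /eqP.
exact: tabfun_neq0 std0.
Qed.

(** The polytabloids of the standard words are free, and evaluation at these same words is injective
    on highest weight vectors. The square matrix [Q] of their values is therefore invertible, which
    forces them to span. *)
Lemma straightening g : hwspace E (nth 0%N lam) g ->
  exists c : word -> F, g = \sum_(w in std_words) c w *: tabfun (tw w).
Proof.
move=> Hg; pose N := #|std_words|; pose ev (i : 'I_N) : word := enum_val i.
have evS i : ev i \in std_words by apply: enum_valP.
have Pw (w : word) : w \in std_words -> hwspace E (nth 0%N lam) (tabfun (tw w)).
  by move=> /std_word_tab [+ _]; apply: tabfun_hwspace.
have Ps (c : 'I_N -> F) : hwspace E (nth 0%N lam) (\sum_i c i *: tabfun (tw (ev i))).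
  by apply: hwspace_sum => i; apply: Pw.
pose Q : 'M[F]_N := \matrix_(i, j) tabfun (tw (ev i)) (ev j).
have evQ (v : 'rV_N) j : (v *m Q) 0 j = (\sum_i v 0 i *: tabfun (tw (ev i))) (ev j).
  by rewrite mxE sum_ffunE; apply: eq_bigr => i _; rewrite !mxE !ffunE.
have ev_inv w (wS : w \in std_words) : exists i, w = ev i.
  by exists (enum_rank_in wS w); rewrite /ev enum_rankK_in.
have Qu : Q \in unitmx.
  rewrite -row_free_unit; apply: inj_row_free => v vQ.
  have S0 : \sum_i v 0 i *: tabfun (tw (ev i)) = 0.
    apply: (hwspace_eval0 (Ps _)) => w /ev_inv [i ->].
    by rewrite -evQ vQ mxE.
  apply/rowP => i; rewrite mxE.
  pose c (w : word) : F := \sum_(i | ev i == w) v 0 i.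
  have cev j : c (ev j) = v 0 j.
    by rewrite /c (big_pred1 j) // => l; rewrite (inj_eq enum_val_inj).
  rewrite -cev; apply: tabfun_free => //.
  by rewrite big_enum_val /= -[RHS]S0; apply: eq_bigr => j _; rewrite cev.
pose v : 'rV[F]_N := (\row_j g (ev j)) *m invmx Q.
have gE : g = \sum_i v 0 i *: tabfun (tw (ev i)).
  apply/eqP; rewrite -subr_eq0 addrC -scaleN1r; apply/eqP.
  apply: hwspace_eval0; first exact: hwspace_comb.
  move=> w /ev_inv [j ->]; rewrite ffunE [X in X + _]ffunE -evQ /v mulmxKV // mxE.
  by rewrite scaleN1r addNr.
exists (fun w => \sum_(i | ev i == w) v 0 i); rewrite [RHS]big_enum_val /= {1}gE.
apply: eq_bigr => j _; congr (_ *: _); rewrite (big_pred1 j) // => l.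
by rewrite (inj_eq enum_val_inj).
Qed.

(** The symmetrizer is applied twice because R C R C contains the factor R C R of D. *)
Lemma hwspace_detect g : hwspace E (nth 0%N lam) g -> g <> 0 ->
  exists T, std_tableau T lam E /\ tabyoung T (tabyoung T g) <> 0.
Proof.
move=> /straightening [c ->] gn0.
have [w1 w1S cw1] : exists2 w1, w1 \in std_words & c w1 != 0.
  apply: NNPP => N; apply: gn0; rewrite big1 // => w wS.
  have [->|cw] := eqVneq (c w) 0; first by rewrite scale0r.
  by case: N; exists w.
have [w0 [w0S cw0 E1]] := tabyoung_top w1S cw1.
have [std0 _] := std_word_tab w0S; have [h h0 E0] := tabyoung_tabfun std0.
exists (tw w0); split=> //; rewrite E1 E0 !tabyoungZ E0 => /eqP.
rewrite !scaler_eq0 (negPf cw0) (negPf h0) /= => /eqP.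
exact: tabfun_neq0 std0.
Qed.

End FixedShape.

(* Raise a vector killed by all Young symmetrizers until it is of highest weight;
   the degree [sum of the letters] bounds the number of steps. *)
Lemma tabyoung_faithful (g : wordfun) : local E g ->
  (forall lam T, is_partition lam -> std_tableau T lam E -> tabyoung T (tabyoung T g) = 0) ->
  g = 0.
Proof.
have H d : forall g : wordfun,
    (forall a, g a != 0 -> (\sum_(p | E p) val (a p) < d)%N) -> local E g ->
    (forall lam T, is_partition lam -> std_tableau T lam E -> tabyoung T (tabyoung T g) = 0) ->
    g = 0.
  elim: d => [|d IH] {}g gd lg gk.
    by apply/ffunP => a; rewrite ffunE; apply/eqP/negPn/negP => /gd.
  have hg : highest E g.
    move=> i j ij; apply: IH.
    - move=> a; rewrite ffunE => N.
      have [p /andP [Ep /eqP ap] gp] : exists2 p, E p && (a p == i) & g (upd a p j) != 0.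
        apply: NNPP => N'; case/eqP: N; apply: big1 => p Hp.
        by apply/eqP/negPn/negP => gp; apply: N'; exists p.
      have := gd _ gp; rewrite (bigD1 p) //= (bigD1 p (P := E)) //= ffunE eqxx ij ap.
      rewrite (eq_bigr (fun q => val (a q))); first by rewrite /=; lia.
      by move=> q /andP [_ qp]; rewrite ffunE (negPf qp).
    - move=> a b ab; rewrite !ffunE; apply: eq_big => p.
        by case: (boolP (E p)) => //= Ep; rewrite ab.
      move=> _; apply: lg => q Eq; rewrite !ffunE; case: ifP => // _; exact: ab.
    - move=> lam T lamP stdT; rewrite /tabyoung -wcol_raise // -wrow_raise //.
      rewrite -wcol_raise // -wrow_raise // -/(tabyoung T g) -/(tabyoung T (tabyoung T g)).
      by rewrite (gk _ _ lamP stdT); have := raise_linear E i j (-1) (0 : wordfun) 0; rewrite !scaleN1r addr0 oppr0 addNr.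
  apply: NNPP => gn0.
  have [a ga _] := highest_lattice char0 hg gn0.
  (* [hwspace] asks for a single weight. The projection [pr] onto the words with the content of [a]
     commutes with place permutations and preserves highest weight vectors. *)
  pose cw (a : word) (i : 'I_n) := #|[pred p | E p & a p == i]|.
  pose same (b : word) := [forall i, cw b i == cw a i].
  pose pr (f : wordfun) : wordfun := [ffun b : word => if same b then f b else 0].
  have pr0 : pr 0 = 0 by apply/ffunP => b; rewrite !ffunE if_same.
  have prD f1 f2 : pr (f1 + f2) = pr f1 + pr f2.
    by apply/ffunP => b; rewrite !ffunE; case: ifP; rewrite ?addr0.
  have prZ c f : pr (c *: f) = c *: pr f.
    by apply/ffunP => b; rewrite !ffunE; case: ifP; rewrite ?scaler0.
  have prperm s f : supported E s -> pr (wperm s f) = wperm s (pr f).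
    move=> sE; apply/ffunP => b; rewrite !ffunE; congr (if _ then _ else _).
    apply: eq_forallb => i; congr (_ == _).
    rewrite /cw -(supported_card (fun p => val (b p)) i sE); apply: eq_card => p.
    by rewrite !inE ffunE.
  have prY T f : pr (tabyoung T f) = tabyoung T (pr f).
    rewrite /tabyoung /rowsym (big_morph pr prD pr0); apply: eq_bigr => s /keeps_supported sE.
    rewrite prperm //; congr (wperm s _); rewrite /colsym (big_morph pr prD pr0).
    by apply: eq_bigr => t /keeps_supported tE; rewrite prZ prperm.
  have lpr : local E (pr g).
    move=> b c bc; rewrite !ffunE (lg _ _ bc); congr (if _ then _ else _).
    apply: eq_forallb => i; congr (_ == _); apply: eq_card => p; rewrite !inE.
    by case: (boolP (E p)) => //= Ep; rewrite bc.
  have hpr : highest E (pr g).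
    move=> i j ij; apply/ffunP => b; rewrite ffunE [RHS]ffunE.
    have nij : (i == j) = false by apply/eqP => E1; move: ij; rewrite E1 /=; lia.
    (* The content of [b] after one letter [i] has become [j]; the subtraction is exact wherever it
       is used, since then [b p = i]. *)
    pose cb (l : 'I_n) := (cw b l + (l == j) - (l == i))%N.
    rewrite (eq_bigr (fun p => if [forall l, cb l == cw a l] then g (upd b p j) else 0)).
      case: [forall l, cb l == cw a l]; last exact: big1.
      by have := congr1 (fun f : wordfun => f b) (hg i j ij); rewrite !ffunE.
    move=> p /andP [Ep /eqP bp]; rewrite ffunE; congr (if _ then _ else _).
    apply: eq_forallb => l; congr (_ == _); rewrite /cb /cw.
    rewrite (cardD1 p) [in RHS](cardD1 p) !inE Ep /= !ffunE eqxx bp.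
    rewrite (eq_card (B := [predD1 [pred p0 | E p0 & b p0 == l] & p])).
      rewrite (eq_sym j) (eq_sym i); case: (l =P j) => [->|_].
        by rewrite (eq_sym j) nij add0n addnC subn0.
      by rewrite addn0 addKn add0n.
    by move=> q; rewrite !inE !ffunE; case: (q == p).
  have prn0 : pr g <> 0.
    move/(congr1 (fun f : wordfun => f a)); rewrite !ffunE ifT; first by apply/eqP.
    by apply/forallP => i; rewrite eqxx.
  have [b gb lb] := highest_lattice char0 hpr prn0.
  have [lam [lamP lam_n lamb]] := lattice_partition lb.
  have ab i : cw b i = cw a i.
    by move: gb; rewrite ffunE; case: ifP => [/forallP /(_ i) /eqP //|]; rewrite eqxx.
  have [|T [stdT]] := @hwspace_detect lam lamP lam_n (pr g) _ prn0.
    split=> // c; rewrite ffunE; case: ifP; last by rewrite eqxx.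
    by move=> /forallP sc _ i; rewrite -lamb -/(cw b i) ab -/(cw c i); apply/eqP.
  by rewrite -!prY (gk _ _ lamP stdT) pr0.
move=> lg gk; apply: (H (\sum_(p : 'I_k) n).+1) => // a _; rewrite ltnS.
by rewrite big_mkcond; apply: leq_sum => p _; case: (E p) => //; apply/ltnW/ltn_ord.
Qed.

End Straightening.

(** * Operators on mixed tensors *)

Section LinearMaps.

Variables (F : fieldType) (U V : vectType F).

Definition lin_of (f : U -> V) (Hf : linear f) : 'Hom(U, V) :=
  let g : {linear U -> V} := HB.pack f (GRing.isLinear.Build F U V *:%R f Hf) in linfun g.

Lemma lin_ofE f Hf v : @lin_of f Hf v = f v.
Proof. by rewrite lfunE. Qed.

Lemma lin0 (f : U -> V) : linear f -> f 0 = 0.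
Proof. by move=> Hf; have := Hf (-1) 0 0; rewrite !scaleN1r addr0 oppr0 addNr. Qed.

Lemma linZ (f : U -> V) : linear f -> forall c v, f (c *: v) = c *: f v.
Proof. by move=> Hf c v; have := Hf c v 0; rewrite (lin0 Hf) !addr0. Qed.

Lemma lin_sum (f : U -> V) : linear f -> forall (I : Type) (r : seq I) (P : pred I) (x : I -> U),
  f (\sum_(i <- r | P i) x i) = \sum_(i <- r | P i) f (x i).
Proof. by move=> Hf I r P x; rewrite -(lin_ofE Hf) linear_sum; apply: eq_bigr => i _; apply: lin_ofE. Qed.

Lemma span_lin (f : U -> V) (X : seq U) (W : {vspace V}) : linear f ->
  (forall x, x \in X -> f x \in W) -> forall v, v \in <<X>>%VS -> f v \in W.
Proof.
move=> Hf HX; apply: span_ind => [|a x v xX vW].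
  by rewrite lin0 // mem0v.
by rewrite Hf rpredD // memvZ // HX.
Qed.

End LinearMaps.

Section TensorOperators.

Variables (F : fieldType) (n k : nat).
Hypotheses (char0 : [pchar F] =i pred0) (n0 : (0 < n)%N).

Notation tens := (tens F n k).
Notation idx := (idx n k).
Implicit Types (f g v w : tens) (x y : idx) (i j l : 'I_k) (s t : 'S_k).
Notation word := {ffun 'I_k -> 'I_n}.

Lemma upd_eq (a : word) i m : upd a i m i = m.
Proof. by rewrite ffunE eqxx. Qed.

Lemma upd_neq (a : word) i j m : j != i -> upd a i m j = a j.
Proof. by rewrite ffunE => /negPf ->. Qed.

Lemma updC (a : word) i j m m' : i != j -> upd (upd a i m) j m' = upd (upd a j m') i m.
Proof.
move=> ij; apply/ffunP => p; rewrite !ffunE.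
by case: (p =P j) => [->|//]; rewrite eq_sym (negPf ij).
Qed.

Lemma upd_upd (a : word) i m m' : upd (upd a i m) i m' = upd a i m'.
Proof. by apply/ffunP => p; rewrite !ffunE; case: (p == i). Qed.

Lemma upd_id (a : word) i : upd a i (a i) = a.
Proof. by apply/ffunP => p; rewrite !ffunE; case: eqP => // ->. Qed.

Lemma upd_perm (a : word) s i m : [ffun p => upd a (s i) m (s p)] = upd [ffun p => a (s p)] i m.
Proof. by apply/ffunP => p; rewrite !ffunE (inj_eq perm_inj). Qed.

Lemma permL_linear s : linear (@permL F n k s).
Proof. by move=> a f g; apply/ffunP => x; rewrite !ffunE. Qed.

Lemma permR_linear s : linear (@permR F n k s).
Proof. by move=> a f g; apply/ffunP => x; rewrite !ffunE. Qed.

Lemma contr_linear i j : linear (@contr F n k i j).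
Proof.
move=> a f g; apply/ffunP => x; rewrite !ffunE; case: ifP => _; last by rewrite scaler0 addr0.
by rewrite scaler_sumr -big_split; apply: eq_bigr => m _; rewrite !ffunE.
Qed.

Lemma contrZ i j a f : contr i j (a *: f) = a *: contr i j f.
Proof.
have c0 : contr i j (0 : tens) = 0.
  by have := contr_linear i j (-1) 0 0; rewrite !scaleN1r addr0 oppr0 addNr.
by have := contr_linear i j a f 0; rewrite c0 !addr0.
Qed.

Lemma permLM s t f : permL s (permL t f) = permL (t * s)%g f.
Proof.
by apply/ffunP => -[a b]; rewrite !ffunE /=; congr (f (_, _)); apply/ffunP => p; rewrite !ffunE permM.
Qed.

Lemma permRM s t f : permR s (permR t f) = permR (t * s)%g f.
Proof.
by apply/ffunP => -[a b]; rewrite !ffunE /=; congr (f (_, _)); apply/ffunP => p; rewrite !ffunE permM.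
Qed.

Lemma permL1 f : permL 1%g f = f.
Proof.
by apply/ffunP => -[a b]; rewrite !ffunE /=; congr (f (_, _)); apply/ffunP => p; rewrite !ffunE perm1.
Qed.

Lemma permR1 f : permR 1%g f = f.
Proof.
by apply/ffunP => -[a b]; rewrite !ffunE /=; congr (f (_, _)); apply/ffunP => p; rewrite !ffunE perm1.
Qed.

Lemma permLR s t f : permL s (permR t f) = permR t (permL s f).
Proof. by apply/ffunP => -[a b]; rewrite !ffunE. Qed.

Lemma permL_contr s i j f : permL s (contr i j f) = contr (s i) j (permL s f).
Proof.
apply/ffunP => -[a b]; rewrite !ffunE /=; case: ifP => // _.
by apply: eq_bigr => m _; rewrite !ffunE /= upd_perm.
Qed.

Lemma permR_contr s i j f : permR s (contr i j f) = contr i (s j) (permR s f).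
Proof.
apply/ffunP => -[a b]; rewrite !ffunE /=; case: ifP => // _.
by apply: eq_bigr => m _; rewrite !ffunE /= upd_perm.
Qed.

Lemma contrE i j f (a b : word) :
  contr i j f (a, b) = if a i == b j then \sum_(m < n) f (upd a i m, upd b j m) else 0.
Proof. by rewrite ffunE. Qed.

Lemma contr_contr i j f : contr i j (contr i j f) = n%:R *: contr i j f.
Proof.
apply/ffunP => -[a b]; rewrite !ffunE /=; case: ifP => _; last by rewrite scaler0.
under eq_bigr => m _ do (rewrite contrE !upd_eq eqxx; under eq_bigr do rewrite !upd_upd).
by rewrite sumr_const card_ord scaler_nat.
Qed.

(** Diagrammatically, a contraction that meets one end of a cap merely reroutes the strand, which is
    a transposition. *)
Lemma contr_contrR i j l f : j != l ->
  contr i l (contr i j f) = permR (tperm j l) (contr i j f).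
Proof.
move=> jl; apply/ffunP => -[a b]; rewrite [RHS]ffunE !contrE /= ffunE tpermL.
case: ifP => // _.
rewrite (bigD1 (b j)) //= contrE upd_eq upd_neq // eqxx [X in _ + X]big1 ?addr0 => [|m mb].
  apply: eq_bigr => m _; rewrite upd_upd; congr (f (_, _)).
  apply/ffunP => p; rewrite !ffunE; case: (p =P j) => // /eqP pj.
  by case: (p =P l) => [->|/eqP pl]; rewrite ?tpermR // tpermD // eq_sym.
by rewrite contrE upd_eq upd_neq // (negPf mb).
Qed.

Lemma contr_contrL i j l f : i != l ->
  contr l j (contr i j f) = permL (tperm i l) (contr i j f).
Proof.
move=> il; apply/ffunP => -[a b]; rewrite [RHS]ffunE !contrE /= ffunE tpermL.
case: ifP => // _.
rewrite (bigD1 (a i)) //= contrE upd_eq upd_neq // eqxx [X in _ + X]big1 ?addr0 => [|m mb].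
  apply: eq_bigr => m _; rewrite upd_upd; congr (f (_, _)).
  apply/ffunP => p; rewrite !ffunE; case: (p =P i) => // /eqP pj.
  by case: (p =P l) => [->|/eqP pl]; rewrite ?tpermR // tpermD // eq_sym.
by rewrite contrE upd_eq upd_neq // eq_sym (negPf mb).
Qed.

Lemma contrC i j i' j' f : i != i' -> j != j' ->
  contr i j (contr i' j' f) = contr i' j' (contr i j f).
Proof.
move=> ii jj; have ii' : i' != i by rewrite eq_sym.
have jj' : j' != j by rewrite eq_sym.
apply/ffunP => -[a b]; rewrite !contrE.
under eq_bigr => m _ do rewrite contrE !upd_neq //.
under [in RHS]eq_bigr => m _ do rewrite contrE !upd_neq //.
case: (a i == b j); case: (a i' == b j') => //; first last.
- by rewrite big1.
- by rewrite big1.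
rewrite exchange_big /=; apply: eq_bigr => m _; apply: eq_bigr => m' _.
by rewrite (updC _ _ _ ii) (updC _ _ _ jj).
Qed.

(** The product of c_{1,1}, ..., c_{m,m}; steps beyond [k] do nothing, so that [m] can be any
    natural number. *)
Fixpoint cups (m : nat) f : tens :=
  if m is m'.+1 then
    if insub m' is Some i then contr i i (cups m' f) else cups m' f
  else f.

Lemma cupsS i f : cups i.+1 f = contr i i (cups i f).
Proof. by rewrite /=; case: insubP => [u _ /val_inj -> //|]; rewrite ltn_ord. Qed.

Lemma cups_linear m : linear (cups m).
Proof.
elim: m => [|m IH] a f g //=; case: insub => [i|//]; last exact: IH.
by rewrite IH contr_linear.
Qed.

Lemma cups_id i m f : (i < m)%N -> contr i i (cups m f) = n%:R *: cups m f.
Proof.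
elim: m => // m IH; rewrite ltnS leq_eqVlt => im.
have [mk|km] := ltnP m k; last first.
  rewrite /= insubF; last by apply/negbTE; rewrite -leqNgt.
  by case/orP: im => [/eqP E1|/IH //]; have := ltn_ord i; rewrite E1 ltnNge km.
rewrite -[m]/(val (Ordinal mk)) cupsS; case: (eqVneq i (Ordinal mk)) => [->|ni]; first exact: contr_contr.
rewrite contrC // IH ?contrZ //.
by case/orP: im => // /eqP E1; case/eqP: ni; apply: val_inj.
Qed.

End TensorOperators.

(** * Capped tensors and the transpose of an operator *)

Section Cups.

Variables (F : fieldType) (n k : nat).
Hypotheses (char0 : [pchar F] =i pred0) (n0 : (0 < n)%N).

Notation tens := (tens F n k).
Notation idx := (idx n k).
Implicit Types (f g v w : tens) (x y : idx) (i j l : 'I_k) (s t : 'S_k).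
Notation word := {ffun 'I_k -> 'I_n}.

Let nF0 : (n%:R : F) != 0 := natr_char0_neq0 char0 n0.

Lemma permLZ s a f : permL s (a *: f) = a *: permL s f.
Proof. by apply/ffunP => x; rewrite !ffunE. Qed.

Lemma permRZ s a f : permR s (a *: f) = a *: permR s f.
Proof. by apply/ffunP => x; rewrite !ffunE. Qed.

(** Exhibits a capped tensor as the result of a contraction at any of its caps, so that the
    identities for two successive contractions apply to it. *)
Lemma cups_div i m f : (i < m)%N -> cups m f = n%:R^-1 *: contr i i (cups m f).
Proof. by move=> im; rewrite cups_id // scalerA mulVf // scale1r. Qed.

Lemma cups_offR i j m f : (i < m)%N -> i != j ->
  contr i j (cups m f) = permR (tperm i j) (cups m f).
Proof. by move=> im ij; rewrite (cups_div f im) contrZ permRZ contr_contrR. Qed.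

Lemma cups_offL i j m f : (j < m)%N -> i != j ->
  contr i j (cups m f) = permL (tperm i j) (cups m f).
Proof.
by move=> im ij; rewrite (cups_div f im) contrZ permLZ contr_contrL 1?eq_sym // tpermC.
Qed.

Lemma cups_support m f (a b : word) : cups m f (a, b) != 0 ->
  forall i, (i < m)%N -> a i = b i.
Proof.
move=> N i im; move: N; rewrite (cups_div f im) ffunE contrE.
by have [//|ab] := eqVneq (a i) (b i); rewrite scaler0 eqxx.
Qed.

Lemma cups_upd m f (a b : word) i (l : 'I_n) : (i < m)%N -> a i = b i ->
  cups m f (upd a i l, upd b i l) = cups m f (a, b).
Proof.
move=> im ab; rewrite (cups_div f im) ffunE [RHS]ffunE !contrE !upd_eq ab !eqxx.
by congr (_ *: _); apply: eq_bigr => m' _; rewrite !upd_upd.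
Qed.

(** The common letter of a cap can be changed freely, one pair at a time; [h] interpolates between
    the old and the new words. *)
Lemma cups_const m f (a b a' b' : word) :
  (forall i, (i < m)%N -> a i = b i) -> (forall i, (i < m)%N -> a' i = b' i) ->
  (forall i, (m <= i)%N -> a i = a' i) -> (forall i, (m <= i)%N -> b i = b' i) ->
  cups m f (a, b) = cups m f (a', b').
Proof.
move=> ab ab' aa bb.
pose h (c c' : word) (j : nat) : word := [ffun p : 'I_k => if (p < j)%N then c' p else c p].
have H (j : nat) : (j <= m)%N -> cups m f (h a a' j, h b b' j) = cups m f (a, b).
  elim: j => [_|j IH jm].
    by congr (cups m f (_, _)); apply/ffunP => p; rewrite ffunE.
  have [jk|kj] := ltnP j k; last first.
    rewrite -IH ?(ltnW jm) //; congr (cups m f (_, _)); apply/ffunP => p; rewrite !ffunE.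
      by have pk := ltn_ord p; rewrite !ifT //; lia.
    by have pk := ltn_ord p; rewrite !ifT //; lia.
  rewrite -(IH (ltnW jm)) -(@cups_upd m f (h a a' j) (h b b' j) (Ordinal jk) (a' (Ordinal jk))) //.
    congr (cups m f (_, _)); apply/ffunP => p; rewrite !ffunE ltnS leq_eqVlt -val_eqE /=.
      by case: (eqVneq (p : nat) j) => //= pj; congr (a' _); apply: val_inj.
    case: (eqVneq (p : nat) j) => //= pj; rewrite ab' //.
    by congr (b' _); apply: val_inj.
  by rewrite !ffunE ltnn ab.
rewrite -(H m (leqnn m)); congr (cups m f (_, _)); apply/ffunP => p; rewrite !ffunE.
  by case: ltnP => // /aa.
by case: ltnP => // /bb.
Qed.

Lemma cups_fix m s f : (forall i, (i < m)%N -> (s i < m)%N) -> (forall i, (m <= i)%N -> s i = i) ->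
  permL s (permR s (cups m f)) = cups m f.
Proof.
move=> s1 s2; apply/ffunP => -[a b]; rewrite !ffunE /=.
have [/forallP ab|] := boolP [forall i : 'I_k, (i < m)%N ==> (a i == b i)].
  have {}ab i : (i < m)%N -> a i = b i by move=> im; apply/eqP; apply: (implyP (ab i)).
  apply: cups_const => // i im; rewrite !ffunE; [|by rewrite s2..].
  by apply: ab; apply: s1.
move=> N; rewrite [RHS](_ : _ = 0); last first.
  apply/eqP/negPn/negP => /cups_support H; case/negP: N; apply/forallP => i.
  by apply/implyP => im; apply/eqP/H.
apply/eqP/negPn/negP => /cups_support H; case/negP: N; apply/forallP => i; apply/implyP => im.
have sV : (iv s i < m)%N.
  rewrite ltnNge; apply/negP => mi; have := s2 _ mi; rewrite permKV => E1.
  by rewrite -E1 leqNgt im in mi.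
by have := H _ sV; rewrite !ffunE permKV => ->.
Qed.

Lemma permL_cups m s f : (forall i, (i < m)%N -> s i = i) ->
  permL s (cups m f) = cups m (permL s f).
Proof.
elim: m => //= m IH sm; case: insubP => [i _ im|_]; last by apply: IH => i im; apply/sm/ltnW.
by rewrite permL_contr IH ?sm ?im // => j jm; apply/sm/ltnW.
Qed.

Lemma permR_cups m s f : (forall i, (i < m)%N -> s i = i) ->
  permR s (cups m f) = cups m (permR s f).
Proof.
elim: m => //= m IH sm; case: insubP => [i _ im|_]; last by apply: IH => i im; apply/sm/ltnW.
by rewrite permR_contr IH ?sm ?im // => j jm; apply/sm/ltnW.
Qed.

Lemma contr_cups m i j f : (m <= i)%N -> (m <= j)%N -> contr i j (cups m f) = cups m (contr i j f).
Proof.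
elim: m => //= m IH mi mj; case: insubP => [q _ qm|_]; last by apply: IH; apply: ltnW.
have qi : i != q by rewrite -val_eqE /= qm gtn_eqF.
have qj : j != q by rewrite -val_eqE /= qm gtn_eqF.
by rewrite contrC // IH // ltnW.
Qed.

(** The two transpositions bring the new cap to position [m], next to the existing ones. *)
Lemma contr_cups_new m i j (mk : (m < k)%N) f : (m <= i)%N -> (m <= j)%N ->
  let q := Ordinal mk in
  contr i j (cups m f) = permL (tperm i q) (permR (tperm j q)
    (cups m.+1 (permL (tperm i q) (permR (tperm j q) f)))).
Proof.
move=> mi mj q; rewrite -[m]/(val q) cupsS permR_contr permL_contr !tpermR.
have fixt l (p : 'I_k) : (m <= l)%N -> (p < m)%N -> tperm l q p = p.
  move=> ml pm; rewrite tpermD //; first by rewrite -val_eqE /= gtn_eqF // (leq_trans pm).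
  by rewrite -val_eqE /= gtn_eqF.
rewrite permR_cups; last by move=> p; apply: fixt.
rewrite permL_cups; last by move=> p; apply: fixt.
by rewrite !permLR !permLM !permRM !tperm2 permL1 permR1.
Qed.

Definition tdot v w : F := \sum_x v x * w x.

Lemma tdotl w : scalar (fun v => tdot v w).
Proof.
move=> c g g'; rewrite /tdot mulr_sumr -big_split /=.
by apply: eq_bigr => a _; rewrite !ffunE mulrDl mulrA.
Qed.

Lemma tdotr v : scalar (tdot v).
Proof.
move=> c g g'; rewrite /tdot mulr_sumr -big_split /=.
by apply: eq_bigr => a _; rewrite !ffunE mulrDr mulrCA.
Qed.

Lemma tdot_permL s v w : tdot (permL s v) w = tdot v (permL (s^-1)%g w).
Proof.
pose r (x : idx) : idx := ([ffun p => x.1 (iv s p)], x.2).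
have rinj : injective r.
  move=> [a b] [a' b'] [/ffunP H ->]; congr (_, _); apply/ffunP => p; have := H (s p).
  by rewrite !ffunE permK.
rewrite /tdot (reindex_inj rinj); apply: eq_bigr => -[a b] _; rewrite !ffunE /=.
by congr (v (_, _) * _); apply/ffunP => p; rewrite !ffunE permK.
Qed.

Lemma tdot_permR s v w : tdot (permR s v) w = tdot v (permR (s^-1)%g w).
Proof.
pose r (x : idx) : idx := (x.1, [ffun p => x.2 (iv s p)]).
have rinj : injective r.
  move=> [a b] [a' b'] [-> /ffunP H]; congr (_, _); apply/ffunP => p; have := H (s p).
  by rewrite !ffunE permK.
rewrite /tdot (reindex_inj rinj); apply: eq_bigr => -[a b] _; rewrite !ffunE /=.
by congr (v (_, _) * _); apply/ffunP => p; rewrite !ffunE permK.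
Qed.

Lemma tdot_contr i j v w : tdot (contr i j v) w = tdot v (contr i j w).
Proof.
have E f g : tdot (contr i j f) g = \sum_(p : idx * 'I_n | p.1.1 i == p.1.2 j)
    f (upd p.1.1 i p.2, upd p.1.2 j p.2) * g p.1.
  transitivity (\sum_(x : idx | x.1 i == x.2 j) \sum_(m < n) f (upd x.1 i m, upd x.2 j m) * g x).
    rewrite [RHS]big_mkcond; apply: eq_bigr => -[a b] _; rewrite contrE /=.
    by case: ifP => _; rewrite ?mul0r // mulr_suml.
  by rewrite pair_big_dep /=; apply: eq_bigl => p; rewrite andbT.
have -> : tdot v (contr i j w) = tdot (contr i j w) v.
  by apply: eq_bigr => x _; rewrite mulrC.
(* The involution that exchanges the common letter at [i] and [j] with the summation letter. *)
pose h (p : idx * 'I_n) : idx * 'I_n := ((upd p.1.1 i p.2, upd p.1.2 j p.2), p.1.1 i).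
have hK (p : idx * 'I_n) : p.1.1 i == p.1.2 j -> h (h p) = p.
  case: p => [[a b] m] /= /eqP ab.
  by rewrite /h /= !upd_upd upd_eq upd_id ab upd_id.
rewrite !E (reindex_onto h h) /=; last by move=> p; apply: hK.
apply: eq_big => p /=.
  rewrite !upd_eq eqxx /=; apply/eqP/idP => [<-|/hK //].
  by rewrite /= !upd_eq.
move=> /andP [_ /eqP E1]; rewrite mulrC; congr (w _ * v _).
exact: (congr1 fst E1).
Qed.

Lemma tdot_cups m v w : tdot (cups m v) w = tdot v (cups m w).
Proof.
elim: m v w => //= m IH v w; case: insubP => [i _ im|_]; last exact: IH.
by rewrite tdot_contr IH -contr_cups // im.
Qed.

Definition delta x : tens := [ffun y => (y == x)%:R].

Lemma delta_sum v : v = \sum_x v x *: delta x.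
Proof.
apply/ffunP => y; rewrite sum_ffunE (bigD1 y) //= big1 ?addr0 => [|x xy].
  by rewrite !ffunE eqxx /GRing.scale /= mulr1.
by rewrite !ffunE eq_sym (negPf xy) /GRing.scale /= mulr0.
Qed.

Lemma tdot_delta x v : tdot (delta x) v = v x.
Proof.
rewrite /tdot (bigD1 x) //= big1 ?addr0 => [|y yx]; first by rewrite ffunE eqxx mul1r.
by rewrite ffunE (negPf yx) mul0r.
Qed.

Lemma tdot_inj v w : (forall u, tdot u v = tdot u w) -> v = w.
Proof. by move=> H; apply/ffunP => x; rewrite -!tdot_delta. Qed.

Lemma end_delta (f : 'End(tens)) v : f v = \sum_x v x *: f (delta x).
Proof. by rewrite {1}(delta_sum v) linear_sum; apply: eq_bigr => x _; rewrite linearZ. Qed.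

Lemma adj_fun_linear (f : 'End(tens)) :
  linear (fun v => [ffun x => tdot (f (delta x)) v] : tens).
Proof. by move=> a v w; apply/ffunP => x; rewrite !ffunE tdotr. Qed.

Definition adj (f : 'End(tens)) : 'End(tens) := lin_of (adj_fun_linear f).

Lemma adjE (f : 'End(tens)) v w : tdot (f v) w = tdot v (adj f w).
Proof.
rewrite lin_ofE [LHS]/tdot end_delta.
under eq_bigr => y _ do rewrite sum_ffunE mulr_suml.
rewrite exchange_big; apply: eq_bigr => x _; rewrite ffunE /tdot mulr_sumr.
by apply: eq_bigr => y _; rewrite ffunE /GRing.scale /= mulrA.
Qed.

Lemma adj_unique (f g : 'End(tens)) : (forall v w, tdot (f v) w = tdot v (g w)) -> adj f = g.
Proof. by move=> H; apply/lfunP => w; apply: tdot_inj => v; rewrite -adjE. Qed.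

Lemma tdotC v w : tdot v w = tdot w v.
Proof. by apply: eq_bigr => x _; rewrite mulrC. Qed.

Lemma adjK (f : 'End(tens)) : adj (adj f) = f.
Proof. by apply: adj_unique => v w; rewrite tdotC -adjE tdotC. Qed.

Lemma adj_comp (f g : 'End(tens)) : adj (f \o g)%VF = (adj g \o adj f)%VF.
Proof. by apply: adj_unique => v w; rewrite !comp_lfunE !adjE. Qed.

Lemma adj_linear : linear adj.
Proof.
move=> a f g; apply: adj_unique => v w.
rewrite !add_lfunE !scale_lfunE tdotl [in RHS]tdotC tdotl.
by rewrite ![tdot _ v]tdotC -!adjE.
Qed.

End Cups.

(** * Ideals of diagrams *)

Section DiagramIdeals.

Variables (F : fieldType) (n k : nat).
Hypotheses (char0 : [pchar F] =i pred0) (n0 : (0 < n)%N).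

Notation tens := (tens F n k).
Notation idx := (idx n k).
Implicit Types (u v w : tens) (x y : idx) (i j l : 'I_k) (s t a b c d : 'S_k).
Implicit Types (f g h : 'End(tens)).

Definition PL s : 'End(tens) := lin_of (@permL_linear F n k s).
Definition PR s : 'End(tens) := lin_of (@permR_linear F n k s).
Definition CT i j : 'End(tens) := lin_of (@contr_linear F n k i j).
Definition CU m : 'End(tens) := lin_of (@cups_linear F n k m).

Lemma PLE s v : PL s v = permL s v. Proof. exact: lin_ofE. Qed.
Lemma PRE s v : PR s v = permR s v. Proof. exact: lin_ofE. Qed.
Lemma CTE i j v : CT i j v = contr i j v. Proof. exact: lin_ofE. Qed.
Lemma CUE m v : CU m v = cups m v. Proof. exact: lin_ofE. Qed.

Definition diagram_op a b m c d : 'End(tens) :=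
  (PL a \o (PR b \o (CU m \o (PL c \o PR d))))%VF.

Lemma diagram_opE a b m c d v :
  diagram_op a b m c d v = permL a (permR b (cups m (permL c (permR d v)))).
Proof. by rewrite !comp_lfunE !PLE !PRE CUE. Qed.

Definition diagram_gens m : seq 'End(tens) :=
  [seq diagram_op z.1.1.1.1 z.1.1.1.2 z.1.1.2 z.1.2 z.2 |
    z : 'S_k * 'S_k * 'I_k.+1 * 'S_k * 'S_k <- enum {: 'S_k * 'S_k * 'I_k.+1 * 'S_k * 'S_k} & (m <= z.1.1.2)%N].

Definition BrIdeal m : {vspace 'End(tens)} := <<diagram_gens m>>%VS.

Lemma mem_diagram_gens m f : f \in diagram_gens m -> exists a b m' c d,
  [/\ (m <= m')%N, (m' <= k)%N & f = diagram_op a b m' c d].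
Proof.
move=> /mapP [[[[[a b] m'] c] d]]; rewrite mem_filter /= => /andP [mm _] ->.
by exists a, b, m', c, d; split=> //; rewrite -ltnS ltn_ord.
Qed.

Lemma diagram_op_gens m a b m' c d : (m <= m')%N -> (m' <= k)%N ->
  diagram_op a b m' c d \in diagram_gens m.
Proof.
move=> mm mk; apply/mapP; rewrite -ltnS in mk.
by exists (a, b, Ordinal mk, c, d) => //; rewrite mem_filter mm mem_enum.
Qed.

Lemma diagram_op_mem m a b m' c d : (m <= m')%N -> (m' <= k)%N ->
  diagram_op a b m' c d \in BrIdeal m.
Proof. by move=> mm mk; apply/memv_span/diagram_op_gens. Qed.

Lemma BrIdeal_lin m (vT : vectType F) (h : 'End(tens) -> vT) (W : {vspace vT}) : linear h ->
  (forall a b m' c d, (m <= m')%N -> (m' <= k)%N -> h (diagram_op a b m' c d) \in W) ->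
  forall f, f \in BrIdeal m -> h f \in W.
Proof.
move=> Hh H; apply: span_lin => // f /mem_diagram_gens [a [b [m' [c [d [mm mk ->]]]]]].
exact: H.
Qed.

Lemma comp_linear_r g : linear (fun f => (g \o f)%VF : 'End(tens)).
Proof. by move=> a f1 f2; rewrite comp_lfunDr -comp_lfunZr. Qed.

Lemma comp_linear_l g : linear (fun f => (f \o g)%VF : 'End(tens)).
Proof. by move=> a f1 f2; rewrite comp_lfunDl -comp_lfunZl. Qed.

Lemma BrIdeal_mono m m' : (m <= m')%N -> (BrIdeal m' <= BrIdeal m)%VS.
Proof.
move=> mm; apply/subvP => f; apply: (@BrIdeal_lin m' _ id) => //.
by move=> a b m1 c d m1m m1k; apply: diagram_op_mem => //; apply: leq_trans m1m.
Qed.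

Lemma BrIdeal_top m : (k < m)%N -> BrIdeal m = 0%VS.
Proof.
move=> km; apply/eqP; rewrite -subv0; apply/subvP => f.
apply: (@BrIdeal_lin m _ id) => // a b m1 c d m1m m1k.
by have := leq_trans (leq_trans km m1m) m1k; rewrite ltnn.
Qed.

Lemma BrIdeal_PL m s f : f \in BrIdeal m -> (PL s \o f)%VF \in BrIdeal m.
Proof.
apply: BrIdeal_lin; first exact: comp_linear_r.
move=> a b m' c d mm mk.
have -> : (PL s \o diagram_op a b m' c d)%VF = diagram_op (a * s)%g b m' c d.
  by apply/lfunP => v; rewrite comp_lfunE !diagram_opE PLE permLM.
exact: diagram_op_mem.
Qed.

Lemma BrIdeal_PR m s f : f \in BrIdeal m -> (PR s \o f)%VF \in BrIdeal m.
Proof.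
apply: BrIdeal_lin; first exact: comp_linear_r.
move=> a b m' c d mm mk.
have -> : (PR s \o diagram_op a b m' c d)%VF = diagram_op a (b * s)%g m' c d.
  by apply/lfunP => v; rewrite comp_lfunE !diagram_opE PRE -permLR permRM.
exact: diagram_op_mem.
Qed.

Lemma contr_perms i j a b v :
  contr i j (permL a (permR b v)) = permL a (permR b (contr (iv a i) (iv b j) v)).
Proof. by rewrite permR_contr permL_contr !permKV. Qed.

(** Contracting a cap with itself gives the factor [n], meeting one end of a cap reroutes it, and
    two uncapped positions form a new cap. The number of caps never drops. *)
Lemma BrIdeal_CT m i j f : f \in BrIdeal m -> (CT i j \o f)%VF \in BrIdeal m.
Proof.
apply: BrIdeal_lin; first exact: comp_linear_r.
move=> a b m' c d mm mk.
set i0 := iv a i; set j0 := iv b j.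
have [im|im] := ltnP i0 m'.
  have [E|ij] := eqVneq i0 j0.
    have -> : (CT i j \o diagram_op a b m' c d)%VF = n%:R *: diagram_op a b m' c d.
      apply/lfunP => v; rewrite comp_lfunE scale_lfunE !diagram_opE CTE contr_perms.
      by rewrite -/i0 -/j0 -E (cups_id _ im) permRZ permLZ.
    by rewrite memvZ // diagram_op_mem.
  have -> : (CT i j \o diagram_op a b m' c d)%VF = diagram_op a (tperm i0 j0 * b)%g m' c d.
    apply/lfunP => v; rewrite comp_lfunE !diagram_opE CTE contr_perms.
    by rewrite -/i0 -/j0 (cups_offR char0 n0 _ im) // permRM.
  exact: diagram_op_mem.
have [jm|jm] := ltnP j0 m'.
  have ij : i0 != j0 by apply: contraTneq im => ->; rewrite -ltnNge.
  have -> : (CT i j \o diagram_op a b m' c d)%VF = diagram_op (tperm i0 j0 * a)%g b m' c d.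
    apply/lfunP => v; rewrite comp_lfunE !diagram_opE CTE contr_perms.
    by rewrite -/i0 -/j0 (cups_offL char0 n0 _ jm) // -permLR permLM.
  exact: diagram_op_mem.
have mk' : (m' < k)%N := leq_ltn_trans im (ltn_ord i0).
pose q := Ordinal mk'.
have -> : (CT i j \o diagram_op a b m' c d)%VF =
    diagram_op (tperm i0 q * a)%g (tperm j0 q * b)%g m'.+1 (c * tperm i0 q)%g (d * tperm j0 q)%g.
  apply/lfunP => v; rewrite comp_lfunE !diagram_opE CTE contr_perms -/i0 -/j0.
  rewrite (contr_cups_new mk' _ im jm) -/q -[in LHS](permLR (tperm i0 q) b) permLM permRM.
  congr (permL _ (permR _ (cups _ _))).
  by rewrite -(permLR c (tperm j0 q)) permLM permRM.
by apply: diagram_op_mem => //; apply: leqW.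
Qed.

Lemma BrIdeal_CU m m' f : f \in BrIdeal m -> (CU m' \o f)%VF \in BrIdeal m.
Proof.
move=> fB; elim: m' => [|m' IH].
  by have -> : (CU 0 \o f)%VF = f by apply/lfunP => v; rewrite comp_lfunE CUE.
have [mk|km] := ltnP m' k; last first.
  have -> : CU m'.+1 = CU m'; last by [].
  by apply/lfunP => v; rewrite !CUE /= insubF //; apply/negbTE; rewrite -leqNgt.
have -> : (CU m'.+1 \o f)%VF = (CT (Ordinal mk) (Ordinal mk) \o (CU m' \o f))%VF.
  apply/lfunP => v; rewrite !comp_lfunE CTE !CUE.
  by rewrite -[m'.+1]/((val (Ordinal mk)).+1) cupsS.
exact: BrIdeal_CT.
Qed.

Lemma BrIdeal_left m f g : g \in BrIdeal 0 -> f \in BrIdeal m -> (g \o f)%VF \in BrIdeal m.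
Proof.
move=> gB fB; move: g gB; apply: BrIdeal_lin; first exact: comp_linear_l.
move=> a b m' c d _ _; rewrite /diagram_op -!comp_lfunA.
by do ?[apply: BrIdeal_PL | apply: BrIdeal_PR | apply: BrIdeal_CU].
Qed.

Lemma adj_diagram_op a b m c d :
  adj (diagram_op a b m c d) = diagram_op (c^-1)%g (d^-1)%g m (a^-1)%g (b^-1)%g.
Proof.
apply: adj_unique => v w; rewrite !diagram_opE.
rewrite tdot_permL tdot_permR tdot_cups tdot_permL tdot_permR.
by rewrite permLR [in RHS]permLR.
Qed.

Lemma BrIdeal_adj m f : f \in BrIdeal m -> adj f \in BrIdeal m.
Proof.
apply: BrIdeal_lin; first exact: adj_linear.
by move=> a b m' c d mm mk; rewrite adj_diagram_op diagram_op_mem.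
Qed.

(** The transpose preserves each ideal and exchanges left with right multiplication. *)
Lemma BrIdeal_right m f g : f \in BrIdeal m -> g \in BrIdeal 0 -> (f \o g)%VF \in BrIdeal m.
Proof.
move=> fB gB; rewrite -[(f \o g)%VF]adjK adj_comp; apply: BrIdeal_adj.
by apply: BrIdeal_left; apply: BrIdeal_adj.
Qed.

Lemma BrIdeal_id : \1%VF \in BrIdeal 0.
Proof.
have -> : \1%VF = diagram_op 1%g 1%g 0 1%g 1%g.
  by apply/lfunP => v; rewrite diagram_opE id_lfunE /= !permL1 !permR1.
exact: diagram_op_mem.
Qed.

Lemma mem_PL s : PL s \in BrIdeal 0.
Proof. by rewrite -[PL s]comp_lfun1r; apply/BrIdeal_PL/BrIdeal_id. Qed.
Lemma mem_PR s : PR s \in BrIdeal 0.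
Proof. by rewrite -[PR s]comp_lfun1r; apply/BrIdeal_PR/BrIdeal_id. Qed.
Lemma mem_CT i j : CT i j \in BrIdeal 0.
Proof. by rewrite -[CT i j]comp_lfun1r; apply/BrIdeal_CT/BrIdeal_id. Qed.

Lemma mem_CU m : (m <= k)%N -> CU m \in BrIdeal m.
Proof.
move=> mk; have -> : CU m = diagram_op 1%g 1%g m 1%g 1%g; last exact: diagram_op_mem.
by apply/lfunP => v; rewrite diagram_opE CUE !permL1 !permR1.
Qed.

Definition kcoord (p : idx * idx) f : F := f (delta F p.1) p.2.

Lemma kcoord_linear p : scalar (kcoord p).
Proof. by move=> c f g; rewrite /kcoord add_lfunE scale_lfunE !ffunE. Qed.

Lemma kcoord_inj f : (forall p, kcoord p f = 0) -> f = 0.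
Proof.
move=> H; apply/lfunP => v; rewrite end_delta zero_lfunE big1 // => x _.
apply/ffunP => y; rewrite !ffunE -[f (delta F x) y]/(kcoord (x, y) f) H.
by rewrite /GRing.scale /= mulr0.
Qed.

(** The trace form tr(f^T g) in the basis [delta]. *)
Definition kdot f g : F := cdot kcoord f g.

Lemma kdotE f g : kdot f g = \sum_x tdot (f (delta F x)) (g (delta F x)).
Proof. by rewrite /kdot /cdot /tdot pair_big. Qed.

Lemma kdot_comp h f g : kdot (h \o f)%VF g = kdot f (adj h \o g)%VF.
Proof. by rewrite !kdotE; apply: eq_bigr => x _; rewrite !comp_lfunE adjE. Qed.

Definition tintegral (v : tens) := forall x, exists z : int, v x = z%:~R.

Lemma tintegral_permL s v : tintegral v -> tintegral (permL s v).
Proof. by move=> H x; rewrite ffunE; apply: H. Qed.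
Lemma tintegral_permR s v : tintegral v -> tintegral (permR s v).
Proof. by move=> H x; rewrite ffunE; apply: H. Qed.
Lemma tintegral_contr i j v : tintegral v -> tintegral (contr i j v).
Proof.
move=> H [a b]; rewrite contrE; case: ifP => _; last by exists 0.
apply: (big_ind (fun r : F => exists z : int, r = z%:~R)) => [|_ _ [z1 ->] [z2 ->]|m _].
- by exists 0.
- by exists (z1 + z2); rewrite intrD.
- exact: H.
Qed.
Lemma tintegral_cups m v : tintegral v -> tintegral (cups m v).
Proof.
move=> H; elim: m => //= m IH; case: insub => [i|//]; exact: tintegral_contr.
Qed.
Lemma tintegral_delta x : tintegral (delta F x).
Proof. by move=> y; rewrite ffunE; exists (y == x)%:R; case: (y == x). Qed.

Lemma tintegral_diagram_op a b m c d v : tintegral v -> tintegral (diagram_op a b m c d v).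
Proof.
move=> H; rewrite diagram_opE; apply/tintegral_permL/tintegral_permR/tintegral_cups.
exact/tintegral_permL/tintegral_permR.
Qed.

Definition kintegral f := forall x, tintegral (f (delta F x)).

Lemma BrIdeal_nondegenerate m f : f \in BrIdeal m ->
  (forall g, g \in BrIdeal m -> kdot f g = 0) -> f = 0.
Proof.
move=> fB H; apply: (int_span_nondegenerate char0 kcoord_linear kcoord_inj (X := diagram_gens m)) => //.
  move=> g /mem_diagram_gens [a [b [m' [c [d [mm mk ->]]]]]] p.
  exact/tintegral_diagram_op/tintegral_delta.
by move=> g gB; apply/H/memv_span.
Qed.

(** * Diagrams between two sets of caps *)

Section Sandwich.

Variable m : nat.

Definition cup_gens (P : 'S_k -> 'S_k -> bool) : seq 'End(tens) :=
  [seq (PL z.1 \o (PR z.2 \o CU m))%VF | z <- enum {: 'S_k * 'S_k} & P z.1 z.2].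

Definition cup_space (P : 'S_k -> 'S_k -> bool) : {vspace 'End(tens)} :=
  (BrIdeal m.+1 + <<cup_gens P>>)%VS.

Lemma cup_space_gen (P : 'S_k -> 'S_k -> bool) a b : P a b ->
  (PL a \o (PR b \o CU m))%VF \in cup_space P.
Proof.
move=> Pab; apply: (subvP (addvSr _ _)); apply/memv_span/mapP.
by exists (a, b); rewrite // mem_filter Pab mem_enum.
Qed.

Lemma cup_space_lin (P : 'S_k -> 'S_k -> bool) h (W : {vspace 'End(tens)}) : h \in BrIdeal 0 ->
  (BrIdeal m.+1 <= W)%VS ->
  (forall a b, P a b -> (h \o (PL a \o (PR b \o CU m)))%VF \in W) ->
  forall f, f \in cup_space P -> (h \o f)%VF \in W.
Proof.
move=> hB BW H f /memv_addP [f1 f1B [f2 f2P ->]]; rewrite comp_lfunDr rpredD //.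
  by apply: (subvP BW); apply: BrIdeal_left.
move: f2 f2P; apply: span_lin; first exact: comp_linear_r.
by move=> f2 /mapP [[a b]]; rewrite mem_filter => /andP [Pab _] ->; apply: H.
Qed.

Hypothesis mk : (m <= k)%N.

Lemma cup_space_CT (i j : 'I_k) a b : let i0 := iv a i in let j0 := iv b j in
  [\/ (CT i j \o (PL a \o (PR b \o CU m)))%VF \in BrIdeal m.+1,
      [/\ i0 = j0, (i0 < m)%N & (CT i j \o (PL a \o (PR b \o CU m)))%VF = n%:R *: (PL a \o (PR b \o CU m))%VF],
      [/\ i0 != j0, (i0 < m)%N & (CT i j \o (PL a \o (PR b \o CU m)))%VF = (PL a \o (PR (tperm i0 j0 * b)%g \o CU m))%VF] |
      [/\ i0 != j0, (j0 < m)%N & (CT i j \o (PL a \o (PR b \o CU m)))%VF = (PL (tperm i0 j0 * a)%g \o (PR b \o CU m))%VF]].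
Proof.
move=> i0 j0; have [im|im] := ltnP i0 m.
  have [E|ij] := eqVneq i0 j0.
    apply: Or42; split=> //; apply/lfunP => v; rewrite scale_lfunE !comp_lfunE CTE !PLE !PRE CUE contr_perms.
    by rewrite -/i0 -/j0 -E (cups_id _ im) permRZ permLZ.
  apply: Or43; split=> //; apply/lfunP => v; rewrite !comp_lfunE CTE !PLE !PRE CUE contr_perms.
  by rewrite -/i0 -/j0 (cups_offR char0 n0 _ im) // permRM.
have [jm|jm] := ltnP j0 m.
  have ij : i0 != j0 by apply: contraTneq im => ->; rewrite -ltnNge.
  apply: Or44; split=> //; apply/lfunP => v; rewrite !comp_lfunE CTE !PLE !PRE CUE contr_perms.
  by rewrite -/i0 -/j0 (cups_offL char0 n0 _ jm) // -permLR permLM.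
apply: Or41.
have mk' : (m < k)%N := leq_ltn_trans im (ltn_ord i0).
pose q := Ordinal mk'.
have -> : (CT i j \o (PL a \o (PR b \o CU m)))%VF =
    diagram_op (tperm i0 q * a)%g (tperm j0 q * b)%g m.+1 (tperm i0 q)%g (tperm j0 q)%g.
  apply/lfunP => v; rewrite diagram_opE !comp_lfunE CTE !PLE !PRE CUE contr_perms -/i0 -/j0.
  by rewrite (contr_cups_new mk' _ im jm) -/q -[in LHS](permLR (tperm i0 q) b) permLM permRM.
exact: diagram_op_mem.
Qed.

Lemma cup_space_left h : h \in BrIdeal 0 -> (h \o CU m)%VF \in cup_space (fun _ _ => true).
Proof.
have cl : forall i j f, f \in cup_space (fun _ _ => true) -> (CT i j \o f)%VF \in cup_space (fun _ _ => true).
  move=> i j; apply: cup_space_lin; [exact: mem_CT|exact: addvSl|move=> a b _].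
  case: (cup_space_CT i j a b) => [H|[_ _ ->]|[_ _ ->]|[_ _ ->]].
  - by apply: (subvP (addvSl _ _)).
  - by rewrite memvZ // cup_space_gen.
  - exact: cup_space_gen.
  - exact: cup_space_gen.
have clU m' : forall f, f \in cup_space (fun _ _ => true) -> (CU m' \o f)%VF \in cup_space (fun _ _ => true).
  elim: m' => [|m' IH] f fC.
    by have -> : (CU 0 \o f)%VF = f by apply/lfunP => v; rewrite comp_lfunE CUE.
  have [mk'|km] := ltnP m' k; last first.
    have -> : CU m'.+1 = CU m'; last by apply: IH.
    by apply/lfunP => v; rewrite !CUE /= insubF //; apply/negbTE; rewrite -leqNgt.
  have -> : (CU m'.+1 \o f)%VF = (CT (Ordinal mk') (Ordinal mk') \o (CU m' \o f))%VF.
    apply/lfunP => v; rewrite !comp_lfunE CTE !CUE.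
    by rewrite -[m'.+1]/((val (Ordinal mk')).+1) cupsS.
  exact/cl/IH.
have clP s t f : f \in cup_space (fun _ _ => true) -> (PL s \o (PR t \o f))%VF \in cup_space (fun _ _ => true).
  rewrite comp_lfunA; move: f; apply: cup_space_lin; last 1 first.
  - move=> a b _.
    have -> : ((PL s \o PR t) \o (PL a \o (PR b \o CU m)))%VF = (PL (a * s)%g \o (PR (b * t)%g \o CU m))%VF.
      by apply/lfunP => v; rewrite !comp_lfunE !PLE !PRE -permLR permLM permRM.
    exact: cup_space_gen.
  - by apply: BrIdeal_left; [exact: mem_PL|exact: mem_PR].
  - exact: addvSl.
move: h; apply: BrIdeal_lin; first exact: comp_linear_l.
move=> a b m' c d _ _; rewrite /diagram_op -!comp_lfunA.
by apply/clP/clU; apply: cup_space_gen.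
Qed.

(** Each of the first [j] pairs of output positions is a cap: one and the same capped index is sent
    to [i] on both sides. *)
Definition cup_pairs (j : nat) a b := [forall i : 'I_k, (i < j)%N ==>
  [exists p : 'I_k, [&& (p < m)%N, a p == i & b p == i]]].

Lemma cup_space_pairs (j : nat) f : (j <= m)%N -> f \in cup_space (fun _ _ => true) ->
  (CU j \o f)%VF \in cup_space (cup_pairs j).
Proof.
move=> + fC; elim: j => [_|j IH jm].
  have -> : (CU 0 \o f)%VF = f by apply/lfunP => v; rewrite comp_lfunE CUE.
  rewrite (_ : cup_space (cup_pairs 0) = cup_space (fun _ _ => true)) //.
  by congr (_ + <<_>>)%VS; congr (map _ _); apply: eq_filter => z; apply/forallP.
have jk : (j < k)%N := leq_trans jm mk; pose q := Ordinal jk.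
have -> : (CU j.+1 \o f)%VF = (CT q q \o (CU j \o f))%VF.
  apply/lfunP => v; rewrite !comp_lfunE CTE !CUE.
  by rewrite -[j.+1]/((val q).+1) cupsS.
move: (CU j \o f)%VF (IH (ltnW jm)); apply: cup_space_lin; [exact: mem_CT|exact: addvSl|move=> a b Pab].
have aq : a (iv a q) = q by rewrite permKV.
have bq : b (iv b q) = q by rewrite permKV.
have pairs a' b' : (forall p : 'I_k, (p < m)%N -> a p = b p -> (a p < j)%N -> a' p = a p /\ b' p = b p) ->
    (exists p : 'I_k, [/\ (p < m)%N, a' p = q & b' p = q]) -> cup_pairs j.+1 a' b'.
  move=> Hp [p [pm ap bp]]; apply/forallP => i; apply/implyP; rewrite ltnS leq_eqVlt => /predU1P [ij|ij].
    by apply/existsP; exists p; rewrite pm ap bp -val_eqE /= ij eqxx.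
  have /existsP [p' /and3P [pm' /eqP ap' /eqP bp']] := implyP (forallP Pab i) ij.
  have [] := Hp p' pm'; rewrite ?ap' ?bp' // => ap2 bp2.
  by apply/existsP; exists p'; rewrite pm' ap2 bp2 eqxx.
case: (cup_space_CT q q a b) => [H|[E im ->]|[E im ->]|[E im ->]].
- by apply: (subvP (addvSl _ _)).
- rewrite memvZ // cup_space_gen //; apply: pairs => //.
  by exists (iv a q); rewrite im aq {1}E bq.
- apply: cup_space_gen; apply: pairs => [p pm ab aj|]; last first.
    by exists (iv a q); rewrite im aq permM tpermL bq.
  rewrite permM tpermD //; first by apply: contraTneq aj => <-; rewrite aq ltnn.
  by apply: contraTneq aj => E1; rewrite ab -E1 bq ltnn.
- apply: cup_space_gen; apply: pairs => [p pm ab aj|]; last first.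
    by exists (iv b q); rewrite im bq permM tpermR aq.
  rewrite permM tpermD //; first by apply: contraTneq aj => <-; rewrite aq ltnn.
  by apply: contraTneq aj => E1; rewrite ab -E1 bq ltnn.
Qed.

Definition tail : pred 'I_k := fun p => (m <= p)%N.

(** The common permutation [s] of the capped indices is what [cups_fix] absorbs; the remaining
    factors move uncapped positions only. *)
Lemma perm_split a b : cup_pairs m a b -> exists a' b' s,
  [/\ supported tail a', supported tail b',
      a = (s * a')%g /\ b = (s * b')%g &
      (forall i : 'I_k, (i < m)%N -> (s i < m)%N) /\ (forall i : 'I_k, (m <= i)%N -> s i = i)].
Proof.
move=> /forallP Pab.
have ex (i : 'I_k) : (i < m)%N -> exists p : 'I_k, [/\ (p < m)%N, a p = i & b p = i].
  by move=> im; have /existsP [p /and3P [pm /eqP ap /eqP bp]] := implyP (Pab i) im; exists p.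
have low (p : 'I_k) : (p < m)%N -> (a p < m)%N /\ b p = a p.
  move=> pm.
  pose A := [set i : 'I_k | (i < m)%N].
  have sub : A \subset [set a p | p in A].
    apply/subsetP => i; rewrite inE => /ex [p' [pm' ap _]].
    by apply/imsetP; exists p'; rewrite ?inE.
  have E : A = [set a p | p in A].
    by apply/eqP; rewrite eqEcard sub (card_imset _ (@perm_inj _ a)) leqnn.
  have apm : a p \in A by rewrite E; apply/imsetP; exists p; rewrite ?inE.
  rewrite inE in apm; split=> //; have [p' [_ ap bp]] := ex _ apm.
  by rewrite -bp; congr (b _); exact/esym/(perm_inj ap).
have sinj : injective (fun p : 'I_k => if (p < m)%N then a p else p).
  move=> p q /=; case: ltnP => pm; case: ltnP => qm // E; first exact: (perm_inj E).
    by have [] := low p pm; rewrite E ltnNge qm.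
  by have [] := low q qm; rewrite -E ltnNge pm.
pose s := perm sinj.
have s1 (i : 'I_k) : (i < m)%N -> s i = a i by move=> im; rewrite permE im.
have s2 (i : 'I_k) : (m <= i)%N -> s i = i by move=> im; rewrite permE ltnNge im.
have sup c : (forall p : 'I_k, (p < m)%N -> c p = a p) -> supported tail (s^-1 * c)%g.
  move=> ca.
  have fixp (p : 'I_k) : (p < m)%N -> (s^-1 * c)%g p = p.
    move=> pm; rewrite permM; have [q [qm aq _]] := ex p pm.
    have -> : iv s p = q by apply: (@perm_inj _ s); rewrite permKV s1.
    by rewrite ca.
  apply/keepsP; split=> p; rewrite /tail; last by rewrite -ltnNge; apply: fixp.
  move=> pm; split=> //; rewrite leqNgt; apply/negP => lt.
  by have := fixp _ lt; move/perm_inj => E1; rewrite E1 ltnNge pm in lt.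
exists (s^-1 * a)%g, (s^-1 * b)%g, s; split.
- exact: sup.
- by apply: sup => p /low [].
- by rewrite !mulKVg.
- by split=> // i im; rewrite s1 //; have [] := low i im.
Qed.

(** Between two sets of [m] caps, and modulo more caps, a diagram is a permutation of the uncapped
    positions on each side. This reduces products D B D to computations in two group algebras. *)
Lemma cups_sandwich h : h \in BrIdeal 0 ->
  (CU m \o (h \o CU m))%VF \in cup_space (fun a b => supported tail a && supported tail b).
Proof.
move=> /cup_space_left /(cup_space_pairs (leqnn m)); move: (CU m \o _)%VF => f.
suff: (cup_space (cup_pairs m) <= cup_space (fun a b => supported tail a && supported tail b))%VS.
  by move/subvP; apply.
apply/subvP => {}f fC; rewrite -[f]comp_lfun1l; move: f fC.
apply: cup_space_lin; [exact: BrIdeal_id|exact: addvSl|move=> a b /perm_split].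
move=> [a' [b' [s [a't b't [-> ->] [s1 s2]]]]]; rewrite comp_lfun1l.
have -> : (PL (s * a')%g \o (PR (s * b')%g \o CU m))%VF = (PL a' \o (PR b' \o CU m))%VF.
  apply/lfunP => v; rewrite !comp_lfunE !PLE !PRE CUE -permLM -permRM (permLR s b').
  by rewrite (cups_fix char0 n0).
by apply: cup_space_gen; rewrite a't.
Qed.

End Sandwich.

End DiagramIdeals.

(** * The first fundamental theorem *)

Section TensorInvariants.

Variables (F : fieldType) (n : nat) (J : finType).
Hypothesis char0 : [pchar F] =i pred0.

Notation word := {ffun J -> 'I_n}.
Variable phi : word -> word -> F.

Definition subst (A : word) (p : J) (i : 'I_n) : word := [ffun q => if q == p then i else A q].

(** Entry by entry, the matrix [phi] commutes with the matrix unit E_ij on the tensor power of V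
    indexed by [J]. *)
Definition gl_invariant := forall (i j : 'I_n) (A B : word),
  \sum_(q | B q == j) phi A (subst B q i) = \sum_(p | A p == i) phi (subst A p j) B.

Hypothesis inv : gl_invariant.

Lemma subst_id (A : word) p : subst A p (A p) = A.
Proof. by apply/ffunP => q; rewrite ffunE; case: eqP => // ->. Qed.

Lemma substK (A : word) p i : subst (subst A p i) p (A p) = A.
Proof. by apply/ffunP => q; rewrite !ffunE; case: eqP => // ->. Qed.

Lemma natr_char0_inj (m m' : nat) : (m%:R : F) = m'%:R -> m = m'.
Proof.
move=> E; have := intr_char0_eq0 char0 (m%:Z - m'%:Z).
by rewrite intrB -!pmulrn E subrr eqxx => /esym; lia.
Qed.

Lemma invariant_weight (A B : word) (l : 'I_n) : phi A B != 0 ->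
  #|[pred p | A p == l]| = #|[pred q | B q == l]|.
Proof.
move=> phi0; have := inv l l A B.
rewrite (eq_bigr (fun=> phi A B)) => [|q /eqP <-]; last by rewrite subst_id.
rewrite [RHS](eq_bigr (fun=> phi A B)) => [|q /eqP <-]; last by rewrite subst_id.
rewrite !sumr_const -(mulr_natl (phi A B)) -[RHS]mulr_natl => /(mulIf phi0) /natr_char0_inj ->.
by [].
Qed.

(* Every word B is reached from the injective word B0: introduce a missing letter
   of B0, or swap two letters, each time decreasing the disagreement with B0. *)
Lemma invariant_vanish (B0 : word) : injective B0 -> (forall A, phi A B0 = 0) ->
  forall A B, phi A B = 0.
Proof.
move=> B0inj phi0 A B; move: {2}#|[pred q | B q != B0 q]| (leqnn #|[pred q | B q != B0 q]|) => d.
elim: d A B => [|d IH] A B.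
  rewrite leqn0 => /eqP /card0_eq H; suff -> : B = B0 by [].
  by apply/ffunP => q; have := H q; rewrite !inE => /negbFE /eqP.
move=> Bd.
have less (C : word) q : B q != B0 q -> C q = B0 q -> (forall r, B r = B0 r -> C r = B0 r) ->
    forall A', phi A' C = 0.
  move=> Bq Cq CB A'; apply: IH; rewrite -ltnS; apply: leq_trans Bd; apply: proper_card.
  apply/properP; split; last by exists q; rewrite !inE // Cq eqxx.
  by apply/subsetP => r; rewrite !inE; apply: contra_neq => /CB.
have [[q Hq]|N] := classic (exists q, forall q', B q' != B0 q).
  (* [B0 q] does not occur in [B], so [q] is the only place of this letter in [C], and the matrix
     unit that turns it back into [B q] maps [C] to [B] alone. *)
  set C := subst B q (B0 q).
  have Bq : B q != B0 q by [].
  have C0 : forall A', phi A' C = 0.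
    apply: (less C q) => // [|r Br]; first by rewrite ffunE eqxx.
    by rewrite ffunE; case: eqP => // ->.
  have := inv (B q) (B0 q) A C; rewrite [RHS]big1 => [|p _]; last exact: C0.
  rewrite (big_pred1 q) => [|r]; first by rewrite substK.
  rewrite /= ffunE; case: (r =P q) => _; [exact: eqxx|exact/negbTE].
have surj q : exists q', B q' = B0 q.
  apply: NNPP => N'; apply: N; exists q => q'; apply/eqP => E; apply: N'; by exists q'.
have Binj : injective B.
  apply/injectiveP/card_uniqP; rewrite size_map -cardE.
  apply/eqP; rewrite eqn_leq; apply/andP; split.
    by rewrite (leq_trans (card_size _)) // size_map -cardE.
  rewrite -(card_codom B0inj); apply/subset_leq_card/subsetP => x /codomP [q ->].
  by have [q' <-] := surj q; apply: codom_f.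
have [->|BB0] := eqVneq B B0; first exact: phi0.
have [q Bq] : exists q, B q != B0 q.
  by apply/existsP; apply: contraNT BB0 => /existsPn H; apply/eqP/ffunP => q; apply/eqP/negPn.
have [q' Bq'] := surj q.
have q'q : q' != q by apply: contraNneq Bq => E; rewrite -{1}E Bq'.
have qq' : (q == q') = false by rewrite eq_sym (negPf q'q).
have B0q' : B q' != B0 q' by rewrite Bq' (inj_eq B0inj) qq'.
have Bq0 := Bq; set l := B0 q in Bq Bq'; set i := B q in Bq *.
(* Here [B] is a rearrangement of [B0], and [C] is [B] with two letters exchanged so that [q] is in
   place. Below, [D] carries [i] at both places: it is an image of [C] under a matrix unit, and the
   matrix unit turning [i] into [l] maps it to [C] plus [B]. *)
set C := subst (subst B q l) q' i.
have C0 : forall A', phi A' C = 0.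
  apply: (less C q) => // [|r Br]; first by rewrite !ffunE qq' eqxx.
  rewrite !ffunE; case: (r =P q') => [E|_]; first by rewrite -E Br eqxx in B0q'.
  by case: (r =P q) => // E; rewrite -E Br eqxx in Bq0.
set D := subst C q i.
have Dphi A' : phi A' D = 0.
  have := inv i l A' C; rewrite [RHS]big1 => [|p _]; last exact: C0.
  rewrite (big_pred1 q) // => r; rewrite /= !ffunE.
  case: (r =P q') => [->|rq']; first by rewrite (negPf Bq) (negPf q'q).
  case: (r =P q) => [_|_]; first exact: eqxx.
  by rewrite -Bq' (inj_eq Binj); apply/eqP.
have := inv l i A D; rewrite [RHS]big1 => [|p _]; last exact: Dphi.
rewrite (bigD1 q) /=; last by rewrite !ffunE eqxx.
have -> : subst D q l = C.
  apply/ffunP => r; rewrite !ffunE; case: (r =P q) => [->|//].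
  by rewrite qq'.
rewrite C0 add0r (big_pred1 q') => [<-|r].
  congr (phi _ _); apply/ffunP => r; rewrite !ffunE.
  case: (r =P q') => [->|]; first by rewrite Bq'.
  by case: (r =P q) => [->|].
rewrite /= !ffunE; case: (r =P q') => [->|rq']; first by rewrite (negPf q'q) eqxx.
case: (r =P q) => [_|rq]; first by rewrite andbF.
by rewrite andbT (inj_eq Binj); apply/eqP.
Qed.

End TensorInvariants.

(** * Operators commuting with gl_n *)

Section FundamentalTheorem.

Variables (F : fieldType) (n k : nat).
Hypotheses (char0 : [pchar F] =i pred0) (n0 : (0 < n)%N) (hn : (2 * k <= n)%N).

Notation tens := (tens F n k).
Notation idx := (idx n k).
Notation word := {ffun 'I_k -> 'I_n}.
Notation bword := {ffun 'I_k + 'I_k -> 'I_n}.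
Implicit Types (f g : 'End(tens)) (i j : 'I_n) (v : tens) (a b : word) (A B : bword).

Definition gl_commutes f := forall (x : 'M[F]_n) v, f (gact x v) = gact x (f v).

Lemma gact_perm (x : 'M[F]_n) s v : gact x (permL s v) = permL s (gact x v).
Proof.
apply/ffunP => -[a b]; rewrite !ffunE /=; congr (_ - _); last first.
  by apply: eq_bigr => q _; apply: eq_bigr => m _; rewrite ffunE.
rewrite [LHS](reindex_inj (@perm_inj _ s)); apply: eq_bigr => p _; apply: eq_bigr => m _.
by rewrite !ffunE /= upd_perm.
Qed.

Lemma gact_permR (x : 'M[F]_n) s v : gact x (permR s v) = permR s (gact x v).
Proof.
apply/ffunP => -[a b]; rewrite !ffunE /=; congr (_ - _).
  by apply: eq_bigr => q _; apply: eq_bigr => m _; rewrite ffunE.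
rewrite [LHS](reindex_inj (@perm_inj _ s)); apply: eq_bigr => p _; apply: eq_bigr => m _.
by rewrite !ffunE /= upd_perm.
Qed.

Lemma gact_contr (x : 'M[F]_n) (p q : 'I_k) v : gact x (contr p q v) = contr p q (gact x v).
Proof.
apply/ffunP => -[a b]; rewrite [LHS]ffunE contrE /=.
(* [R1] and [R2] collect the action away from [p] and [q]; at the contracted pair the contributions
   of V and of its dual cancel. *)
pose W := \sum_(l < n) v (upd a p l, upd b q l).
pose R1 := \sum_(r | r != p) \sum_(m < n) x (a r) m * \sum_(l < n) v (upd (upd a p l) r m, upd b q l).
pose R2 := \sum_(r | r != q) \sum_(m < n) x m (b r) * \sum_(l < n) v (upd a p l, upd (upd b q l) r m).
transitivity (if a p == b q then R1 - R2 else 0).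
  rewrite (bigD1 p) //= [X in _ - X](bigD1 q) //=.
  have -> : \sum_(m < n) x (a p) m * contr p q v (upd a p m, b) = x (a p) (b q) * W.
    rewrite (bigD1 (b q)) //= big1 ?addr0 => [|m mb]; last by rewrite contrE upd_eq (negPf mb) mulr0.
    by rewrite contrE upd_eq eqxx; congr (_ * _); apply: eq_bigr => l _; rewrite upd_upd.
  have -> : \sum_(m < n) x m (b q) * contr p q v (a, upd b q m) = x (a p) (b q) * W.
    rewrite (bigD1 (a p)) //= big1 ?addr0 => [|m mb]; last by rewrite contrE upd_eq eq_sym (negPf mb) mulr0.
    by rewrite contrE upd_eq eqxx; congr (_ * _); apply: eq_bigr => l _; rewrite upd_upd.
  rewrite opprD addrACA subrr add0r.
  case: (a p =P b q) => ab.
    congr (_ - _); apply: eq_bigr => r rp; apply: eq_bigr => m _; congr (_ * _).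
      by rewrite contrE upd_neq 1?eq_sym // ab eqxx; apply: eq_bigr => l _; rewrite updC.
    by rewrite contrE upd_neq 1?eq_sym // ab eqxx; apply: eq_bigr => l _; rewrite [X in (_, X)]updC.
  rewrite !big1 ?subr0 // => r; rewrite eq_sym => rp; apply: big1 => m _;
    by rewrite contrE upd_neq // (introF eqP ab) mulr0.
case: ifP => // _.
under [RHS]eq_bigr => l _ do rewrite ffunE /= (bigD1 p) //= [X in _ - X](bigD1 q) //= !upd_eq.
have E1 : \sum_(l < n) \sum_(m < n) x l m * v (upd (upd a p l) p m, upd b q l) =
    \sum_(l < n) \sum_(m < n) x m l * v (upd a p l, upd (upd b q l) q m).
  rewrite exchange_big; apply: eq_bigr => l _; apply: eq_bigr => m _.
  by rewrite !upd_upd.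
rewrite sumrB !big_split /= E1 opprD addrACA subrr add0r.
congr (_ - _).
  rewrite exchange_big; apply: eq_bigr => r rp; rewrite exchange_big; apply: eq_bigr => m _.
  by rewrite mulr_sumr; apply: eq_bigr => l _; rewrite upd_neq.
rewrite exchange_big; apply: eq_bigr => r rp; rewrite exchange_big; apply: eq_bigr => m _.
by rewrite mulr_sumr; apply: eq_bigr => l _; rewrite upd_neq.
Qed.

(** Moving the dual factors across turns an operator on mixed tensors into one on the 2k-th tensor
    power of V: [A] holds the output letters of V and the input letters of the dual, [B] the other
    two families. *)
Definition kernel f A B : F :=
  f (delta F ([ffun p => B (inl p)], [ffun q => A (inr q)])) ([ffun p => A (inl p)], [ffun q => B (inr q)]).

Lemma gact_delta_mx i j v a b : gact (delta_mx i j) v (a, b) =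
  \sum_(p | a p == i) v (upd a p j, b) - \sum_(q | b q == j) v (a, upd b q i).
Proof.
rewrite ffunE /=; congr (_ - _).
  rewrite [RHS]big_mkcond; apply: eq_bigr => p _.
  rewrite (bigD1 j) //= big1 ?addr0 => [|m mj]; last by rewrite mxE (negPf mj) andbF mul0r.
  by rewrite mxE eqxx andbT; case: eqP; rewrite ?mul1r ?mul0r.
rewrite [RHS]big_mkcond; apply: eq_bigr => p _.
rewrite (bigD1 i) //= big1 ?addr0 => [|m mj]; last by rewrite mxE (negPf mj) mul0r.
by rewrite mxE eqxx; case: eqP; rewrite ?mul1r ?mul0r.
Qed.

Lemma upd_switch a a' (p : 'I_k) (i j : 'I_n) :
  (a p == i) && (upd a p j == a') = (a' p == j) && (a == upd a' p i).
Proof.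
apply/andP/andP => [] [/eqP E1 /eqP E2]; split; apply/eqP.
- by rewrite -E2 upd_eq.
- by rewrite -E2 upd_upd -E1 upd_id.
- by rewrite E2 upd_eq.
- by rewrite E2 upd_upd -E1 upd_id.
Qed.

Lemma gact_delta i j a b : gact (delta_mx i j) (delta F (a, b)) =
  \sum_(p | a p == j) delta F (upd a p i, b) - \sum_(q | b q == i) delta F (a, upd b q j).
Proof.
apply/ffunP => -[a' b']; rewrite gact_delta_mx ffunE [X in _ = _ + X]ffunE !sum_ffunE.
congr (_ - _).
  rewrite big_mkcond [RHS]big_mkcond; apply: eq_bigr => p _; rewrite !ffunE !xpair_eqE.
  have := upd_switch a' a p i j.
  by case: (a' p == i); case: (a p == j); case: (upd a' p j == a); case: (a' == upd a p i) => //=; case: eqP.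
rewrite big_mkcond [RHS]big_mkcond; apply: eq_bigr => p _; rewrite !ffunE !xpair_eqE.
have := upd_switch b' b p j i.
by case: (b' p == j); case: (b p == i); case: (upd b' p i == b); case: (b' == upd b p j) => //=; rewrite ?andbF //; case: eqP.
Qed.

Lemma kernel_invariant f : gl_commutes f -> gl_invariant (kernel f).
Proof.
move=> fg i j A B.
pose a' : word := [ffun p => B (inl p)]; pose b' : word := [ffun q => A (inr q)].
pose a : word := [ffun p => A (inl p)]; pose b : word := [ffun q => B (inr q)].
have := congr1 (fun v : tens => v (a, b)) (fg (delta_mx i j) (delta F (a', b'))).
rewrite gact_delta linearB (linear_sum f) (linear_sum f) gact_delta_mx ffunE [X in _ + X]ffunE !sum_ffunE => E.
rewrite !big_sumType /=.
have -> : \sum_(q | B (inl q) == j) kernel f A (subst B (inl q) i) =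
    \sum_(p | a' p == j) f (delta F (upd a' p i, b')) (a, b).
  apply: eq_big => p; first by rewrite ffunE.
  move=> _; rewrite /kernel; congr (f (delta F (_, _)) (_, _)); apply/ffunP => q; rewrite !ffunE //.
have -> : \sum_(q | B (inr q) == j) kernel f A (subst B (inr q) i) =
    \sum_(q | b q == j) f (delta F (a', b')) (a, upd b q i).
  apply: eq_big => p; first by rewrite ffunE.
  move=> _; rewrite /kernel; congr (f (delta F (_, _)) (_, _)); apply/ffunP => q; rewrite !ffunE //.
have -> : \sum_(q | A (inl q) == i) kernel f (subst A (inl q) j) B =
    \sum_(p | a p == i) f (delta F (a', b')) (upd a p j, b).
  apply: eq_big => p; first by rewrite ffunE.
  move=> _; rewrite /kernel; congr (f (delta F (_, _)) (_, _)); apply/ffunP => q; rewrite !ffunE //.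
have -> : \sum_(q | A (inr q) == i) kernel f (subst A (inr q) j) B =
    \sum_(q | b' q == i) f (delta F (a', upd b' q j)) (a, b).
  apply: eq_big => p; first by rewrite ffunE.
  move=> _; rewrite /kernel; congr (f (delta F (_, _)) (_, _)); apply/ffunP => q; rewrite !ffunE //.
by move/eqP: E; rewrite subr_eq => /eqP ->; rewrite addrAC subrK addrC.
Qed.

Lemma cups_delta m (a b a' b' : word) : cups m (delta F (a', b')) (a, b) =
  [forall p : 'I_k, if (p < m)%N then (a p == b p) && (a' p == b' p)
                    else (a p == a' p) && (b p == b' p)]%:R.
Proof.
elim: m a b => [|m IH] a b.
  rewrite ffunE xpair_eqE; congr (_%:R); congr (nat_of_bool _).
  apply/andP/forallP => [[/eqP -> /eqP ->] p|H]; first by rewrite !eqxx.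
  by split; apply/eqP/ffunP => p; have /andP [/eqP H1 /eqP H2] := H p.
have [mk|km] := ltnP m k; last first.
  rewrite /= insubF; last by apply/negbTE; rewrite -leqNgt.
  rewrite IH; congr (_%:R); congr (nat_of_bool _); apply: eq_forallb => p.
  by have pk := leq_trans (ltn_ord p) km; rewrite pk (leqW pk).
pose q := Ordinal mk; rewrite -[m]/(val q) cupsS contrE.
have E l : (cups q (delta F (a', b'))) (upd a q l, upd b q l) =
    ((l == a' q) && (l == b' q) && [forall p : 'I_k, (p != q) ==> if (p < m.+1)%N then (a p == b p) && (a' p == b' p)
                    else (a p == a' p) && (b p == b' p)])%:R.
  rewrite IH; congr (_%:R); congr (nat_of_bool _).
  apply/forallP/andP => [H|[/andP [l1 l2] /forallP H] p].
    split; first by have := H q; rewrite ltnn !upd_eq.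
    apply/forallP => p; apply/implyP => pq; have := H p; rewrite !upd_neq //.
    by rewrite ltnS [(p <= m)%N]leq_eqVlt (negPf (_ : (p : nat) != m)).
  have [->|pq] := eqVneq p q; first by rewrite ltnn !upd_eq l1.
  rewrite !upd_neq //; have := implyP (H p) pq.
  by rewrite ltnS [(p <= m)%N]leq_eqVlt (negPf (_ : (p : nat) != m)).
under eq_bigr => l _ do rewrite E.
rewrite (bigD1 (a' q)) //= big1 ?addr0 => [|l /negPf ->] //.
rewrite eqxx /=; set Q := [forall p : 'I_k, _ ==> _].
have -> : [forall p : 'I_k, if (p < m.+1)%N then (a p == b p) && (a' p == b' p)
                    else (a p == a' p) && (b p == b' p)] = [&& a q == b q, a' q == b' q & Q].
  apply/forallP/and3P => [H|[aq a'q /forallP H] p].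
    split; [by have := H q; rewrite ltnSn => /andP []|by have := H q; rewrite ltnSn => /andP []|].
    by apply/forallP => p; rewrite H implybT.
  have [->|pq] := eqVneq p q; first by rewrite ltnSn aq a'q.
  exact: (implyP (H p) pq).
by case: (a q == b q).
Qed.

Lemma permL_delta s (a b : word) : permL s (delta F (a, b)) = delta F ([ffun p => a (iv s p)], b).
Proof.
apply/ffunP => -[a' b']; rewrite !ffunE /= !xpair_eqE; congr (_%:R); congr (nat_of_bool (_ && _)).
by apply/eqP/eqP => E; apply/ffunP => p; [rewrite -E|rewrite E]; rewrite !ffunE ?permKV ?permK.
Qed.

Lemma permR_delta s (a b : word) : permR s (delta F (a, b)) = delta F (a, [ffun p => b (iv s p)]).
Proof.
apply/ffunP => -[a' b']; rewrite !ffunE /= !xpair_eqE; congr (_%:R); congr (nat_of_bool (_ && _)).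
by apply/eqP/eqP => E; apply/ffunP => p; [rewrite -E|rewrite E]; rewrite !ffunE ?permKV ?permK.
Qed.

Lemma gact_linear (x : 'M[F]_n) : linear (fun v : tens => gact x v).
Proof.
move=> c v w; apply/ffunP => -[a b]; rewrite !ffunE /= scalerBr addrACA.
congr (_ + _); first by rewrite scaler_sumr -big_split; apply: eq_bigr => p _;
  rewrite scaler_sumr -big_split; apply: eq_bigr => m _; rewrite !ffunE mulrDr mulrCA.
rewrite -!opprD; congr (- _); rewrite scaler_sumr -big_split; apply: eq_bigr => p _.
by rewrite scaler_sumr -big_split; apply: eq_bigr => m _; rewrite !ffunE mulrDr mulrCA.
Qed.

Lemma BrIdeal_commutes f : f \in BrIdeal F n k 0 -> gl_commutes f.
Proof.
have cups_g m (x : 'M[F]_n) v : cups m (gact x v) = gact x (cups m v).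
  by elim: m => //= m ->; case: insub => // i; rewrite gact_contr.
have glin := gact_linear.
have g0 (x : 'M[F]_n) : gact x (0 : tens) = 0.
  by have := glin x (-1) 0 0; rewrite !scaleN1r addr0 oppr0 addNr.
move: f; apply: span_ind => [x v|c f g fX gg x v]; first by rewrite !zero_lfunE g0.
rewrite !add_lfunE !scale_lfunE glin gg; congr (_ *: _ + _).
have [a [b [m [c' [d [_ _ ->]]]]]] := mem_diagram_gens fX.
by rewrite !diagram_opE !gact_perm !gact_permR -cups_g gact_perm gact_permR.
Qed.

Let ord1 (p : 'I_k) : (p < n)%N.
Proof. by apply: leq_trans (ltn_ord p) (leq_trans _ hn); rewrite leq_pmull. Qed.
Let ord2 (p : 'I_k) : (k + p < n)%N.
Proof. by apply: leq_trans hn; rewrite mul2n -addnn ltn_add2l. Qed.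

(** A word with 2k distinct letters, the reason why the first fundamental theorem is proved for
    [2 * k <= n]. *)
Definition base : bword := [ffun p => match p with inl p => Ordinal (ord1 p) | inr p => Ordinal (ord2 p) end].

Lemma base_inj : injective base.
Proof.
move=> [p|p] [q|q]; rewrite !ffunE => /(congr1 val) /=.
- by move/val_inj ->.
- by move=> E; have := ltn_ord p; rewrite E ltnNge leq_addr.
- by move=> E; have := ltn_ord q; rewrite -E ltnNge leq_addr.
- by move/addnI/val_inj ->.
Qed.

(* Matching A with the base word reads off a walled diagram: letters [< k] in the
   right half of A are the caps, letters [>= k] in the left half are the cups. *)
Lemma base_diagram A : (forall l : 'I_n, #|[pred p | A p == l]| = #|[pred p | base p == l]|) ->
  exists2 f, f \in BrIdeal F n k 0 & forall A', kernel f A' base = (A' == A)%:R.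
Proof.
move=> cnt.
have Ainj : injective A.
  move=> p q Apq; apply/eqP/negPn/negP => pq.
  have : (1 < #|[pred r | A r == A p]|)%N.
    by rewrite (cardD1 p) (cardD1 q) !inE Apq eqxx eq_sym pq.
  rewrite cnt ltnNge; case/negP; rewrite leqNgt; apply/negP => /card_gt1P [x [y]].
  by rewrite !inE => -[/eqP Ex /eqP Ey]; case/eqP; apply: base_inj; rewrite Ex Ey.
have Aimg p : exists q, A p = base q.
  have : (0 < #|[pred q | base q == A p]|)%N.
    by rewrite -cnt; apply/card_gt0P; exists p; rewrite inE eqxx.
  by case/card_gt0P => q; rewrite inE => /eqP <-; exists q.
have A2k p : (A p < k + k)%N.
  have [[q|q] ->] := Aimg p; rewrite ffunE /= ?ltn_add2l //.
  exact: leq_trans (ltn_ord q) (leq_addr _ _).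
pose SL := [set p : 'I_k | (k <= A (inl p))%N]; pose SR := [set p : 'I_k | (A (inr p) < k)%N].
(* Exactly [k] letters of [base], hence of [A], lie below [k]; so the left half of [A] lacks as many
   of them as the right half holds. *)
have cS : #|SL| = #|SR|.
  have low (B : bword) : #|[pred p | (B p < k)%N]| = \sum_(l < n | (l < k)%N) #|[pred p | B p == l]|.
    rewrite -sum1_card (partition_big B (fun l : 'I_n => (l < k)%N)) //=.
    apply: eq_bigr => l lk; rewrite -sum1_card; apply: eq_bigl => p.
    by rewrite !inE; case: eqP => [->|]; rewrite ?andbF // lk.
  have Elow : #|[pred p | (A p < k)%N]| = #|[pred p | (base p < k)%N]|.
    by rewrite !low; apply: eq_bigr => l _; apply: cnt.
  have split_sum (B : bword) : #|[pred p | (B p < k)%N]| =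
      (#|[pred p : 'I_k | (B (inl p) < k)%N]| + #|[pred p : 'I_k | (B (inr p) < k)%N]|)%N.
    by rewrite -!sum1_card big_sumType.
  have base_low : #|[pred p | (base p < k)%N]| = k.
    rewrite split_sum eq_cardT => [|p]; last by rewrite !inE ffunE /= ltn_ord.
    rewrite eq_card0 => [|p]; first by rewrite size_enum_ord addn0.
    by rewrite !inE ffunE /= ltnNge leq_addr.
  rewrite split_sum base_low in Elow.
  have := cardC SL; rewrite card_ord => Ec.
  have E1 : #|[predC SL]| = #|[pred p : 'I_k | (A (inl p) < k)%N]|.
    by apply: eq_card => p; rewrite !inE ltnNge.
  have E2 : #|SR| = #|[pred p : 'I_k | (A (inr p) < k)%N]|.
    by apply: eq_card => p; rewrite !inE.
  by rewrite E1 in Ec; rewrite E2; apply: (@addnI #|[pred p : 'I_k | (A (inl p) < k)%N]|); rewrite addnC Ec Elow.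
set m := #|SL| in cS; have mk : (m <= k)%N by rewrite -[k in (_ <= k)%N]card_ord max_card.
have [al Hal] := perm_of_set (erefl m); have [de Hde] := perm_of_set (esym cS).
have uP (i : 'I_k) : (k <= A (inl (al i)))%N = (i < m)%N by rewrite Hal inE.
have vP (i : 'I_k) : (A (inr (de i)) < k)%N = (i < m)%N by rewrite Hde inE.
(* [be i] is the dual output position joined to the output position [al i] if [i < m], and to the
   dual input position [de i] by a through strand otherwise. [ga] plays the same role for the input
   positions of V. *)
have be_lt (i : 'I_k) : ((if (i < m)%N then A (inl (al i)) else A (inr (de i))) - k < k)%N.
  by case: (ltnP i m) => im; rewrite ltn_subLR // ?uP // leqNgt vP ltnNge im.
have be_inj : injective (fun i : 'I_k => Ordinal (be_lt i)).
  move=> i j /(congr1 val) /=.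
  case: (ltnP i m) => im; case: (ltnP j m) => jm E.
  - have /val_inj/Ainj [] : val (A (inl (al i))) = val (A (inl (al j))); last exact: perm_inj.
    by rewrite -[LHS](@subnK k) ?uP // E subnK ?uP.
  - have /val_inj/Ainj // : val (A (inl (al i))) = val (A (inr (de j))).
    by rewrite -[LHS](@subnK k) ?uP // E subnK // leqNgt vP -leqNgt.
  - have /val_inj/Ainj // : val (A (inr (de i))) = val (A (inl (al j))).
    by rewrite -[LHS](@subnK k) ?E ?subnK ?uP // leqNgt vP -leqNgt.
  - have /val_inj/Ainj [] : val (A (inr (de i))) = val (A (inr (de j))); last exact: perm_inj.
    by rewrite -[LHS](@subnK k) ?E ?subnK // leqNgt vP -leqNgt.
have ga_lt (i : 'I_k) : ((if (i < m)%N then A (inr (de i)) else A (inl (al i))) < k)%N.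
  by case: (ltnP i m) => im; rewrite ?vP // ltnNge uP -leqNgt.
have ga_inj : injective (fun i : 'I_k => Ordinal (ga_lt i)).
  move=> i j /(congr1 val) /=.
  by case: (ltnP i m) => im; case: (ltnP j m) => jm /val_inj /Ainj // -[] /perm_inj.
pose be := perm be_inj; pose ga := perm ga_inj.
have beE (i : 'I_k) : val (Ordinal (ord2 (be i))) = val (if (i < m)%N then A (inl (al i)) else A (inr (de i))).
  rewrite /= permE /= subnKC //; case: (ltnP i m) => im; rewrite ?uP //.
  by rewrite leqNgt vP -leqNgt.
have gaE (i : 'I_k) : val (Ordinal (ord1 (ga i))) = val (if (i < m)%N then A (inr (de i)) else A (inl (al i))).
  by rewrite /= permE /=.
exists (diagram_op F n al be m (ga^-1)%g (de^-1)%g); first exact: diagram_op_mem.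
move=> A'; rewrite /kernel diagram_opE permR_delta permL_delta ffunE /= ffunE /= cups_delta.
congr (_%:R); congr (nat_of_bool _).
transitivity [forall p : 'I_k, (A' (inl (al p)) == A (inl (al p))) && (A' (inr (de p)) == A (inr (de p)))].
  apply: eq_forallb => p; rewrite !ffunE !invgK -!val_eqE beE gaE.
  by case: (ltnP p m) => _; rewrite (eq_sym _ (val (A' (inr _)))).
apply/forallP/eqP => [H|-> p]; last by rewrite !eqxx.
apply/ffunP => -[p|p].
  by have /andP [/eqP + _] := H (iv al p); rewrite permKV.
by have /andP [_ /eqP] := H (iv de p); rewrite permKV.
Qed.

(** By [invariant_vanish] an invariant operator is determined by the column of its kernel at [base].
    Preservation of weights matches each nonzero entry there with a diagram whose column is the
    indicator of that entry, so a combination of diagrams has the same column as [f]. *)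
Lemma first_fundamental_theorem f : gl_commutes f -> f \in BrIdeal F n k 0.
Proof.
move=> fg; have ex A : exists g, g \in BrIdeal F n k 0 /\
    (kernel f A base != 0 -> forall A', kernel g A' base = (A' == A)%:R).
  have [_|N] := eqVneq (kernel f A base) 0; first by exists 0; rewrite mem0v.
  have [g gB Hg] := base_diagram (fun l => invariant_weight char0 (kernel_invariant fg) l N).
  by exists g.
have [d Hd] : exists d : bword -> 'End(tens), forall A, d A \in BrIdeal F n k 0 /\
    (kernel f A base != 0 -> forall A', kernel (d A) A' base = (A' == A)%:R).
  by exists (fun A => proj1_sig (constructive_indefinite_description _ (ex A))) => A;
     case: (constructive_indefinite_description _ _).
pose h := \sum_A kernel f A base *: d A.
have hB : h \in BrIdeal F n k 0 by apply: memv_suml => A _; rewrite memvZ //; have [] := Hd A.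
suff -> : f = h by [].
apply/eqP; rewrite -subr_eq0; apply/eqP; set r := f - h.
have rg : gl_commutes r.
  move=> x v; have HG w := lin_ofE (gact_linear x) w; rewrite -!HG !add_lfunE !opp_lfunE linearB /= !HG.
  by rewrite fg (BrIdeal_commutes hB).
have kB A B : kernel r A B = 0.
  apply: (invariant_vanish (kernel_invariant rg) base_inj) => A'.
  have -> : kernel r A' base = kernel f A' base - kernel h A' base.
    by rewrite /kernel add_lfunE opp_lfunE !ffunE.
  have -> : kernel h A' base = \sum_A kernel f A base * kernel (d A) A' base.
    rewrite /kernel sum_lfunE sum_ffunE; apply: eq_bigr => A1 _.
    by rewrite scale_lfunE ffunE.
  have E A1 : kernel f A1 base * kernel (d A1) A' base = kernel f A1 base * (A' == A1)%:R.
    have [->|N] := eqVneq (kernel f A1 base) 0; first by rewrite !mul0r.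
    by have [_ ->] := Hd A1.
  rewrite (bigD1 A') //= E eqxx mulr1 big1 ?addr0 ?subrr // => A1 AA.
  by rewrite E eq_sym (negPf AA) mulr0.
apply/lfunP => v; rewrite end_delta zero_lfunE big1 // => -[a' b'] _.
suff -> : r (delta F (a', b')) = 0 by rewrite scaler0.
apply/ffunP => -[a b].
have := kB [ffun z => match z with inl p => a p | inr q => b' q end]
           [ffun z => match z with inl p => a' p | inr q => b q end].
rewrite /kernel => H; rewrite [RHS]ffunE -[RHS]H.
by congr (r (delta F (_, _)) (_, _)); apply/ffunP => p; rewrite !ffunE.
Qed.

End FundamentalTheorem.

(** * Generators of the modules *)

Section GeneratorModule.

Variables (F : fieldType) (n k : nat).
Hypotheses (char0 : [pchar F] =i pred0) (n0 : (0 < n)%N) (hn : (2 * k <= n)%N).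

Notation tens := (tens F n k).
Notation idx := (idx n k).
Notation word := {ffun 'I_k -> 'I_n}.
Notation wordfun := (wordfun F k n).
Notation Br := (BrIdeal F n k).
Implicit Types (u v w : tens) (s t : 'S_k) (a b : word) (f : 'End(tens)) (g : wordfun).

Definition rowL E ro : tens -> tens := rowsym (@permL F n k) E ro.
Definition colL E co : tens -> tens := colsym (@permL F n k) E co.
Definition rowR E ro : tens -> tens := rowsym (@permR F n k) E ro.
Definition colR E co : tens -> tens := colsym (@permR F n k) E co.

Lemma rowL_linear E ro : linear (rowL E ro). Proof. exact: rowsym_linear (@permL_linear F n k) E ro. Qed.
Lemma colL_linear E ro : linear (colL E ro). Proof. exact: colsym_linear (@permL_linear F n k) E ro. Qed.
Lemma rowR_linear E ro : linear (rowR E ro). Proof. exact: rowsym_linear (@permR_linear F n k) E ro. Qed.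
Lemma colR_linear E ro : linear (colR E ro). Proof. exact: colsym_linear (@permR_linear F n k) E ro. Qed.

Definition ROWL E ro : 'End(tens) := lin_of (rowL_linear E ro).
Definition COLL E ro : 'End(tens) := lin_of (colL_linear E ro).
Definition ROWR E ro : 'End(tens) := lin_of (rowR_linear E ro).
Definition COLR E ro : 'End(tens) := lin_of (colR_linear E ro).

Lemma mem_ROWL E ro : ROWL E ro \in Br 0.
Proof.
have -> : ROWL E ro = \sum_(s | keeps E ro s) PL F n s.
  by apply/lfunP => v; rewrite lin_ofE sum_lfunE; apply: eq_bigr => s _; rewrite PLE.
by apply: memv_suml => s _; apply: mem_PL.
Qed.
Lemma mem_ROWR E ro : ROWR E ro \in Br 0.
Proof.
have -> : ROWR E ro = \sum_(s | keeps E ro s) PR F n s.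
  by apply/lfunP => v; rewrite lin_ofE sum_lfunE; apply: eq_bigr => s _; rewrite PRE.
by apply: memv_suml => s _; apply: mem_PR.
Qed.
Lemma mem_COLL E ro : COLL E ro \in Br 0.
Proof.
have -> : COLL E ro = \sum_(s | keeps E ro s) (-1) ^+ odd_perm s *: PL F n s.
  apply/lfunP => v; rewrite lin_ofE sum_lfunE; apply: eq_bigr => s _.
  by rewrite scale_lfunE PLE.
by apply: memv_suml => s _; rewrite memvZ // mem_PL.
Qed.
Lemma mem_COLR E ro : COLR E ro \in Br 0.
Proof.
have -> : COLR E ro = \sum_(s | keeps E ro s) (-1) ^+ odd_perm s *: PR F n s.
  apply/lfunP => v; rewrite lin_ofE sum_lfunE; apply: eq_bigr => s _.
  by rewrite scale_lfunE PRE.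
by apply: memv_suml => s _; rewrite memvZ // mem_PR.
Qed.

Lemma permL_rowR s E ro v : permL s (rowR E ro v) = rowR E ro (permL s v).
Proof.
rewrite /rowR /rowsym (pi_sum (@permL_linear F n k)); apply: eq_bigr => t _.
by rewrite permLR.
Qed.
Lemma permL_colR s E ro v : permL s (colR E ro v) = colR E ro (permL s v).
Proof.
rewrite /colR /colsym (pi_sum (@permL_linear F n k)); apply: eq_bigr => t _.
by rewrite permLZ permLR.
Qed.
Definition rev_word b : word := [ffun p => rev_ord (b p)].

Section FixedCaps.

Variable m : nat.
Hypothesis mk : (m <= k)%N.
Notation tl := (@tail k m).

Lemma tail_fixP ro s : keeps tl ro s -> forall i : 'I_k, (i < m)%N -> s i = i.
Proof. by move=> /keepsP [_ s2] i im; apply: s2; rewrite /tail -ltnNge. Qed.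

Lemma rowL_cups ro v : rowL tl ro (cups m v) = cups m (rowL tl ro v).
Proof.
rewrite /rowL /rowsym (lin_sum (@cups_linear F n k m)); apply: eq_bigr => s ks.
by rewrite permL_cups //; apply: tail_fixP ks.
Qed.
Lemma colL_cups ro v : colL tl ro (cups m v) = cups m (colL tl ro v).
Proof.
rewrite /colL /colsym (lin_sum (@cups_linear F n k m)); apply: eq_bigr => s ks.
rewrite permL_cups; last by apply: tail_fixP ks.
by rewrite (linZ (@cups_linear F n k m)).
Qed.
Lemma rowR_cups ro v : rowR tl ro (cups m v) = cups m (rowR tl ro v).
Proof.
rewrite /rowR /rowsym (lin_sum (@cups_linear F n k m)); apply: eq_bigr => s ks.
by rewrite permR_cups //; apply: tail_fixP ks.
Qed.
Lemma colR_cups ro v : colR tl ro (cups m v) = cups m (colR tl ro v).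
Proof.
rewrite /colR /colsym (lin_sum (@cups_linear F n k m)); apply: eq_bigr => s ks.
rewrite permR_cups; last by apply: tail_fixP ks.
by rewrite (linZ (@cups_linear F n k m)).
Qed.

(* The vector sum v_l (x) v_l^* in the first m pairs of positions, and g (x) g'
   in the others; the dual letters are counted from the end. *)
Definition cap_tensor g g' : tens := [ffun x : idx =>
  if [forall i : 'I_k, (i < m)%N ==> (x.1 i == x.2 i)] then g x.1 * g' (rev_word x.2) else 0].

Lemma cap_tensor_linearl g' : linear (cap_tensor^~ g').
Proof.
move=> c g1 g2; apply/ffunP => x; rewrite !ffunE; case: ifP => _; last by rewrite scaler0 addr0.
by rewrite mulrDl /GRing.scale /= mulrA.
Qed.
Lemma cap_tensor_linearr g : linear (cap_tensor g).
Proof.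
move=> c g1 g2; apply/ffunP => x; rewrite !ffunE; case: ifP => _; last by rewrite scaler0 addr0.
by rewrite mulrDr /GRing.scale /= mulrCA.
Qed.

Lemma permL_cap_tensor ro s g g' : keeps tl ro s ->
  permL s (cap_tensor g g') = cap_tensor (wperm s g) g'.
Proof.
move=> /tail_fixP fs; apply/ffunP => -[a b]; rewrite !ffunE /=; congr (if _ then _ else _).
by apply: eq_forallb => i; case: (ltnP i m) => //= /fs E; rewrite ffunE E.
Qed.

Lemma permR_cap_tensor ro s g g' : keeps tl ro s ->
  permR s (cap_tensor g g') = cap_tensor g (wperm s g').
Proof.
move=> /tail_fixP fs; apply/ffunP => -[a b]; rewrite !ffunE /=.
have -> : rev_word [ffun p => b (s p)] = [ffun p => rev_word b (s p)].
  by apply/ffunP => p; rewrite !ffunE.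
congr (if _ then _ else _).
by apply: eq_forallb => i; case: (ltnP i m) => //= /fs E; rewrite ffunE E.
Qed.

Lemma rowL_cap_tensor ro g g' :
  rowL tl ro (cap_tensor g g') = cap_tensor (rowsym (@wperm F k n) tl ro g) g'.
Proof.
rewrite /rowL /rowsym (lin_sum (cap_tensor_linearl g')); apply: eq_bigr => s ks.
exact: permL_cap_tensor ks.
Qed.
Lemma colL_cap_tensor ro g g' :
  colL tl ro (cap_tensor g g') = cap_tensor (colsym (@wperm F k n) tl ro g) g'.
Proof.
rewrite /colL /colsym (lin_sum (cap_tensor_linearl g')); apply: eq_bigr => s ks.
by rewrite (permL_cap_tensor _ _ ks) (linZ (cap_tensor_linearl g')).
Qed.
Lemma rowR_cap_tensor ro g g' :
  rowR tl ro (cap_tensor g g') = cap_tensor g (rowsym (@wperm F k n) tl ro g').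
Proof.
rewrite /rowR /rowsym (lin_sum (cap_tensor_linearr g)); apply: eq_bigr => s ks.
exact: permR_cap_tensor ks.
Qed.
Lemma colR_cap_tensor ro g g' :
  colR tl ro (cap_tensor g g') = cap_tensor g (colsym (@wperm F k n) tl ro g').
Proof.
rewrite /colR /colsym (lin_sum (cap_tensor_linearr g)); apply: eq_bigr => s ks.
by rewrite (permR_cap_tensor _ _ ks) (linZ (cap_tensor_linearr g)).
Qed.

Lemma contr_cap_tensor (i : 'I_k) g g' : (i < m)%N -> local tl g -> local tl g' ->
  contr i i (cap_tensor g g') = n%:R *: cap_tensor g g'.
Proof.
move=> im lg lg'; apply/ffunP => -[a b]; rewrite contrE [RHS]ffunE.
have [ab|ab] := eqVneq (a i) (b i); last first.
  rewrite ffunE ifF ?scaler0 //=; apply/negbTE/forallPn; exists i.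
  by rewrite im (negPf ab).
rewrite (eq_bigr (fun=> cap_tensor g g' (a, b))); first by rewrite sumr_const card_ord scaler_nat.
move=> l _; rewrite !ffunE /=.
have -> : g (upd a i l) = g a.
  apply: lg => p mp; rewrite upd_neq //; apply: contraTneq mp => ->.
  by rewrite /tail -ltnNge.
have -> : g' (rev_word (upd b i l)) = g' (rev_word b).
  apply: lg' => p mp; rewrite !ffunE ifF //; apply: contraTF mp => /eqP ->.
  by rewrite /tail -ltnNge.
congr (if _ then _ else _); apply: eq_forallb => j; rewrite !ffunE.
by case: (j =P i) => [->|//]; rewrite ab !eqxx.
Qed.

(* The diagonal torus acts on cap tensors with a weight whose positive part has
   size k - m; in positions paired by cups the contributions cancel. *)
Definition grade (x : idx) : nat :=
  (\sum_(p : 'I_k) (x.1 p < k) + \sum_(p : 'I_k) (k <= x.2 p))%N.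

Definition graded d v := forall x, v x != 0 -> grade x = d.

Lemma graded_permL d s v : graded d v -> graded d (permL s v).
Proof.
move=> gv [a b]; rewrite ffunE /= => /gv <-; rewrite /grade /=; congr (_ + _)%N.
by rewrite (reindex_inj (@perm_inj _ s)); apply: eq_bigr => p _; rewrite ffunE.
Qed.

Lemma graded_permR d s v : graded d v -> graded d (permR s v).
Proof.
move=> gv [a b]; rewrite ffunE /= => /gv <-; rewrite /grade /=; congr (_ + _)%N.
by rewrite (reindex_inj (@perm_inj _ s)); apply: eq_bigr => p _; rewrite ffunE.
Qed.

Lemma grade_upd a b (i j : 'I_k) (l : 'I_n) : a i = b j ->
  grade (upd a i l, upd b j l) = grade (a, b).
Proof.
move=> ab; rewrite /grade /= (bigD1 i) //= [X in (_ + X)%N](bigD1 j) //=.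
rewrite [in RHS](bigD1 i) //= [X in _ = (_ + X)%N](bigD1 j) //= !upd_eq ab.
rewrite (eq_bigr (fun p => (a p < k)%N : nat)) => [|p pi]; last by rewrite upd_neq.
rewrite [X in (_ + (_ + X))%N](eq_bigr (fun p => (k <= b p)%N : nat)) => [|p pi]; last by rewrite upd_neq.
by clear hn mk; case: (ltnP l k); case: (ltnP (b j) k); rewrite /= ?addnA; lia.
Qed.

Lemma graded_contr d i j v : graded d v -> graded d (contr i j v).
Proof.
move=> gv [a b]; rewrite contrE; have [ab|_] := eqVneq (a i) (b j); last by rewrite eqxx.
move=> N; have [l gl] : exists l, v (upd a i l, upd b j l) != 0.
  apply: NNPP => N'; case/eqP: N; apply: big1 => l _.
  by apply/eqP/negPn/negP => vl; apply: N'; exists l.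
by rewrite -(gv _ gl) grade_upd.
Qed.

Lemma graded_cups d m' v : graded d v -> graded d (cups m' v).
Proof. by move=> gv; elim: m' => //= m' IH; case: insub => // i; apply: graded_contr. Qed.

(** Diagrams preserve the grade. After [m1] caps each capped pair contributes exactly 1 and any
    other pair at most 2, so a surviving grade is at most [2 * k - m1]. *)
Lemma graded_kill m' d f v : f \in Br m' -> graded d v -> (2 * k - m' < d)%N -> f v = 0.
Proof.
move=> fB gv dm; move: f fB; apply: span_ind => [|c f g /mem_diagram_gens H gv0].
  by rewrite zero_lfunE.
rewrite add_lfunE scale_lfunE gv0 addr0.
have [s1 [s2 [m1 [s3 [s4 [mm1 m1k ->]]]]]] := H; rewrite diagram_opE.
set w := permL s3 _; have gw : graded d w by apply/graded_permL/graded_permR.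
suff -> : cups m1 w = 0.
  by rewrite (lin0 (@permR_linear F n k s2)) (lin0 (@permL_linear F n k s1)) scaler0.
apply/ffunP => -[a b]; rewrite [RHS]ffunE; apply/eqP/negPn/negP => N.
have := graded_cups gw N; have ab := cups_support char0 n0 N.
rewrite /grade /= -big_split /= => E; move: dm; rewrite -E ltnNge; case/negP.
apply: (@leq_trans (\sum_(p : 'I_k) (2 - (p < m1)))%N).
  apply: leq_sum => p _; case: (ltnP p m1) => pm /=; last by case: (a p < k)%N; case: (k <= b p)%N.
  by rewrite ab //; case: (ltnP (b p) k).
rewrite sumnB; last by move=> p _; case: (p < m1)%N.
rewrite sum_nat_const card_ord mulnC; apply: leq_sub2l; apply: leq_trans mm1 _.
rewrite -big_mkcond sum1_card /=.
have [al Hal] : exists h : 'I_m1 -> 'I_k, forall i, val (h i) = val i.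
  by exists (widen_ord m1k).
have ali : injective al by move=> i j /(congr1 val); rewrite !Hal => /val_inj.
rewrite -[m1 in (m1 <= _)%N]card_ord -(card_codom ali); apply/subset_leq_card/subsetP => x /codomP [i ->].
by rewrite -topredE; change (val (al i) < m1)%N; rewrite Hal ltn_ord.
Qed.

End FixedCaps.

End GeneratorModule.

(** * The elements D and the modules generated by capped polytabloids *)

Section YoungOperators.

Variables (F : fieldType) (n k m : nat).
Hypotheses (char0 : [pchar F] =i pred0) (n0 : (0 < n)%N) (hn : (2 * k <= n)%N) (mk : (m <= k)%N).

Notation tens := (tens F n k).
Notation word := {ffun 'I_k -> 'I_n}.
Notation wordfun := (wordfun F k n).
Notation Br := (BrIdeal F n k).
Notation tl := (@tail k m).
Implicit Types (u v w : tens) (s t : 'S_k) (a b : word) (f : 'End(tens)).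

Definition youngL ro co v : tens := rowL tl ro (colL tl co (rowL tl ro v)).
Definition youngR ro co v : tens := rowR tl ro (colR tl co (rowR tl ro v)).

Lemma youngL_linear ro co : linear (youngL ro co).
Proof. by move=> c v w; rewrite /youngL rowL_linear colL_linear rowL_linear. Qed.
Lemma youngR_linear ro co : linear (youngR ro co).
Proof. by move=> c v w; rewrite /youngR rowR_linear colR_linear rowR_linear. Qed.

Lemma permL_youngR s ro co v : permL s (youngR ro co v) = youngR ro co (permL s v).
Proof. by rewrite /youngR permL_rowR permL_colR permL_rowR. Qed.

Lemma commute_youngL (A : tens -> tens) : linear A ->
  (forall s v, A (permL s v) = permL s (A v)) -> forall ro co v, A (youngL ro co v) = youngL ro co (A v).
Proof.
move=> HA As ro co v.
have row ro0 w : A (rowL tl ro0 w) = rowL tl ro0 (A w).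
  by rewrite /rowL /rowsym (lin_sum HA); apply: eq_bigr => s _.
have col w : A (colL tl co w) = colL tl co (A w).
  by rewrite /colL /colsym (lin_sum HA); apply: eq_bigr => s _; rewrite (linZ HA) As.
by rewrite /youngL row col row.
Qed.

Lemma youngR_youngL ro co ro' co' v : youngR ro' co' (youngL ro co v) = youngL ro co (youngR ro' co' v).
Proof. by apply: commute_youngL => [|s w]; [exact: youngR_linear|rewrite permL_youngR]. Qed.

Lemma permR_youngL t ro co v : permR t (youngL ro co v) = youngL ro co (permR t v).
Proof. by apply: commute_youngL => [|s w]; [exact: permR_linear|rewrite permLR]. Qed.

Definition capYoung ro co ro' co' v : tens := youngL ro co (youngR ro' co' (cups m v)).

Definition YOUNG ro co ro' co' : 'End(tens) :=
  (ROWL F n tl ro \o (COLL F n tl co \o (ROWL F n tl ro \o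
    (ROWR F n tl ro' \o (COLR F n tl co' \o ROWR F n tl ro')))))%VF.

Definition CAPYOUNG ro co ro' co' : 'End(tens) := (YOUNG ro co ro' co' \o CU F n k m)%VF.

Lemma YOUNGE ro co ro' co' v : YOUNG ro co ro' co' v = youngL ro co (youngR ro' co' v).
Proof. by rewrite !comp_lfunE !lin_ofE. Qed.

Lemma CAPYOUNGE ro co ro' co' v : CAPYOUNG ro co ro' co' v = capYoung ro co ro' co' v.
Proof. by rewrite comp_lfunE YOUNGE CUE. Qed.

Lemma mem_YOUNG ro co ro' co' : YOUNG ro co ro' co' \in Br 0.
Proof.
by do ![apply: BrIdeal_left => //]; rewrite ?mem_ROWL ?mem_COLL ?mem_ROWR ?mem_COLR.
Qed.

Lemma mem_CAPYOUNG ro co ro' co' : CAPYOUNG ro co ro' co' \in Br m.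
Proof. by apply: BrIdeal_left => //; [exact: mem_YOUNG|exact: mem_CU]. Qed.

Lemma young_cups ro co ro' co' v :
  youngL ro co (youngR ro' co' (cups m v)) = cups m (youngL ro co (youngR ro' co' v)).
Proof. by rewrite /youngR /youngL !(rowR_cups, colR_cups, rowL_cups, colL_cups). Qed.

Lemma CAPYOUNG_sym ro co ro' co' v w :
  tdot (CAPYOUNG ro co ro' co' v) w = tdot v (CAPYOUNG ro co ro' co' w).
Proof.
rewrite !CAPYOUNGE /capYoung.
have adjL ro1 co1 v1 w1 : tdot (youngL ro1 co1 v1) w1 = tdot v1 (youngL ro1 co1 w1).
  rewrite /youngL /rowL /colL (rowsym_adj (@tdotl F n k) (@tdotr F n k) (@tdot_permL F n k)).
  rewrite (colsym_adj (@tdotl F n k) (@tdotr F n k) (@tdot_permL F n k)).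
  by rewrite (rowsym_adj (@tdotl F n k) (@tdotr F n k) (@tdot_permL F n k)).
have adjR ro1 co1 v1 w1 : tdot (youngR ro1 co1 v1) w1 = tdot v1 (youngR ro1 co1 w1).
  rewrite /youngR /rowR /colR (rowsym_adj (@tdotl F n k) (@tdotr F n k) (@tdot_permR F n k)).
  rewrite (colsym_adj (@tdotl F n k) (@tdotr F n k) (@tdot_permR F n k)).
  by rewrite (rowsym_adj (@tdotl F n k) (@tdotr F n k) (@tdot_permR F n k)).
by rewrite adjL adjR tdot_cups youngR_youngL young_cups.
Qed.

Section Diagrams.

Variables (ro co ro' co' : 'I_k -> nat) (lam mu : nat -> nat).
Hypotheses (lam_noninc : forall i j, (i <= j)%N -> (lam j <= lam i)%N).
Hypotheses (mu_noninc : forall i j, (i <= j)%N -> (mu j <= mu i)%N).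
Hypotheses (dgm : diagram tl ro co lam) (dgm' : diagram tl ro' co' mu).

Notation D := (CAPYOUNG ro co ro' co').

(** The symmetrizers Y commute with the caps C, so D f D = Y (C f C) Y. By [cups_sandwich] the
    middle consists of permutations of uncapped positions, and [young2_pi_young2] yields a scalar on
    each side. *)
Lemma CAPYOUNG_sandwich f : f \in Br 0 ->
  exists c : F, (D \o (f \o D))%VF - c *: D \in Br m.+1.
Proof.
move=> fB; set Y := YOUNG ro co ro' co'.
have YB : Y \in Br 0 by apply: mem_YOUNG.
have DY : D = (CU F n k m \o Y)%VF.
  by apply/lfunP => v; rewrite CAPYOUNGE comp_lfunE CUE YOUNGE /capYoung young_cups.
have DE : D = (Y \o CU F n k m)%VF by [].
have YE v : Y v = youngL ro co (youngR ro' co' v) by apply: YOUNGE.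
clearbody Y.
suff: (D \o (f \o D))%VF \in (Br m.+1 + <[D]>)%VS.
  move=> /memv_addP [x xB [y /vlineP [c ->] ->]]; exists c.
  by rewrite addrK.
have -> : (D \o (f \o D))%VF = (Y \o ((CU F n k m \o (f \o CU F n k m)) \o Y))%VF.
  by rewrite {2}DY DE !comp_lfunA.
move: (cups_sandwich char0 n0 mk fB) => /memv_addP [z1 z1B [z2 z2B ->]].
rewrite comp_lfunDl comp_lfunDr; apply: memv_add.
  by apply: BrIdeal_left => //; apply: BrIdeal_right.
move: z2 z2B; apply: span_lin => [c z z'|z].
  by rewrite comp_lfunDl comp_lfunDr -comp_lfunZl -comp_lfunZr.
move=> /mapP [[a b]]; rewrite mem_filter => /andP [/andP [/= at_ bt] _] ->.
have [c1 H1] := young2_pi_young2 char0 (@permL_linear F n k) (@permLM F n k) lam_noninc dgm at_.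
have [c2 H2] := young2_pi_young2 char0 (@permR_linear F n k) (@permRM F n k) mu_noninc dgm' bt.
have -> : (Y \o ((PL F n a \o (PR F n b \o CU F n k m)) \o Y))%VF = (c1 * c2) *: D.
  apply/lfunP => v; rewrite scale_lfunE CAPYOUNGE /capYoung !comp_lfunE.
  rewrite CUE PRE PLE !YE -young_cups; move: (cups m v) => w.
  rewrite -permL_youngR permR_youngL.
  rewrite youngR_youngL -[youngR ro' co' (permR b _)]/(young2 (@permR F n k) tl ro' co' (permR b (young2 (@permR F n k) tl ro' co' w))).
  rewrite H2 (linZ (youngL_linear ro co)) permLZ (linZ (youngL_linear ro co)).
  rewrite -[youngL ro co (permL a _)]/(young2 (@permL F n k) tl ro co (permL a (young2 (@permL F n k) tl ro co _))).
  by rewrite H1 scalerA mulrC.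
by rewrite memvZ // memv_line.
Qed.

Hypotheses (rok : forall p, tl p -> (ro p < k)%N) (ro'k : forall p, tl p -> (ro' p < k)%N).

Notation cap_tensor := (cap_tensor m).
Definition cap_gen : tens := cap_tensor (polytab F n tl ro co) (polytab F n tl ro' co').
(** A preimage of [cap_gen] under D, up to a nonzero scalar: identities for D f D applied to it
    become statements about D f on [cap_gen]. *)
Definition cap_rows : tens := cap_tensor (rowword F n tl ro) (rowword F n tl ro').

Let kn : (k <= n)%N. Proof. by apply: leq_trans hn; rewrite leq_pmull. Qed.

Lemma cups_cap_tensor m' (g g' : wordfun) : (m' <= m)%N -> local tl g -> local tl g' ->
  cups m' (cap_tensor g g') = n%:R ^+ m' *: cap_tensor g g'.
Proof.
move=> + lg lg'; elim: m' => [_|m' IH m'm]; first by rewrite expr0 scale1r.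
have m'k : (m' < k)%N := leq_trans m'm mk.
rewrite -[m'.+1]/((val (Ordinal m'k)).+1) cupsS /= IH ?(ltnW m'm) //.
by rewrite contrZ contr_cap_tensor // scalerA exprS mulrC.
Qed.

Lemma CAPYOUNG_rows : exists2 c : F, c != 0 & D cap_rows = c *: cap_gen.
Proof.
have R0 ro1 := card_keeps_neq0 char0 (k := k) tl ro1.
set r := fun ro1 : 'I_k -> nat => (#|[pred s | keeps tl ro1 s]|%:R : F).
exists (n%:R ^+ m * (r ro * r ro')).
  by rewrite !mulf_neq0 ?expf_neq0 ?R0 // natr_char0_neq0.
rewrite CAPYOUNGE /capYoung cups_cap_tensor ?leqnn //; try exact: rowword_local.
rewrite (linZ (youngR_linear ro' co')) (linZ (youngL_linear ro co)) /youngL /youngR.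
rewrite rowR_cap_tensor colR_cap_tensor rowR_cap_tensor.
rewrite rowL_cap_tensor colL_cap_tensor rowL_cap_tensor !rowword_row.
rewrite !(linZ (colsym_linear (@wperm_linear F k n) _ _)) !(linZ (rowsym_linear (@wperm_linear F k n) _ _)).
rewrite (linZ (cap_tensor_linearl m _)) (linZ (cap_tensor_linearr m _)) !scalerA.
by rewrite -!mulrA.
Qed.

Lemma cap_gen_neq0 : cap_gen <> 0.
Proof.
have ron p : tl p -> (ro p < n)%N by move=> /rok H; apply: leq_trans kn.
have ro'n p : tl p -> (ro' p < n)%N by move=> /ro'k H; apply: leq_trans kn.
have ex ro1 co1 lam1 : diagram tl ro1 co1 lam1 -> (forall p, tl p -> (ro1 p < n)%N) ->
    exists a, polytab F n tl ro1 co1 a != 0.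
  move=> d r; apply: NNPP => N; apply: (polytab_neq0 char0 d r n0); apply/ffunP => a; rewrite [RHS]ffunE.
  by apply/eqP/negPn/negP => H; apply: N; exists a.
have [a Pa] := ex _ _ _ dgm ron; have [b Pb] := ex _ _ _ dgm' ro'n.
pose b' : word := [ffun p : 'I_k => if (p < m)%N then a p else rev_ord (b p)].
move/(congr1 (fun v : tens => v (a, b'))); rewrite ffunE [RHS]ffunE /= ifT; last first.
  by apply/forallP => i; apply/implyP => im; rewrite ffunE im.
have [lP _ _] := polytab_hwspace n char0 dgm' mu_noninc.
rewrite (lP _ b) => [/eqP|p]; first by rewrite mulf_eq0 (negPf Pa) (negPf Pb).
by rewrite /tail leqNgt => /negPf pm; rewrite !ffunE pm rev_ordK.
Qed.

Lemma weight_letter lam1 ro1 co1 (g : wordfun) a p : diagram tl ro1 co1 lam1 ->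
  (forall q, tl q -> (ro1 q < k)%N) -> has_weight tl lam1 g -> g a != 0 -> tl p -> (a p < k)%N.
Proof.
move=> dg rk wg ga tp; have := wg a ga (a p).
have : (0 < #|[pred q | tl q & a q == a p]|)%N by apply/card_gt0P; exists p; rewrite inE eqxx tp.
move=> + E1; rewrite E1 => lam0; have [d1 d2 d3] := dg.
by have [q tq [<- _]] := d3 _ _ lam0; apply: rk.
Qed.

Lemma sum_lt_card m' : (m' <= k)%N -> (\sum_(p < k) (p < m') = m')%N.
Proof.
by move=> m'k; rewrite -big_mkcond -(big_ord_widen k (fun=> 1%N) m'k) sum1_card card_ord.
Qed.

Lemma graded_cap_tensor (g g' : wordfun) : has_weight tl lam g -> has_weight tl mu g' ->
  graded (2 * k - m) (cap_tensor g g').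
Proof.
move=> wg wg' [a b]; rewrite ffunE /=; case: ifP => [/forallP ab N|]; last by rewrite eqxx.
have [ga gb] : g a != 0 /\ g' (rev_word b) != 0.
  by split; apply: contraNneq N => ->; rewrite ?mul0r ?mulr0.
rewrite /grade /= -big_split /=.
rewrite (eq_bigr (fun p : 'I_k => (2 - (p < m))%N)) => [|p _].
  rewrite sumnB; last by move=> p _; case: (p < m)%N.
  by rewrite sum_nat_const card_ord sum_lt_card // mulnC.
(* A capped pair counts once. An uncapped pair counts twice: its letter of V is below [k], its dual
   letter at least [n - k], hence at least [k]. *)
case: (ltnP p m) => pm /=.
  by have /implyP /(_ pm) /eqP -> := ab p; case: (ltnP (b p) k).
have -> : (a p < k)%N by apply: (weight_letter dgm rok wg ga).
suff -> : (k <= b p)%N by [].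
have : (rev_word b p < k)%N by apply: (weight_letter dgm' ro'k wg' gb).
by rewrite ffunE /=; have := ltn_ord (b p); have := hn; lia.
Qed.

Lemma cap_gen_kill f : f \in Br m.+1 -> f cap_gen = 0 /\ f cap_rows = 0.
Proof.
move=> fB; have [mlt|km] := ltnP m k; last first.
  by move: fB; rewrite BrIdeal_top // memv0 => /eqP ->; rewrite !zero_lfunE.
have [_ _ w1] := polytab_hwspace n char0 dgm lam_noninc.
have [_ _ w2] := polytab_hwspace n char0 dgm' mu_noninc.
have lt : (2 * k - m.+1 < 2 * k - m)%N by lia.
split; apply: (graded_kill char0 n0 fB _ lt); apply: graded_cap_tensor => //;
  [exact: rowword_weight dgm|exact: rowword_weight dgm'].
Qed.

(** Uncapped letters of V are below [k] and those of the dual are not, so they never agree. *)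
Lemma contr_cap_gen (i j : 'I_k) : (m <= i)%N -> (m <= j)%N -> contr i j cap_gen = 0.
Proof.
move=> mi mj; apply/ffunP => -[a b]; rewrite contrE [RHS]ffunE; case: ifP => // _.
apply: big1 => l _; rewrite ffunE /=; case: ifP => // _.
have [_ _ w1] := polytab_hwspace n char0 dgm lam_noninc.
have [_ _ w2] := polytab_hwspace n char0 dgm' mu_noninc.
have [->|Pa] := eqVneq (polytab F n tl ro co (upd a i l)) 0; first by rewrite mul0r.
have [->|Pb] := eqVneq (polytab F n tl ro' co' (rev_word (upd b j l))) 0; first by rewrite mulr0.
have := weight_letter (p := i) dgm rok w1 Pa mi; rewrite upd_eq => l1.
have := weight_letter (p := j) dgm' ro'k w2 Pb mj; rewrite ffunE upd_eq /=.
by have := ltn_ord l; have := hn; lia.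
Qed.

Definition gen_vectors : seq tens :=
  [seq permL z.1 (permR z.2 cap_gen) | z <- enum {: 'S_k * 'S_k}].

Definition gen_module : {vspace tens} := <<gen_vectors>>%VS.

Lemma mem_gen_module s t : permL s (permR t cap_gen) \in gen_module.
Proof. by apply/memv_span/mapP; exists (s, t); rewrite ?mem_enum. Qed.

Lemma cap_gen_mem : cap_gen \in gen_module.
Proof. by have := mem_gen_module 1%g 1%g; rewrite permL1 permR1. Qed.

Lemma gen_module_lin (h : tens -> tens) (W : {vspace tens}) : linear h ->
  (forall s t, h (permL s (permR t cap_gen)) \in W) -> forall v, v \in gen_module -> h v \in W.
Proof. by move=> Hh H; apply: span_lin => // v /mapP [[s t] _ ->]. Qed.

Lemma cap_gen_cup (i : 'I_k) : (i < m)%N -> contr i i cap_gen = n%:R *: cap_gen.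
Proof.
move=> im; apply: contr_cap_tensor => //.
  by have [] := polytab_hwspace n char0 dgm lam_noninc.
by have [] := polytab_hwspace n char0 dgm' mu_noninc.
Qed.

(** Permutations of [cap_gen] already span a submodule: a contraction that meets a cap acts as a
    permutation or as the scalar [n], and any other contraction vanishes. *)
Lemma gen_module_left f v : f \in Br 0 -> v \in gen_module -> f v \in gen_module.
Proof.
have nF0 : (n%:R : F) != 0 := natr_char0_neq0 char0 n0.
have gdiv (i : 'I_k) : (i < m)%N -> cap_gen = n%:R^-1 *: contr i i cap_gen.
  by move=> im; rewrite cap_gen_cup // scalerA mulVf // scale1r.
have clL s : forall v, v \in gen_module -> permL s v \in gen_module.
  by apply: gen_module_lin => [|s' t']; [exact: permL_linear|rewrite permLM mem_gen_module].
have clR s : forall v, v \in gen_module -> permR s v \in gen_module.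
  by apply: gen_module_lin => [|s' t']; [exact: permR_linear|rewrite -permLR permRM mem_gen_module].
have clC i j : forall v, v \in gen_module -> contr i j v \in gen_module.
  apply: gen_module_lin => [|s t]; first exact: contr_linear.
  rewrite contr_perms; apply/clL/clR; move: (iv s i) (iv t j) => {}i {}j.
  have [im|im] := ltnP i m.
    have [<-|ij] := eqVneq i j; first by rewrite cap_gen_cup // memvZ // cap_gen_mem.
    rewrite (gdiv i im) contrZ contr_contrR // memvZ // cap_gen_cup // permRZ memvZ //.
    exact/clR/cap_gen_mem.
  have [jm|jm] := ltnP j m.
    have ij : j != i by apply: contraTneq jm => ->; rewrite -leqNgt.
    rewrite (gdiv j jm) contrZ contr_contrL // memvZ // cap_gen_cup // permLZ memvZ //.
    exact/clL/cap_gen_mem.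
  by rewrite contr_cap_gen // mem0v.
have clU m' : forall v, v \in gen_module -> cups m' v \in gen_module.
  by elim: m' => // m' IH v0 v0N /=; case: insub => [i|]; rewrite ?clC ?IH.
move=> fB vN; move: f fB; apply: span_ind => [|c f g /mem_diagram_gens [a [b [m1 [c1 [d [_ _ ->]]]]]] gN].
  by rewrite zero_lfunE mem0v.
rewrite add_lfunE scale_lfunE rpredD // memvZ // diagram_opE.
exact: (clL _ _ (clR _ _ (clU _ _ (clL _ _ (clR _ _ vN))))).
Qed.

(** Since [cap_gen] is a multiple of D [cap_rows], the sandwich identity for D s t D computes D s t
    [cap_gen]; its error term kills [cap_rows]. *)
Lemma CAPYOUNG_gen_module v : v \in gen_module -> D v \in <[cap_gen]>%VS.
Proof.
apply: gen_module_lin => [|s t]; first by move=> c x y; rewrite linearP.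
have [c0 c0n E0] := CAPYOUNG_rows.
have -> : permL s (permR t cap_gen) = (PL F n s \o PR F n t)%VF cap_gen.
  by rewrite comp_lfunE PLE PRE.
have fB : (PL F n s \o PR F n t)%VF \in Br 0 by apply: BrIdeal_left => //; [exact: mem_PL|exact: mem_PR].
have [c Hc] := CAPYOUNG_sandwich fB; have [_] := cap_gen_kill Hc.
move: E0; move: (CAPYOUNG _ _ _ _) (PL F n s \o PR F n t)%VF => d h E0.
rewrite add_lfunE opp_lfunE scale_lfunE !comp_lfunE E0 [h _]linearZ [d _]linearZ => /eqP.
rewrite subr_eq0 scalerA mulrC -scalerA => /eqP /(scalerI c0n) ->.
by rewrite memvZ // memv_line.
Qed.

Lemma tintegral_cap_tensor (g g' : wordfun) : integral g -> integral g' -> tintegral (cap_tensor g g').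
Proof.
move=> ig ig' [a b]; rewrite ffunE; case: ifP => _; last by exists 0.
by have [z1 ->] := ig a; have [z2 ->] := ig' (rev_word b); exists (z1 * z2); rewrite intrM.
Qed.

Lemma CAPYOUNG_detect p : p \in gen_module -> p <> 0 ->
  exists s t, D (permR t (permL s p)) <> 0.
Proof.
move=> pN p0.
have [s [t Hst]] : exists s t, tdot p (permL s (permR t cap_gen)) != 0.
  apply: NNPP => N; apply: p0.
  apply: (@int_span_nondegenerate F char0 _ _ (fun x (v : tens) => v x) _ _ gen_vectors) => //.
  - by move=> x c v w; rewrite !ffunE.
  - by move=> v H; apply/ffunP => x; rewrite H ffunE.
  - move=> v /mapP [[s t] _ ->]; apply/tintegral_permL/tintegral_permR/tintegral_cap_tensor.
      exact: polytab_integral.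
    exact: polytab_integral.
  - move=> v /mapP [[s t] _ ->]; apply/eqP/negPn/negP => H; apply: N; by exists s, t.
have [c0 c0n E0] := CAPYOUNG_rows.
exists (s^-1)%g, (t^-1)%g => h0; move/eqP: Hst; apply.
(* Moving the self-adjoint D to the other side of the form produces [cap_gen], and moving the
   permutations produces the nonzero pairing. *)
have : tdot (D (permR (t^-1)%g (permL (s^-1)%g p))) cap_rows = 0 by rewrite h0 (dt0l (@tdotl F n k)).
rewrite CAPYOUNG_sym E0 (dtZr (@tdotr F n k)) => /eqP.
by rewrite mulf_eq0 (negPf c0n) /= tdot_permR tdot_permL !invgK => /eqP.
Qed.

Lemma gen_module_irreducible p q : p \in gen_module -> p <> 0 -> q \in gen_module ->
  exists2 f, f \in Br 0 & f p = q.
Proof.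
move=> pN p0 qN.
have [f [fB fp]] : exists f, f \in Br 0 /\ f p = cap_gen.
  have [s [t /eqP Hst]] := CAPYOUNG_detect pN p0.
  pose h := (D \o (PR F n t \o PL F n s))%VF.
  have stB : (PR F n t \o PL F n s)%VF \in Br 0.
    by apply: BrIdeal_left => //; [exact: mem_PR|exact: mem_PL].
  have hB : h \in Br 0.
    apply: BrIdeal_left => //.
    by apply: (subvP (@BrIdeal_mono F n k 0 m (leq0n m))); apply: mem_CAPYOUNG.
  have hp : h p = D (permR t (permL s p)) by rewrite [h p]comp_lfunE [(PR F n _ \o _)%VF p]comp_lfunE PRE PLE.
  have /vlineP [c Ec] : h p \in <[cap_gen]>%VS.
    by rewrite /h comp_lfunE; apply: CAPYOUNG_gen_module; apply: gen_module_left.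
  have cn : c != 0 by apply: contraNneq Hst => c0'; rewrite -hp Ec c0' scale0r.
  exists (c^-1 *: h); rewrite memvZ // scale_lfunE Ec scalerA mulVf // scale1r.
  by split.
have [g gB <-] : exists2 g, g \in Br 0 & g cap_gen = q.
  move: q qN; apply: span_ind => [|c x v /mapP [[s t] _ ->] [g gB gv]].
    by exists 0; rewrite ?mem0v ?zero_lfunE.
  exists (c *: (PL F n s \o PR F n t)%VF + g); last first.
    by rewrite add_lfunE scale_lfunE comp_lfunE PLE PRE gv.
  by rewrite rpredD // memvZ //; apply: BrIdeal_left => //; [exact: mem_PL|exact: mem_PR].
by exists (g \o f)%VF; [exact: BrIdeal_left|rewrite comp_lfunE fp].
Qed.

End Diagrams.

End YoungOperators.

(** * Identification of the modules *)

Section Identification.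

Variables (F : fieldType) (n k : nat).
Hypotheses (char0 : [pchar F] =i pred0) (n0 : (0 < n)%N) (hn : (2 * k <= n)%N).

Notation tens := (tens F n k).
Notation idx := (idx n k).
Notation word := {ffun 'I_k -> 'I_n}.
Notation wordfun := (wordfun F k n).
Implicit Types (u v w : tens) (s t : seq 'I_k) (a b : word) (al be g : 'S_k).

Lemma rowword_conj (E : pred 'I_k) (ro : 'I_k -> nat) g : wperm g (rowword F n E ro) =
  rowword F n (fun p => E (iv g p)) (fun p => ro (iv g p)).
Proof.
apply/ffunP => a; rewrite !ffunE; congr (if _ then _ else _).
apply/forallP/forallP => H p.
  by have := H (iv g p); rewrite ffunE permKV.
by have := H (g p); rewrite ffunE permK.
Qed.

Lemma polytab_conj (E : pred 'I_k) (ro co : 'I_k -> nat) g : wperm g (polytab F n E ro co) =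
  polytab F n (fun p => E (iv g p)) (fun p => ro (iv g p)) (fun p => co (iv g p)).
Proof.
rewrite /polytab (pi_rowsym_conj (@wperm_linear F k n) (@wpermM F k n)).
by rewrite (pi_colsym_conj (@wperm_linear F k n) (@wpermM F k n)) rowword_conj.
Qed.

Lemma eq_polytab (E E' : pred 'I_k) (ro ro' co co' : 'I_k -> nat) : E =1 E' -> (forall p, E p -> ro p = ro' p) ->
  (forall p, E p -> co p = co' p) -> polytab F n E ro co = polytab F n E' ro' co'.
Proof.
move=> EE rr cc; rewrite /polytab (eq_rowsym _ _ EE rr) (eq_colsym _ _ EE cc).
congr (rowsym _ _ _ (colsym _ _ _ _)); apply/ffunP => a; rewrite !ffunE.
congr (if _ then _ else _); apply: eq_forallb => p; rewrite EE.
by case: (boolP (E' p)) => //= Ep; rewrite rr ?EE.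
Qed.

Lemma diagram_conj (E : pred 'I_k) (ro co : 'I_k -> nat) (lam : nat -> nat) g : diagram E ro co lam ->
  diagram (fun p => E (iv g p)) (fun p => ro (iv g p)) (fun p => co (iv g p)) lam.
Proof.
move=> [d1 d2 d3]; split=> [p|p q Ep Eq rpq cpq|i j /d3 [p Ep [rp cp]]].
- exact: d1.
- by apply: (@perm_inj _ (iv g)); apply: d2.
- by exists (g p); rewrite permK.
Qed.

Lemma eq_diagram (E E' : pred 'I_k) (ro ro' co co' : 'I_k -> nat) (lam : nat -> nat) : E =1 E' -> (forall p, E p -> ro p = ro' p) ->
  (forall p, E p -> co p = co' p) -> diagram E ro co lam -> diagram E' ro' co' lam.
Proof.
move=> EE rr cc [d1 d2 d3]; split=> [p|p q|i j /d3 [p Ep [rp cp]]].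
- by rewrite -EE => Ep; rewrite -rr // -cc //; apply: d1.
- by rewrite -!EE => Ep Eq; rewrite -!rr // -!cc //; apply: d2.
- by exists p; rewrite -?EE // -rr // -cc.
Qed.

Lemma diagram_transport (E : pred 'I_k) (ro1 co1 ro2 co2 : 'I_k -> nat) (lam : nat -> nat) :
  diagram E ro1 co1 lam -> diagram E ro2 co2 lam ->
  exists2 g, supported E g & forall p, E p -> ro2 p = ro1 (g p) /\ co2 p = co1 (g p).
Proof.
move=> [d1 d2 d3] [e1 e2 e3].
have ex p : exists q, if E p then [&& E q, ro1 q == ro2 p & co1 q == co2 p] else q == p.
  case: (boolP (E p)) => [/e1 /d3 [q Eq [rq cq]]|_]; last by exists p.
  by exists q; rewrite Eq rq cq !eqxx.
have [f fP] : exists f : 'I_k -> 'I_k, forall p,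
    if E p then [&& E (f p), ro1 (f p) == ro2 p & co1 (f p) == co2 p] else f p == p.
  by exists (fun p => xchoose (ex p)) => p; apply: (xchooseP (ex p)).
have fE p : E p -> [/\ E (f p), ro1 (f p) = ro2 p & co1 (f p) = co2 p].
  by move=> Ep; have := fP p; rewrite Ep => /and3P [? /eqP ? /eqP].
have fN p : ~~ E p -> f p = p.
  by move=> Ep; have := fP p; rewrite (negPf Ep) => /eqP.
have finj : injective f.
  move=> p q fpq; case: (boolP (E p)) (boolP (E q)) => Ep [] Eq.
  - have [_ rp cp] := fE _ Ep; have [_ rq cq] := fE _ Eq.
    by apply: e2 => //; rewrite -?rp -?rq -?cp -?cq fpq.
  - by have [+ _ _] := fE _ Ep; rewrite fpq fN // (negPf Eq).
  - by have [+ _ _] := fE _ Eq; rewrite -fpq fN // (negPf Ep).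
  - by rewrite -(fN _ Ep) -(fN _ Eq).
exists (perm finj).
  by apply/keepsP; split=> p Ep; rewrite permE; [have [] := fE _ Ep|apply: fN].
by move=> p Ep; rewrite permE; have [_ -> ->] := fE _ Ep.
Qed.

(** Distinct positions make the contractions independent: each contracted pair, having equal letters
    in [(A, B)], becomes one free common letter, and all other letters stay. *)
Lemma contrs_delta s t (A B a b : word) : uniq s -> uniq t -> size s = size t ->
  all (fun ij => A ij.1 == B ij.2) (zip s t) ->
  contrs s t (delta F (A, B)) (a, b) =
    [&& all (fun ij => a ij.1 == b ij.2) (zip s t), [forall p, (p \notin s) ==> (a p == A p)]
      & [forall p, (p \notin t) ==> (b p == B p)]]%:R.
Proof.
elim: s t a b => [|i s IH] [|j t] a b //=.
  move=> _ _ _ _; rewrite /contrs /= ffunE xpair_eqE; congr (_%:R); congr (nat_of_bool _).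
  have E (c C : word) : (c == C) = [forall p, (p \notin [::]) ==> (c p == C p)].
    by apply/eqP/forallP => [-> p|H]; [rewrite eqxx implybT|apply/ffunP => p; apply/eqP/H].
  by rewrite (E a A) (E b B).
move=> /andP [is_ us] /andP [jt ut] [sst] /andP [/eqP AB ABs].
rewrite -[contrs _ _ _]/(contr i j (contrs s t (delta F (A, B)))) contrE.
have zip_mem (P Q : pred ('I_k * 'I_k)) : (forall x y, x \in s -> y \in t -> P (x, y) = Q (x, y)) ->
    all P (zip s t) = all Q (zip s t).
  move=> PQ; apply: eq_in_all => -[x y] xy; apply: PQ.
    by move/(map_f fst): xy; rewrite -/(unzip1 _) unzip1_zip // sst.
  by move/(map_f snd): xy; rewrite -/(unzip2 _) unzip2_zip // sst.
have E l : contrs s t (delta F (A, B)) (upd a i l, upd b j l) =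
    ((l == A i) && [&& all (fun ij => a ij.1 == b ij.2) (zip s t), [forall p, (p \notin i :: s) ==> (a p == A p)]
      & [forall p, (p \notin j :: t) ==> (b p == B p)]])%:R.
  rewrite IH //; congr (_%:R); congr (nat_of_bool _).
  have -> : all (fun ij => upd a i l ij.1 == upd b j l ij.2) (zip s t) =
            all (fun ij => a ij.1 == b ij.2) (zip s t).
    apply: zip_mem => x y xs yt /=; rewrite !upd_neq //.
      by apply: contraNneq jt => <-.
    by apply: contraNneq is_ => <-.
  have H (c C : word) (q : 'I_k) (z : seq 'I_k) : q \notin z ->
      [forall p, (p \notin z) ==> (upd c q l p == C p)] =
      (l == C q) && [forall p, (p \notin q :: z) ==> (c p == C p)].
    move=> qz; apply/forallP/andP => [HH|[lq /forallP HH] p].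
      split; first by have := HH q; rewrite qz upd_eq.
      apply/forallP => p; rewrite inE negb_or; apply/implyP => /andP [pq pz].
      by have := HH p; rewrite pz upd_neq.
    have [->|pq] := eqVneq p q; first by rewrite upd_eq lq implybT.
    by rewrite upd_neq //; have := HH p; rewrite inE negb_or pq.
  rewrite (H a A i s) // (H b B j t) // -AB.
  by case: (l == A i); rewrite /= ?andbF.
under eq_bigr => l _ do rewrite E.
rewrite (bigD1 (A i)) //= big1 ?addr0 => [|l /negPf -> //].
by rewrite eqxx /=; case: (a i == b j).
Qed.

Lemma yLE T lam (E : pred 'I_k) v : std_tableau T lam E ->
  yL T v = rowsym (@permL F n k) E (fun p => rowof T p) (colsym (@permL F n k) E (fun p => colof T p) v).
Proof.
move=> stdT; apply: eq_big => [s|s _]; first exact: rowperm_keeps stdT s.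
by congr (permL s _); apply: eq_bigl => t; apply: colperm_keeps stdT t.
Qed.

Lemma yRE T lam (E : pred 'I_k) v : std_tableau T lam E ->
  yR T v = rowsym (@permR F n k) E (fun p => rowof T p) (colsym (@permR F n k) E (fun p => colof T p) v).
Proof.
move=> stdT; apply: eq_big => [s|s _]; first exact: rowperm_keeps stdT s.
by congr (permR s _); apply: eq_bigl => t; apply: colperm_keeps stdT t.
Qed.

Section Shapes.

Variables (lam mu : seq nat).
Hypothesis ok : index_ok k lam mu.

Notation r := (sumn lam).
Notation m := (k - sumn lam)%N.
Notation tl := (@tail k m).

Let lamP : is_partition lam. Proof. by case/and4P: ok. Qed.
Let muP : is_partition mu. Proof. by case/and4P: ok. Qed.
Let lam_mu : sumn lam = sumn mu. Proof. by case/and4P: ok => _ _ /eqP. Qed.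
Let lam_k : (sumn lam <= k)%N. Proof. by case/and4P: ok. Qed.
Let mk : (m <= k)%N. Proof. exact: leq_subr. Qed.
Let kn : (k <= n)%N. Proof. by apply: leq_trans hn; rewrite leq_pmull. Qed.

Lemma notin_prefix (q : seq 'I_k) g : uniq q -> size q = m ->
  (forall i : 'I_k, (i < m)%N -> g i = nth i q i) -> forall p, (p \notin q) = tl (iv g p).
Proof.
move=> uq sq Hg p; rewrite /tail leqNgt; congr (~~ _); apply/idP/idP => [pq|im].
  have im : (index p q < m)%N by rewrite -sq index_mem.
  have ik := leq_trans im mk.
  have -> : p = g (Ordinal ik) by rewrite Hg //= nth_index.
  by rewrite permK.
by rewrite -(permKV g p) Hg // mem_nth // sq.
Qed.

(** [al] and [be] carry the first [m] positions to the contracted ones. The contracted basis tensor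
    is then a transported [cap_rows] ([Eal]), and conjugation turns the symmetrizers of [T] and [Ts]
    into those of fillings of the uncapped positions. *)
Lemma gen_cap_gen s t T Ts al be :
  uniq s -> uniq t -> size s = m -> size t = m ->
  std_tableau T lam (fun p => p \notin s) -> std_tableau Ts mu (fun p => p \notin t) ->
  (forall i : 'I_k, (i < m)%N -> al i = nth i s i) ->
  (forall i : 'I_k, (i < m)%N -> be i = nth i t i) ->
  yL T (yR Ts (contrs s t (xprime F n r T Ts s t))) =
  permL al (permR be (cap_gen F n m (fun p => rowof T (al p)) (fun p => colof T (al p))
                           (fun p => rowof Ts (be p)) (fun p => colof Ts (be p)))).
Proof.
move=> us ut ss st stdT stdTs Hal Hbe.
have bound (q : seq 'I_k) (Q : seq (seq nat)) nu : sumn nu = r -> is_partition nu -> uniq q -> size q = m ->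
    std_tableau Q nu (fun p => p \notin q) ->
    forall p : 'I_k, ((if p \in q then r + index p q else rowof Q p) < n)%N.
  move=> snu nuP uq sq stdQ p; apply: leq_trans kn; case: ifP => pq.
    by move: pq; rewrite -index_mem sq -(ltn_add2l r) subnKC.
  by apply: leq_trans lam_k; rewrite -snu; apply: (std_row_bound stdQ nuP); rewrite pq.
have bA := bound s T lam erefl lamP us ss stdT.
have bB := bound t Ts mu (esym lam_mu) muP ut st stdTs.
pose A : word := [ffun p => Ordinal (bA p)].
have bB' (p : 'I_k) : ((if p \in t then r + index p t else n - (rowof Ts p).+1) < n)%N.
  by case: ifP => pt; [have := bB p; rewrite pt|rewrite ltn_subrL n0].
pose B : word := [ffun p => Ordinal (bB' p)].
have -> : xprime F n r T Ts s t = delta F (A, B).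
  apply/ffunP => -[a b]; rewrite !ffunE xpair_eqE /=.
  have -> : [forall p : 'I_k, (val (a p) == (if p \in s then r + index p s else rowof T p)%N) &&
      (val (b p) == (if p \in t then r + index p t else n - (rowof Ts p).+1)%N)] = (a == A) && (b == B).
    apply/forallP/andP => [H|[/eqP -> /eqP ->] p]; last by rewrite !ffunE !eqxx.
    by split; apply/eqP/ffunP => p; rewrite ffunE; apply/val_inj/eqP; have /andP [] := H p.
  by case: (_ && _).
have tlA := notin_prefix us ss Hal; have tlB := notin_prefix ut st Hbe.
have Eal : permL al (permR be (cap_rows F n m (fun p => rowof T (al p)) (fun p => rowof Ts (be p)))) =
    contrs s t (delta F (A, B)).
  apply/ffunP => -[a b]; rewrite contrs_delta ?ss //; last first.
    apply/allP => -[x y] xy; have [i iz E] := nthP (x, y) xy.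
    rewrite size_zip ss st minnn in iz; rewrite nth_zip ?ss // in E; case: E => Ex Ey.
    rewrite /= !ffunE -Ex -Ey -val_eqE /= !mem_nth ?ss ?st //.
    by rewrite !index_uniq ?ss ?st.
  rewrite !ffunE /=.
  have -> : [forall i : 'I_k, (i < m)%N ==> ([ffun p => a (al p)] i == [ffun p => b (be p)] i)] =
      all (fun ij => a ij.1 == b ij.2) (zip s t).
    apply/forallP/allP => [H [x y] xy|H i]; last first.
      apply/implyP => im; rewrite !ffunE Hal // Hbe //.
      apply: (H (nth i s i, nth i t i)); rewrite -nth_zip ?ss // mem_nth // size_zip ss st minnn //.
    have [i iz E] := nthP (x, y) xy; rewrite size_zip ss st minnn in iz.
    rewrite nth_zip ?ss // in E; case: E => Ex Ey.
    have ik := leq_trans iz mk; have := implyP (H (Ordinal ik)) iz.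
    rewrite !ffunE Hal // Hbe //= (set_nth_default x) ?ss // Ex.
    by rewrite (set_nth_default y) ?st // Ey.
  have -> : [forall p, tl p ==> (val ([ffun p0 => a (al p0)] p) == rowof T (al p))] =
      [forall p, (p \notin s) ==> (a p == A p)].
    apply/forallP/forallP => H p.
      apply/implyP => ps; have := H (iv al p); rewrite -tlA ps ffunE permKV /= => E1.
      by rewrite -val_eqE ffunE /= (negPf ps).
    apply/implyP => tp; have := H (al p); rewrite tlA permK tp ffunE -val_eqE ffunE /=.
    by rewrite ifN // tlA permK.
  have -> : [forall p, tl p ==> (val (rev_word [ffun p0 => b (be p0)] p) == rowof Ts (be p))] =
      [forall p, (p \notin t) ==> (b p == B p)].
    have revE (l : 'I_n) x : (x < n)%N -> (val (rev_ord l) == x) = (val l == n - x.+1)%N.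
      by move=> xn; have := ltn_ord l; rewrite /=; move=> ln; apply/eqP/eqP; lia.
    apply/forallP/forallP => H p.
      apply/implyP => pt; have bp : (rowof Ts p < n)%N by have := bB p; rewrite (negPf pt).
      have := H (iv be p); rewrite -tlB pt !ffunE permKV /=.
      rewrite -[(n - _)%N]/(val (rev_ord (b p))) revE //.
      by rewrite -val_eqE /= (negPf pt).
    apply/implyP => tp; have := H (be p); have pt : be p \notin t by rewrite tlB permK.
    have bp : (rowof Ts (be p) < n)%N by have := bB (be p); rewrite (negPf pt).
    rewrite pt !ffunE -val_eqE /= (negPf pt).
    by rewrite -[(n - (b _).+1)%N]/(val (rev_ord (b (be p)))) revE.
  by do 3 case: ifP => //=; rewrite ?mulr0 ?mul0r ?mulr1.
rewrite (yLE _ stdT) (yRE _ stdTs) -Eal.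
set X := cap_rows F n m _ _.
have conjL ro v : rowsym (@permL F n k) (fun p => p \notin s) ro (permL al v) =
    permL al (rowL tl (fun p => ro (al p)) v).
  rewrite /rowL (pi_rowsym_conj (@permL_linear F n k) (@permLM F n k)).
  by apply: eq_rowsym => p; [exact: tlA|rewrite permKV].
have conjLc ro v : colsym (@permL F n k) (fun p => p \notin s) ro (permL al v) =
    permL al (colL tl (fun p => ro (al p)) v).
  rewrite /colL (pi_colsym_conj (@permL_linear F n k) (@permLM F n k)).
  by apply: eq_colsym => p; [exact: tlA|rewrite permKV].
have conjR ro v : rowsym (@permR F n k) (fun p => p \notin t) ro (permR be v) =
    permR be (rowR tl (fun p => ro (be p)) v).
  rewrite /rowR (pi_rowsym_conj (@permR_linear F n k) (@permRM F n k)).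
  by apply: eq_rowsym => p; [exact: tlB|rewrite permKV].
have conjRc ro v : colsym (@permR F n k) (fun p => p \notin t) ro (permR be v) =
    permR be (colR tl (fun p => ro (be p)) v).
  rewrite /colR (pi_colsym_conj (@permR_linear F n k) (@permRM F n k)).
  by apply: eq_colsym => p; [exact: tlB|rewrite permKV].
rewrite [X in rowsym _ _ _ (colsym _ _ _ X)](_ : _ = permL al (permR be
   (rowR tl (fun p => rowof Ts (be p)) (colR tl (fun p => colof Ts (be p)) X)))); last first.
  by rewrite permLR conjRc conjR -permL_colR -permL_rowR -permLR.
rewrite conjLc conjL; congr (permL al _).
rewrite /X /cap_rows colR_cap_tensor rowR_cap_tensor.
have commR g ro v : rowL tl ro (permR g v) = permR g (rowL tl ro v).
  rewrite /rowL /rowsym (pi_sum (@permR_linear F n k)); apply: eq_bigr => s' _; exact: permLR.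
have commRc g ro v : colL tl ro (permR g v) = permR g (colL tl ro v).
  rewrite /colL /colsym (pi_sum (@permR_linear F n k)); apply: eq_bigr => s' _.
  by rewrite permRZ permLR.
by rewrite commRc commR colL_cap_tensor rowL_cap_tensor.
Qed.

Let lam_n : (size lam <= n)%N.
Proof. exact: leq_trans (partition_size lamP) (leq_trans lam_k kn). Qed.
Let mu_n : (size mu <= n)%N.
Proof. by apply: leq_trans (partition_size muP) (leq_trans _ kn); rewrite -lam_mu. Qed.

Lemma perm_cap_tensor (h : 'S_k) (g g' : wordfun) : (forall i, (h i < m)%N = (i < m)%N) ->
  permL h (permR h (cap_tensor m g g')) = cap_tensor m (wperm h g) (wperm h g').
Proof.
move=> hm; apply/ffunP => -[a b]; rewrite !ffunE /=.
have -> : rev_word [ffun p => b (h p)] = [ffun p => rev_word b (h p)].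
  by apply/ffunP => p; rewrite !ffunE.
congr (if _ then _ else _); apply/forallP/forallP => H i.
  by have := H (iv h i); rewrite !ffunE permKV -hm permKV.
by have := H (h i); rewrite !ffunE hm.
Qed.

Lemma Mlm_space : exists W : {vspace tens}, forall v, Mlm lam mu v <-> v \in W.
Proof.
have [X [XP PX]] := span_of_pred (@gen F n k lam mu).
exists <<X>>%VS => v; split=> [[Y [YP vY]]|vX]; last by exists X.
by apply: subvP vY; apply/span_subvP => y /YP /PX.
Qed.

(** An arbitrary filling, transported by [al], need not be standard, whereas [Mlm] is spanned by
    tensors of standard tableaux only. *)
Lemma straighten_polytab (nu : seq nat) (q : seq 'I_k) (al : 'S_k) ro co :
  is_partition nu -> (size nu <= n)%N -> (forall p, (p \notin q) = tl (iv al p)) ->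
  diagram tl ro co (nth 0%N nu) -> exists (c : word -> F) (T : word -> seq (seq nat)) (A : {set word}),
    (forall a, a \in A -> std_tableau (T a) nu (fun p => p \notin q)) /\
    polytab F n tl ro co = \sum_(a in A) c a *:
      polytab F n tl (fun p => rowof (T a) (al p)) (fun p => colof (T a) (al p)).
Proof.
move=> nuP nun tlq dgm; have nuN := partition_noninc nuP.
pose E : pred 'I_k := fun p => p \notin q.
have H : hwspace E (nth 0%N nu) (wperm al (polytab F n tl ro co)).
  rewrite polytab_conj.
  rewrite (@eq_polytab _ E _ (fun p => ro (iv al p)) _ (fun p => co (iv al p))) //; last first.
    by move=> p; rewrite /E tlq.
  apply: polytab_hwspace => //.
  by apply: eq_diagram (diagram_conj al dgm) => // p; rewrite /E tlq.
have [c Hc] := straightening char0 n0 nuP nun H.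
exists c, (fun a => tab_of E nu a), (std_words E n0 nu); split=> [w wA|].
  by have [] := std_word_tab nuP nun wA.
have W1 : wperm (al^-1)%g (wperm al (polytab F n tl ro co)) = polytab F n tl ro co.
  by rewrite wpermM mulgV wperm1.
rewrite -W1 Hc (lin_sum (@wperm_linear F k n _)); apply: eq_bigr => w _.
rewrite (linZ (@wperm_linear F k n _)) /tabfun polytab_conj; congr (_ *: _).
by apply: eq_polytab => [p|p _|p _]; rewrite ?invgK // /E tlq permK.
Qed.

(** [gen] wants the list [s] increasing. A permutation [h] applied to both sides and preserving the
    capped indices sorts it: the caps do not change and the fillings are relabelled. Straightening
    on both sides then expresses the tensor by generators. *)
Lemma cap_gen_Mlm (al be : 'S_k) ro co ro' co' :
  diagram tl ro co (nth 0%N lam) -> diagram tl ro' co' (nth 0%N mu) ->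
  Mlm lam mu (permL al (permR be (cap_gen F n m ro co ro' co'))).
Proof.
have [W HW] := Mlm_space.
suff sorted_case s t (al' be' : 'S_k) ro1 co1 ro1' co1' : sorted ltn (map val s) -> uniq t ->
    size s = m -> size t = m ->
    (forall i : 'I_k, (i < m)%N -> al' i = nth i s i) ->
    (forall i : 'I_k, (i < m)%N -> be' i = nth i t i) ->
    diagram tl ro1 co1 (nth 0%N lam) -> diagram tl ro1' co1' (nth 0%N mu) ->
    permL al' (permR be' (cap_gen F n m ro1 co1 ro1' co1')) \in W.
  move=> dgm dgm'; apply/HW; pose s := [seq p <- enum 'I_k | (iv al p < m)%N].
  have us : uniq s by apply: filter_uniq; apply: enum_uniq.
  have ss : size s = m.
    rewrite size_filter -sum1_count big_mkcond big_enum /= (reindex_inj (@perm_inj _ al)) /=.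
    by rewrite -[RHS](sum_lt_card mk); apply: eq_bigr => p _; rewrite permK; case: (p < m)%N.
  have [al' Hal] := perm_of_uniq us; rewrite ss in Hal.
  have [h Eh] : exists h : 'S_k, h = (al' * al^-1)%g by exists (al' * al^-1)%g.
  pose be' : 'S_k := (h * be)%g.
  have sort_s : sorted ltn (map val s).
    have := @sorted_filter _ ltn ltn_trans [pred x : nat | x \in map val s] (map val (enum 'I_k)).
    rewrite val_enum_ord iota_ltn_sorted => /(_ isT); rewrite -val_enum_ord filter_map.
    congr (sorted _ (map _ _)); apply: eq_in_filter => p pk.
    by rewrite /= mem_map; [rewrite mem_filter pk andbT|exact: val_inj].
  have hm0 (i : 'I_k) : (i < m)%N -> (h i < m)%N.
    move=> im; rewrite Eh permM Hal //.
    by have : nth i s i \in s; [rewrite mem_nth // ss|rewrite mem_filter => /andP []].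
  have hm (i : 'I_k) : (h i < m)%N = (i < m)%N.
    apply/idP/idP; last exact: hm0.
    have E : [set h x | x in [set i : 'I_k | (i < m)%N]] = [set i : 'I_k | (i < m)%N].
      apply/eqP; rewrite eqEcard card_imset ?leqnn ?andbT; last exact: perm_inj.
      by apply/subsetP => y /imsetP [x + ->]; rewrite !inE; apply: hm0.
    move=> him.
    have : h i \in [set i : 'I_k | (i < m)%N] by rewrite inE.
    by rewrite -E => /imsetP [x + /perm_inj ->]; rewrite inE.
  pose t := [seq be (iv al p) | p <- s].
  have hm' (i : 'I_k) : (iv h i < m)%N = (i < m)%N by rewrite -[in RHS](permKV h i) hm.
  have tlh p : tl p = tl (h p) by rewrite /tail leqNgt -(hm p) -leqNgt.
  have -> : permL al (permR be (cap_gen F n m ro co ro' co')) =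
      permL al' (permR be' (cap_gen F n m (fun p => ro (h p)) (fun p => co (h p))
        (fun p => ro' (h p)) (fun p => co' (h p)))).
    have -> : cap_gen F n m (fun p => ro (h p)) (fun p => co (h p)) (fun p => ro' (h p)) (fun p => co' (h p)) =
        permL (h^-1)%g (permR (h^-1)%g (cap_gen F n m ro co ro' co')).
      have E1 ro0 co0 : wperm (h^-1)%g (polytab F n tl ro0 co0) =
          polytab F n tl (fun p => ro0 (h p)) (fun p => co0 (h p)).
        rewrite polytab_conj.
        apply: eq_polytab => p; rewrite invgK; [by rewrite -tlh|by []|by []].
      rewrite /cap_gen.
      rewrite (perm_cap_tensor _ _ hm').
      rewrite (E1 ro co).
      by rewrite (E1 ro' co').
    by rewrite -permLR permLM permRM /be' mulKg Eh invMg invgK -mulgA mulVg mulg1.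
  have dg (nu : nat -> nat) ro0 co0 : diagram tl ro0 co0 nu ->
      diagram tl (fun p => ro0 (h p)) (fun p => co0 (h p)) nu.
    move=> d0; have := diagram_conj (h^-1)%g d0; rewrite invgK.
    by apply: eq_diagram => // p; rewrite -tlh.
  apply: (sorted_case s t) => //; try exact: dg.
  - by rewrite map_inj_uniq // => x y /perm_inj /perm_inj.
  - by rewrite size_map.
  - by move=> i im; rewrite permM Eh permM Hal // (nth_map i) ?ss.
move=> ss ut sz tz Hal Hbe dgm dgm'.
have us : uniq s by rewrite -(map_inj_uniq val_inj); apply: sorted_uniq ss; [exact: ltn_trans|exact: ltnn].
have [c [T [A [TP E]]]] := straighten_polytab lamP lam_n (notin_prefix us sz Hal) dgm.
have [c' [T' [A' [TP' E']]]] := straighten_polytab muP mu_n (notin_prefix ut tz Hbe) dgm'.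
rewrite /cap_gen E E' (lin_sum (cap_tensor_linearl m _)) (lin_sum (@permR_linear F n k _)).
rewrite (lin_sum (@permL_linear F n k _)); apply: rpred_sum => w wA.
rewrite (linZ (cap_tensor_linearl m _)) permRZ permLZ memvZ //.
rewrite (lin_sum (cap_tensor_linearr m _)) (lin_sum (@permR_linear F n k _)).
rewrite (lin_sum (@permL_linear F n k _)); apply: rpred_sum => w' wA'.
rewrite (linZ (cap_tensor_linearr m _)) permRZ permLZ memvZ //.
rewrite -[cap_tensor _ _ _]/(cap_gen F n m _ _ _ _).
rewrite -(gen_cap_gen us ut sz tz (TP w wA) (TP' w' wA') Hal Hbe).
apply/HW; exists [:: yL (T w) (yR (T' w') (contrs s t (xprime F n r (T w) (T' w') s t)))].
split; last by apply: memv_span; rewrite inE.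
by move=> x; rewrite inE => /eqP ->; exists s, t, (T w), (T' w'); split=> //; [exact: TP|exact: TP'].
Qed.

Lemma cap_gen_transport ro1 co1 ro1' co1' ro2 co2 ro2' co2' :
  diagram tl ro1 co1 (nth 0%N lam) -> diagram tl ro1' co1' (nth 0%N mu) ->
  diagram tl ro2 co2 (nth 0%N lam) -> diagram tl ro2' co2' (nth 0%N mu) ->
  exists g g' : 'S_k, cap_gen F n m ro2 co2 ro2' co2' = permL g (permR g' (cap_gen F n m ro1 co1 ro1' co1')).
Proof.
move=> d1 d1' d2 d2'; have [g gE Hg] := diagram_transport d1 d2.
have [g' gE' Hg'] := diagram_transport d1' d2'.
exists (g^-1)%g, (g'^-1)%g; rewrite /cap_gen.
rewrite (permR_cap_tensor _ _ (keepsV gE')) (permL_cap_tensor _ _ (keepsV gE)) !polytab_conj !invgK.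
have tlg (h : 'S_k) : supported tl h -> forall p, tl p = tl (h p).
  move=> /keepsP [h1 h2] p; case: (boolP (tl p)) => [/h1 [-> //]|tp].
  by rewrite (h2 p tp) (negPf tp).
by congr cap_tensor; apply: eq_polytab => p; [exact: tlg|case/Hg|case/Hg|exact: tlg|case/Hg'|case/Hg'].
Qed.

Lemma gen_fillings v : gen lam mu v -> exists al be ro co ro' co',
  [/\ diagram tl ro co (nth 0%N lam), diagram tl ro' co' (nth 0%N mu),
      v = permL al (permR be (cap_gen F n m ro co ro' co')) &
      (forall p, tl p -> (ro p < k)%N) /\ (forall p, tl p -> (ro' p < k)%N)].
Proof.
move=> [s [t [T [Ts [[ss ut] [sz tz] stdT stdTs ->]]]]].
have us : uniq s by rewrite -(map_inj_uniq val_inj); apply: sorted_uniq ss; [exact: ltn_trans|exact: ltnn].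
have [al Hal] := perm_of_uniq us; have [be Hbe] := perm_of_uniq ut.
rewrite sz in Hal; rewrite tz in Hbe.
exists al, be, (fun p => rowof T (al p)), (fun p => colof T (al p)),
  (fun p => rowof Ts (be p)), (fun p => colof Ts (be p)).
have tlA p : (al p \notin s) = tl p by rewrite (notin_prefix us sz Hal) permK.
have tlB p : (be p \notin t) = tl p by rewrite (notin_prefix ut tz Hbe) permK.
split.
- have := diagram_conj (al^-1)%g (std_diagram stdT); rewrite invgK.
  by apply: eq_diagram => p //; rewrite tlA.
- have := diagram_conj (be^-1)%g (std_diagram stdTs); rewrite invgK.
  by apply: eq_diagram => p //; rewrite tlB.
- exact: gen_cap_gen.
- split=> p tp; apply: leq_trans lam_k.
    by apply: (std_row_bound stdT lamP); rewrite tlA.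
  by rewrite lam_mu; apply: (std_row_bound stdTs muP); rewrite tlB.
Qed.

Lemma Mlm_gen_module ro co ro' co' v :
  diagram tl ro co (nth 0%N lam) -> diagram tl ro' co' (nth 0%N mu) ->
  Mlm lam mu v <-> v \in gen_module F n m ro co ro' co'.
Proof.
move=> dgm dgm'; split=> [[X [XP vX]]|].
  apply: subvP vX; apply/span_subvP => x /XP /gen_fillings [al [be [ro2 [co2 [ro2' [co2' [d2 d2' -> _]]]]]]].
  have [g [g' ->]] := cap_gen_transport dgm dgm' d2 d2'.
  by rewrite -[permR be (permL _ _)]permLR permLM permRM mem_gen_module.
have [W HW] := Mlm_space; move=> vN; apply/HW; move: v vN.
apply: (@gen_module_lin F n k m ro co ro' co' id W) => // s t.
exact/HW/cap_gen_Mlm.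
Qed.

Lemma Mlm_fillings v : Mlm lam mu v -> v <> 0 -> exists ro co ro' co',
  [/\ diagram tl ro co (nth 0%N lam), diagram tl ro' co' (nth 0%N mu),
      (forall p, tl p -> (ro p < k)%N) & (forall p, tl p -> (ro' p < k)%N)].
Proof.
move=> [[|x X] [XP vX]] v0; first by case: v0; move: vX; rewrite span_nil memv0 => /eqP.
have /gen_fillings [_ [_ [ro [co [ro' [co' [? ? _ [? ?]]]]]]]] := XP x (mem_head _ _).
by exists ro, co, ro', co'.
Qed.

End Shapes.

End Identification.

(** * The centralizer algebra *)

Section CentralizerAlgebra.

Variables (F : fieldType) (n k : nat).
Hypotheses (char0 : [pchar F] =i pred0) (n0 : (0 < n)%N) (hn : (2 * k <= n)%N).

Notation tens := (tens F n k).
Notation Br := (BrIdeal F n k).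
Implicit Types (u v w : tens) (f x y : 'End(tens)) (ro co : 'I_k -> nat).

Let nF0 : (n%:R : F) != 0. Proof. exact: natr_char0_neq0. Qed.

Definition EP : 'End(tens) :=
  foldr (fun i f => ((\1 - n%:R^-1 *: CT F n i i) \o f)%VF) \1%VF (enum 'I_k).

Lemma EPE v : EP v = eproj v.
Proof.
rewrite /EP /eproj; elim: (enum 'I_k) => [|i s IH] /=; first by rewrite id_lfunE.
by rewrite comp_lfunE IH add_lfunE opp_lfunE scale_lfunE id_lfunE CTE.
Qed.

Lemma mem_EP : EP \in Br 0.
Proof.
rewrite /EP; elim: (enum 'I_k) => [|i s IH] /=; first exact: BrIdeal_id.
apply: BrIdeal_left => //; rewrite rpredB ?memvZ ?BrIdeal_id //.
exact: mem_CT.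
Qed.

Lemma contr_eproj i v : contr i i (eproj v) = 0.
Proof.
have : i \in enum 'I_k by rewrite mem_enum.
rewrite /eproj; elim: (enum 'I_k) => //= j s IH; rewrite inE /pproj.
have cB (u w : tens) : contr i i (u - w) = contr i i u - contr i i w.
  by have := @contr_linear F n k i i (-1) w u; rewrite !scaleN1r [- w + u]addrC => ->; rewrite addrC.
rewrite cB contrZ; have [<- _|ij /IH is_] := eqVneq i j.
  by rewrite contr_contr scalerA mulVf // scale1r subrr.
by rewrite contrC // is_ (lin0 (@contr_linear F n k j j)) scaler0 subrr.
Qed.

Lemma eproj_id v : (forall i, contr i i v = 0) -> eproj v = v.
Proof.
move=> H; rewrite /eproj; elim: (enum 'I_k) => //= i s ->.
by rewrite /pproj H scaler0 subr0.
Qed.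

Lemma eproj_idem v : eproj (eproj v) = eproj v.
Proof. by apply: eproj_id => i; apply: contr_eproj. Qed.

(** Compression by the idempotent e. By the first fundamental theorem these operators, for [x] in
    [BrIdeal 0], make up the whole algebra of [Calg]. *)
Definition corner x : 'End(tens) := (EP \o (x \o EP))%VF.

Lemma cornerE x v : corner x v = eproj (x (eproj v)).
Proof. by rewrite /corner; move: EPE; move: EP => e eE; rewrite !comp_lfunE !eE. Qed.

Lemma corner_Calg x : x \in Br 0 -> Calg (corner x).
Proof.
move=> xB; have cB : corner x \in Br 0.
  apply: BrIdeal_left => //; first exact: mem_EP.
  by apply: BrIdeal_left => //; exact: mem_EP.
split=> [|v|v]; first exact: BrIdeal_commutes.
  by rewrite !cornerE eproj_idem.
by rewrite !cornerE eproj_idem.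
Qed.

Lemma Calg_mem f : Calg f -> f \in Br 0.
Proof. by move=> [fg _ _]; apply: first_fundamental_theorem. Qed.

Lemma Calg_corner f : Calg f -> corner f = f.
Proof. by move=> [_ f1 f2]; apply/lfunP => v; rewrite cornerE f1 f2. Qed.

Lemma corner_comp x y : (corner x \o corner y)%VF = corner (x \o (EP \o y))%VF.
Proof. by apply/lfunP => v; rewrite comp_lfunE !cornerE eproj_idem !comp_lfunE EPE. Qed.

Lemma corner_linear : linear corner.
Proof.
by move=> c x y; rewrite /corner comp_lfunDl comp_lfunDr -comp_lfunZl -comp_lfunZr.
Qed.

(* The data defining [CAPYOUNG] and [cap_gen]: fillings of two Young diagrams by
   the positions that are not capped. *)
Definition bifilling m (lam mu : nat -> nat) ro co ro' co' : Prop :=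
  [/\ (m <= k)%N /\ (forall i j, (i <= j)%N -> (lam j <= lam i)%N),
      forall i j, (i <= j)%N -> (mu j <= mu i)%N,
      diagram (@tail k m) ro co lam, diagram (@tail k m) ro' co' mu &
      (forall p, @tail k m p -> (ro p < k)%N) /\ (forall p, @tail k m p -> (ro' p < k)%N)].

Section Bifilling.

Variables (m : nat) (lam mu : nat -> nat) (ro co ro' co' : 'I_k -> nat).
Hypothesis fil : bifilling m lam mu ro co ro' co'.

Notation N := (gen_module F n m ro co ro' co').
Notation u0 := (cap_gen F n m ro co ro' co').
Notation D := (CAPYOUNG F n m ro co ro' co').

Lemma bifilling_left f v : f \in Br 0 -> v \in N -> f v \in N.
Proof. by move: fil => [[mk ln] mn dg dg' [rk rk']]; apply: (gen_module_left char0 n0 hn mk ln mn dg dg'). Qed.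

Lemma bifilling_irreducible p q : p \in N -> p <> 0 -> q \in N -> exists2 f, f \in Br 0 & f p = q.
Proof. by move: fil => [[mk ln] mn dg dg' [rk rk']]; apply: (gen_module_irreducible char0 n0 hn mk ln mn dg dg'). Qed.

Lemma bifilling_neq0 : u0 <> 0.
Proof. by move: fil => [[mk ln] mn dg dg' [rk rk']]; apply: (cap_gen_neq0 char0 n0 hn mn dg dg'). Qed.

Lemma bifilling_mem : D \in Br m /\ D \in Br 0.
Proof.
move: fil => [[mk _] _ _ _ _]; have H : D \in Br m by apply: mem_CAPYOUNG.
by split=> //; apply: (subvP (@BrIdeal_mono F n k 0 m (leq0n m))).
Qed.

Lemma bifilling_kill f v : f \in Br m.+1 -> v \in N -> f v = 0.
Proof.
move: fil => [[mk ln] mn dg dg' [rk rk']] fB vN.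
suff: f v \in 0%VS by rewrite memv0 => /eqP.
move: v vN; apply: (gen_module_lin (W := 0%VS)) => [|s t]; first by move=> c a b; rewrite linearP.
have fstB : (f \o (PL F n s \o PR F n t))%VF \in Br m.+1.
  by apply: BrIdeal_right => //; apply: BrIdeal_left => //; [exact: mem_PL|exact: mem_PR].
have [] := cap_gen_kill char0 n0 hn mk ln mn dg dg' rk rk' fstB.
by rewrite comp_lfunE [(PL F n s \o _)%VF _]comp_lfunE PRE PLE => -> _; rewrite mem0v.
Qed.

Lemma bifilling_detect p : p \in N -> p <> 0 -> exists2 f, f \in Br 0 & D (f p) <> 0.
Proof.
move: fil => [[mk _] _ _ _ _] pN p0; have [s [t H]] := CAPYOUNG_detect char0 n0 mk pN p0.
exists (PR F n t \o PL F n s)%VF; last by rewrite [(PR F n _ \o _)%VF p]comp_lfunE PRE PLE.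
by apply: BrIdeal_left => //; [exact: mem_PR|exact: mem_PL].
Qed.

Lemma bifilling_sandwich f : f \in Br 0 ->
  exists c : F, (D \o (f \o D))%VF - c *: D \in Br m.+1 /\ D (f u0) = c *: u0.
Proof.
move: fil => [[mk ln] mn dg dg' [rk rk']] fB.
have [c Hc] := CAPYOUNG_sandwich char0 n0 mk ln mn dg dg' fB.
exists c; split=> //; have [_] := cap_gen_kill char0 n0 hn mk ln mn dg dg' rk rk' Hc.
have [c0 c0n] := CAPYOUNG_rows char0 n0 mk ro co ro' co'; move: (CAPYOUNG _ _ _ _ _ _ _) => d E0.
rewrite add_lfunE opp_lfunE scale_lfunE !comp_lfunE E0 [f _]linearZ [d _]linearZ => /eqP.
by rewrite subr_eq0 scalerA mulrC -scalerA => /eqP /(scalerI c0n).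
Qed.

End Bifilling.

Lemma eMlm_bifilling lam mu : index_ok k lam mu -> nonzero (@eMlm F n k lam mu) ->
  exists ro co ro' co',
    bifilling (k - sumn lam) (nth 0%N lam) (nth 0%N mu) ro co ro' co'.
Proof.
move=> ok [_ [[v [vM ->]] e0]]; have v0 : v <> 0.
  by move=> v0; apply: e0; rewrite v0 -EPE linear0.
have [ro [co [ro' [co' [d d' rk rk']]]]] := Mlm_fillings n0 hn ok vM v0.
case/and4P: (ok) => lP mP _ _; exists ro, co, ro', co'.
by split=> //; try split=> //; try exact: leq_subr; move=> i j; apply: partition_noninc.
Qed.

Section Index.

Variables (lam mu : seq nat) (ro co ro' co' : 'I_k -> nat).
Notation m := (k - sumn lam)%N.
Hypotheses (ok : index_ok k lam mu) (fil : bifilling m (nth 0%N lam) (nth 0%N mu) ro co ro' co').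
Notation N := (gen_module F n m ro co ro' co').

(** N is stable under the idempotent e, so its image is its part fixed by e. *)
Lemma eMlmP w : eMlm lam mu w <-> w \in N /\ eproj w = w.
Proof.
have [_ _ d d' _] := fil.
have H v : Mlm lam mu v <-> v \in N by apply: Mlm_gen_module.
split=> [[v [/H vN ->]]|[wN ew]]; last by exists w; split=> //; apply/H.
split; last exact: eproj_idem.
by rewrite -EPE; apply: (bifilling_left fil) => //; apply: mem_EP.
Qed.

Lemma eMlm_submodule : Csubmodule (@eMlm F n k lam mu).
Proof.
move=> f v fC /eMlmP [vN _]; apply/eMlmP; split; last by case: fC.
by apply: (bifilling_left fil) => //; apply: Calg_mem.
Qed.

Lemma eMlm_transitive p q : eMlm lam mu p -> p <> 0 -> eMlm lam mu q ->
  exists2 f : 'End(tens), Calg f & f p = q.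
Proof.
move=> /eMlmP [pN ep] p0 /eMlmP [qN eq].
have [f fB fp] := bifilling_irreducible fil pN p0 qN.
by exists (corner f); [exact: corner_Calg|rewrite cornerE ep fp].
Qed.

Lemma eMlm_irreducible : nonzero (@eMlm F n k lam mu) -> Cirreducible (@eMlm F n k lam mu).
Proof.
move=> nz; split=> // U UW Uinv; case: (eqVneq U 0%VS) => [->|U0]; first by left.
right=> w wW; have uU := memv_pick U; have u0 : vpick U <> 0 by apply/eqP; rewrite vpick0.
by have [f fC <-] := eMlm_transitive (UW _ uU) u0 wW; apply: Uinv.
Qed.

End Index.

End CentralizerAlgebra.

(** * Separation of the modules *)

Section Separation.

Variables (F : fieldType) (n k : nat).
Hypotheses (char0 : [pchar F] =i pred0) (n0 : (0 < n)%N) (hn : (2 * k <= n)%N).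

Notation tens := (tens F n k).
Notation Br := (BrIdeal F n k).
Implicit Types (u v w : tens) (f x y : 'End(tens)) (ro co : 'I_k -> nat).

(** Each permutation of the row sum to the left of [g] merges with [g], after which
    [colsym_pi_rowsym_shape] kills every term. *)
Lemma young2_pi_young2_shape (V : lmodType F) (pi : 'S_k -> V -> V)
    (pi_linear : forall s, linear (pi s)) (piM : forall s t (v : V), pi s (pi t v) = pi (t * s)%g v)
    (E : pred 'I_k) ro co lam ro2 co2 lam2 i g (v : V) :
  (forall i j, (i <= j)%N -> (lam j <= lam i)%N) ->
  diagram E ro co lam -> diagram E ro2 co2 lam2 -> (forall j, (j < i)%N -> lam j = lam2 j) ->
  (lam i < lam2 i)%N -> supported E g ->
  young2 pi E ro co (pi g (young2 pi E ro2 co2 v)) = 0.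
Proof.
move=> ln dg dg2 same lt gE; rewrite /young2.
move: (colsym pi E co2 _) => z.
suff -> : colsym pi E co (rowsym pi E ro (pi g (rowsym pi E ro2 z))) = 0.
  by rewrite /rowsym big1 // => s _; rewrite (pi0 pi_linear).
rewrite [X in colsym _ _ _ X]/rowsym /colsym.
under eq_bigr => s _ do rewrite (pi_sum pi_linear) scaler_sumr.
rewrite exchange_big big1 // => p pk /=; rewrite piM -[LHS]/(colsym pi E co _).
apply: (colsym_pi_rowsym_shape char0 pi_linear piM ln dg z dg2 same lt).
by apply: keepsM => //; apply: keeps_supported pk.
Qed.

Section SameDegree.

Variables (m : nat) (lam mu lam2 mu2 : nat -> nat).
Variables (ro co ro' co' ro2 co2 ro2' co2' : 'I_k -> nat).
Hypotheses (fil : bifilling m lam mu ro co ro' co') (fil2 : bifilling m lam2 mu2 ro2 co2 ro2' co2').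

Notation D := (CAPYOUNG F n m ro co ro' co').

(** For the element D2 of the second filling, D f D2 lies in [BrIdeal m.+1]: the middle reduces to
    the group algebras, where the difference of shapes makes every term vanish. *)
Lemma shape_kill v :
  (exists2 i, (forall j, (j < i)%N -> lam j = lam2 j) & (lam i < lam2 i)%N) \/
  (exists2 i, (forall j, (j < i)%N -> mu j = mu2 j) & (mu i < mu2 i)%N) ->
  v \in gen_module F n m ro2 co2 ro2' co2' -> D v = 0.
Proof.
move=> H vN; have u2 := bifilling_neq0 char0 n0 hn fil2.
have [f fB <-] := bifilling_irreducible char0 n0 hn fil2 (cap_gen_mem _ _ _ _ _ _ _) u2 vN.
move: fil fil2 => [[mk ln] mn dg dg' _] [[_ ln2] mn2 dg2 dg2' [rk2 rk2']].
have [c0 c0n E0] := CAPYOUNG_rows char0 n0 mk ro2 co2 ro2' co2'.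
set Y := YOUNG F n m ro co ro' co'; set Y2 := YOUNG F n m ro2 co2 ro2' co2'.
have YB : Y \in Br 0 by apply: mem_YOUNG.
have YB2 : Y2 \in Br 0 by apply: mem_YOUNG.
have DY2 : CAPYOUNG F n m ro2 co2 ro2' co2' = (CU F n k m \o Y2)%VF.
  by apply/lfunP => w; rewrite CAPYOUNGE comp_lfunE CUE YOUNGE /capYoung young_cups.
have YE w : Y w = youngL m ro co (youngR m ro' co' w) by apply: YOUNGE.
have YE2 w : Y2 w = youngL m ro2 co2 (youngR m ro2' co2' w) by apply: YOUNGE.
have DE : D = (Y \o CU F n k m)%VF by [].
suff: (D \o (f \o CAPYOUNG F n m ro2 co2 ro2' co2'))%VF \in Br m.+1.
  move=> /(cap_gen_kill char0 n0 hn mk ln2 mn2 dg2 dg2' rk2 rk2') [_].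
  move: E0 (CAPYOUNG F n m ro co ro' co') => + d; move: (CAPYOUNG _ _ _ _ _ _ _) => d2 E0.
  rewrite !comp_lfunE E0 [f (_ *: _)]linearZ [d (_ *: _)]linearZ => /eqP.
  by rewrite scaler_eq0 (negPf c0n) => /eqP.
rewrite DY2 DE.
have -> : ((Y \o CU F n k m) \o (f \o (CU F n k m \o Y2)))%VF =
    (Y \o ((CU F n k m \o (f \o CU F n k m)) \o Y2))%VF by rewrite !comp_lfunA.
clearbody Y Y2.
move: (cups_sandwich char0 n0 mk fB) => /memv_addP [z1 z1B [z2 z2B ->]].
rewrite comp_lfunDl comp_lfunDr rpredD //.
  by apply: BrIdeal_left => //; apply: BrIdeal_right.
move: z2 z2B; apply: span_lin => [c z z'|z].
  by rewrite comp_lfunDl comp_lfunDr -comp_lfunZl -comp_lfunZr.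
move=> /mapP [[a b]]; rewrite mem_filter => /andP [/andP [/= at_ bt] _] ->.
suff -> : (Y \o ((PL F n a \o (PR F n b \o CU F n k m)) \o Y2))%VF = 0 by rewrite mem0v.
apply/lfunP => w; rewrite zero_lfunE !comp_lfunE.
rewrite CUE PRE PLE YE YE2 -young_cups; move: (cups m w) => {}w.
rewrite -permL_youngR permR_youngL youngR_youngL.
case: H => [[i same lt]|[i same lt]].
  exact: (young2_pi_young2_shape (@permL_linear F n k) (@permLM F n k) _ ln dg dg2 same lt at_).
rewrite -[youngR m ro' co' (permR b _)]/(young2 (@permR F n k) (@tail k m) ro' co'
  (permR b (young2 (@permR F n k) (@tail k m) ro2' co2' w))).
rewrite (young2_pi_young2_shape (@permR_linear F n k) (@permRM F n k) _ mn dg' dg2' same lt bt).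
by rewrite (lin0 (youngL_linear m ro2 co2)) (lin0 (@permL_linear F n k a)) (lin0 (youngL_linear m ro co)).
Qed.

End SameDegree.

Lemma partition_differ (lam lam2 : seq nat) : is_partition lam -> is_partition lam2 -> lam <> lam2 ->
  exists2 i, (forall j, (j < i)%N -> nth 0%N lam j = nth 0%N lam2 j) & nth 0%N lam i <> nth 0%N lam2 i.
Proof.
move=> P P2 ne.
have ex : exists i, nth 0%N lam i != nth 0%N lam2 i.
  apply: NNPP => N; apply: ne.
  have E i : nth 0%N lam i = nth 0%N lam2 i by apply/eqP/negPn/negP => H; apply: N; exists i.
  apply: (@eq_from_nth _ 0%N) => // .
  apply/eqP; rewrite eqn_leq; apply/andP; split; rewrite leqNgt; apply/negP => lt.
    by move: lt; rewrite -(partition_gt0 _ P) E partition_gt0 // ltnn.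
  by move: lt; rewrite -(partition_gt0 _ P2) -E partition_gt0 // ltnn.
case: (ex_minnP ex) => i ne_i min_i; exists i; last exact/eqP.
by move=> j ji; apply/eqP/negPn/negP => /min_i; rewrite leqNgt ji.
Qed.

Section TwoIndices.

Variables (lam mu lam2 mu2 : seq nat).
Variables (ro co ro' co' ro2 co2 ro2' co2' : 'I_k -> nat).
Notation m := (k - sumn lam)%N.
Notation m2 := (k - sumn lam2)%N.
Hypotheses (ok : index_ok k lam mu) (ok2 : index_ok k lam2 mu2).
Hypotheses (fil : bifilling m (nth 0%N lam) (nth 0%N mu) ro co ro' co').
Hypotheses (fil2 : bifilling m2 (nth 0%N lam2) (nth 0%N mu2) ro2 co2 ro2' co2').

Notation D := (CAPYOUNG F n m ro co ro' co').
Notation D2 := (CAPYOUNG F n m2 ro2 co2 ro2' co2').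
Notation N := (gen_module F n m ro co ro' co').
Notation N2 := (gen_module F n m2 ro2 co2 ro2' co2').

Lemma separation : (lam, mu) <> (lam2, mu2) ->
  (forall v, v \in N2 -> D v = 0) \/ (forall v, v \in N -> D2 v = 0).
Proof.
move=> ne; have [lt|gt|E] := ltngtP m m2.
- right=> v; apply: (bifilling_kill char0 n0 hn fil).
  by apply: (subvP (BrIdeal_mono F n k lt)); have [] := bifilling_mem char0 n0 fil2.
- left=> v; apply: (bifilling_kill char0 n0 hn fil2).
  by apply: (subvP (BrIdeal_mono F n k gt)); have [] := bifilling_mem char0 n0 fil.
case/and4P: ok => P M _ _; case/and4P: ok2 => P2 M2 _ _.
move: fil2; rewrite -E => fil2'.
have [lE|/eqP lN] := eqVneq lam lam2.
  have mN : mu <> mu2 by move=> mE; apply: ne; rewrite lE mE.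
  have [i same /eqP] := partition_differ M M2 mN; rewrite neq_ltn => /orP [lt|lt].
    by left=> v; apply: (shape_kill fil fil2'); right; exists i.
  by right=> v; apply: (shape_kill fil2' fil); right; exists i => // j /same.
have [i same /eqP] := partition_differ P P2 lN; rewrite neq_ltn => /orP [lt|lt].
  by left=> v; apply: (shape_kill fil fil2'); left; exists i.
by right=> v; apply: (shape_kill fil2' fil); left; exists i => // j /same.
Qed.

End TwoIndices.

(* An operator that kills one module and not the other can be moved by
   irreducibility so that it fixes a vector of [e M_{lam,mu}]. *)
Lemma eMlm_separating_operator lam mu m2 ro co ro' co' ro2 co2 ro2' co2' lam2 mu2 p :
  index_ok k lam mu -> bifilling (k - sumn lam)%N (nth 0%N lam) (nth 0%N mu) ro co ro' co' ->
  bifilling m2 lam2 mu2 ro2 co2 ro2' co2' ->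
  (forall v, v \in gen_module F n m2 ro2 co2 ro2' co2' ->
     CAPYOUNG F n (k - sumn lam)%N ro co ro' co' v = 0) ->
  eMlm lam mu p -> p <> 0 ->
  exists f : 'End(tens), [/\ Calg f, f p = p &
    forall v, v \in gen_module F n m2 ro2 co2 ro2' co2' -> f v = 0].
Proof.
move=> ok fil fil2 kill /(eMlmP char0 n0 hn ok fil) [pN ep] p0.
have [b bB Db] := bifilling_detect char0 n0 fil pN p0.
have [_ DB] := bifilling_mem char0 n0 fil.
have [b' b'B Eb'] := bifilling_irreducible char0 n0 hn fil
  (bifilling_left char0 n0 hn fil DB (bifilling_left char0 n0 hn fil bB pN)) Db pN.
move: DB kill Eb'; move: (CAPYOUNG _ _ _ _ _ _ _) => d dB kill Eb'.
exists (corner (b' \o (d \o b))%VF); split.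
- by apply: corner_Calg => //; do 2 (apply: BrIdeal_left => //).
- by rewrite cornerE !comp_lfunE ep Eb'.
move=> v vN; rewrite cornerE !comp_lfunE kill; first by rewrite linear0 -EPE linear0.
apply: (bifilling_left char0 n0 hn fil2) => //.
by rewrite -EPE; apply: (bifilling_left char0 n0 hn fil2) => //; apply: mem_EP.
Qed.

Lemma eMlm_not_iso lam mu lam2 mu2 : index_ok k lam mu -> index_ok k lam2 mu2 ->
  nonzero (@eMlm F n k lam mu) -> nonzero (@eMlm F n k lam2 mu2) ->
  (lam, mu) <> (lam2, mu2) -> ~ Ciso (@eMlm F n k lam mu) (@eMlm F n k lam2 mu2).
Proof.
move=> ok ok2 nz nz2 ne [phi [phiW phi_inj phi_surj phi_lin]].
have [ro [co [ro' [co' fil]]]] := eMlm_bifilling n0 hn ok nz.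
have [ro2 [co2 [ro2' [co2' fil2]]]] := eMlm_bifilling n0 hn ok2 nz2.
have mem2 v : eMlm lam2 mu2 v -> v \in gen_module F n (k - sumn lam2) ro2 co2 ro2' co2'.
  by move=> /(eMlmP char0 n0 hn ok2 fil2) [].
have mem1 v : eMlm lam mu v -> v \in gen_module F n (k - sumn lam) ro co ro' co'.
  by move=> /(eMlmP char0 n0 hn ok fil) [].
have [kill|kill] := separation ok ok2 fil fil2 ne.
  have [p [pW p0]] := nz.
  have [f [fC fp fk]] := eMlm_separating_operator ok fil fil2 kill pW p0.
  apply: p0; apply: phi_inj => //.
  by rewrite -fp phi_lin // fk //; apply/mem2/phiW.
have [p [pW p0]] := nz2.
have [f [fC fp fk]] := eMlm_separating_operator ok2 fil2 fil kill pW p0.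
have [v [vW Ev]] := phi_surj p pW.
by apply: p0; rewrite -fp -Ev -phi_lin // fk ?linear0 //; apply: mem1.
Qed.

End Separation.

(** * Completeness *)

Section YoungSpanning.

Variables (F : fieldType) (n k : nat).
Hypotheses (char0 : [pchar F] =i pred0) (n0 : (0 < n)%N) (hn : (2 * k <= n)%N).

Notation tens := (tens F n k).
Notation word := {ffun 'I_k -> 'I_n}.
Notation wordfun := (wordfun F k n).
Notation Br := (BrIdeal F n k).
Implicit Types (u v w z : tens) (f g : 'End(tens)) (a b : word) (E : pred 'I_k) (s : 'S_k).

Definition merge E a b : word := [ffun p => if E p then a p else b p].

(** Freezing all letters except those of V on [E] gives a function local on [E], to which
    [tabyoung_faithful] applies. *)
Definition sliceL E a0 b z : wordfun := [ffun a : word => z (merge E a a0, b)].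
Definition sliceR E b0 a z : wordfun := [ffun b : word => z (a, merge E b b0)].

Lemma eq_merge E a a' b : (forall p, E p -> a p = a' p) -> merge E a b = merge E a' b.
Proof. by move=> H; apply/ffunP => p; rewrite !ffunE; case: ifP => // /H. Qed.

Lemma merge_perm E (f : 'I_k -> nat) s a a0 : keeps E f s ->
  [ffun p => merge E a a0 (s p)] = merge E [ffun p => a (s p)] a0.
Proof.
move=> /keepsP [sE sN]; apply/ffunP => p; rewrite !ffunE.
by case: (boolP (E p)) => Ep; [have [-> _] := sE p Ep|rewrite sN // (negPf Ep)].
Qed.

Lemma sliceL_linear E a0 b : linear (sliceL E a0 b).
Proof. by move=> c z z'; apply/ffunP => a; rewrite !ffunE. Qed.
Lemma sliceR_linear E b0 a : linear (sliceR E b0 a).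
Proof. by move=> c z z'; apply/ffunP => b; rewrite !ffunE. Qed.

Lemma tabyoung_sliceL E T a0 b z : tabyoung E T (sliceL E a0 b z) =
  sliceL E a0 b (rowL E (fun p => rowof T p) (colL E (fun p => colof T p) z)).
Proof.
have H (f : 'I_k -> nat) s (v : tens) : keeps E f s -> wperm s (sliceL E a0 b v) = sliceL E a0 b (permL s v).
  by move=> ks; apply/ffunP => a; rewrite !ffunE /= (merge_perm _ _ ks).
rewrite /tabyoung /rowL /rowsym (lin_sum (sliceL_linear E a0 b)); apply: eq_bigr => s ks.
rewrite -(H _ _ _ ks); congr (wperm s _).
rewrite /colL /colsym (lin_sum (sliceL_linear E a0 b)); apply: eq_bigr => t kt.
by rewrite (linZ (sliceL_linear E a0 b)) (H _ _ _ kt).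
Qed.

Lemma tabyoung_sliceR E T b0 a z : tabyoung E T (sliceR E b0 a z) =
  sliceR E b0 a (rowR E (fun p => rowof T p) (colR E (fun p => colof T p) z)).
Proof.
have H (f : 'I_k -> nat) s (v : tens) : keeps E f s -> wperm s (sliceR E b0 a v) = sliceR E b0 a (permR s v).
  by move=> ks; apply/ffunP => b; rewrite !ffunE /= (merge_perm _ _ ks).
rewrite /tabyoung /rowR /rowsym (lin_sum (sliceR_linear E b0 a)); apply: eq_bigr => s ks.
rewrite -(H _ _ _ ks); congr (wperm s _).
rewrite /colR /colsym (lin_sum (sliceR_linear E b0 a)); apply: eq_bigr => t kt.
by rewrite (linZ (sliceR_linear E b0 a)) (H _ _ _ kt).
Qed.

Lemma merge_id E a : merge E a a = a.
Proof. by apply/ffunP => p; rewrite ffunE if_same. Qed.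

Lemma youngL_faithful m z : z <> 0 -> exists lam T,
  [/\ is_partition lam, std_tableau T lam (@tail k m) &
      youngL m (fun p => rowof T p) (fun p => colof T p) (colL (tail m) (fun p => colof T p) z) <> 0].
Proof.
move=> z0; apply: NNPP => N; apply: z0; apply/ffunP => -[a b]; rewrite [RHS]ffunE.
have -> : z (a, b) = sliceL (@tail k m) a b z a by rewrite ffunE merge_id.
rewrite (@tabyoung_faithful F k n (@tail k m) char0 n0 (sliceL (@tail k m) a b z)) ?ffunE //.
  by move=> c c' cc; rewrite !ffunE (eq_merge a cc).
move=> lam T lamP stdT; rewrite !tabyoung_sliceL -[rowL _ _ _]/(youngL m _ _ _).
suff -> : youngL m (fun p => rowof T p) (fun p => colof T p) (colL (tail m) (fun p => colof T p) z) = 0.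
  exact: lin0 (sliceL_linear _ a b).
by apply: NNPP => H; apply: N; exists lam, T.
Qed.

Lemma youngR_faithful m z : z <> 0 -> exists lam T,
  [/\ is_partition lam, std_tableau T lam (@tail k m) &
      youngR m (fun p => rowof T p) (fun p => colof T p) (colR (tail m) (fun p => colof T p) z) <> 0].
Proof.
move=> z0; apply: NNPP => N; apply: z0; apply/ffunP => -[a b]; rewrite [RHS]ffunE.
have -> : z (a, b) = sliceR (@tail k m) b a z b by rewrite ffunE merge_id.
rewrite (@tabyoung_faithful F k n (@tail k m) char0 n0 (sliceR (@tail k m) b a z)) ?ffunE //.
  by move=> c c' cc; rewrite !ffunE (eq_merge b cc).
move=> lam T lamP stdT; rewrite !tabyoung_sliceR -[rowR _ _ _]/(youngR m _ _ _).
suff -> : youngR m (fun p => rowof T p) (fun p => colof T p) (colR (tail m) (fun p => colof T p) z) = 0.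
  exact: lin0 (sliceR_linear _ b a).
by apply: NNPP => H; apply: N; exists lam, T.
Qed.

Lemma tintegral_sum (I : Type) (r : seq I) (P : pred I) (x : I -> tens) :
  (forall i, P i -> tintegral (x i)) -> tintegral (\sum_(i <- r | P i) x i).
Proof.
move=> H; apply: big_ind => // [y|v w vi wi y]; first by exists 0; rewrite ffunE.
by have [c1 E1] := vi y; have [c2 E2] := wi y; exists (c1 + c2); rewrite ffunE E1 E2 intrD.
Qed.

Lemma tintegral_sign (e : bool) v : tintegral v -> tintegral (((-1) ^+ e : F) *: v).
Proof.
move=> vi y; have [c E] := vi y; exists ((-1) ^+ e * c).
by rewrite ffunE E /GRing.scale /= intrM; case: e; rewrite ?expr0 ?expr1 ?mulrN1z.
Qed.

Lemma tintegral_CAPYOUNG m ro co ro' co' v : tintegral v ->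
  tintegral (CAPYOUNG F n m ro co ro' co' v).
Proof.
move=> vi; rewrite CAPYOUNGE /capYoung /youngL /youngR.
have rL E ro0 w : tintegral w -> tintegral (rowL E ro0 w).
  by move=> wi; apply: tintegral_sum => s _; apply: tintegral_permL.
have rR E ro0 w : tintegral w -> tintegral (rowR E ro0 w).
  by move=> wi; apply: tintegral_sum => s _; apply: tintegral_permR.
have cL E ro0 w : tintegral w -> tintegral (colL E ro0 w).
  by move=> wi; apply: tintegral_sum => s _; apply/tintegral_sign/tintegral_permL.
have cR E ro0 w : tintegral w -> tintegral (colR E ro0 w).
  by move=> wi; apply: tintegral_sum => s _; apply/tintegral_sign/tintegral_permR.
by apply/rL/cL/rL/rR/cR/rR/tintegral_cups.
Qed.

(* The elements [h D h'] of the ideal spanned by diagrams with at least [m] caps. *)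
Definition young_gen m f : Prop := exists lam mu ro co ro' co' h h',
  [/\ index_ok k lam mu, (m <= k - sumn lam)%N,
      bifilling (k - sumn lam)%N (nth 0%N lam) (nth 0%N mu) ro co ro' co',
      h \in diagram_gens F n k 0 /\ h' \in diagram_gens F n k 0 &
      f = (h \o (CAPYOUNG F n (k - sumn lam)%N ro co ro' co' \o h'))%VF].

Lemma young_gen_mem m f : young_gen m f -> f \in Br m.
Proof.
move=> [lam [mu [ro [co [ro' [co' [h [h' [_ mm fil [/memv_span hB /memv_span h'B] ->]]]]]]]]].
apply: BrIdeal_left => //; apply: BrIdeal_right => //.
by apply: (subvP (BrIdeal_mono F n k mm)); have [] := bifilling_mem char0 n0 fil.
Qed.

(** This is the reason why [young_gen] takes [h] and [h'] among the diagrams and not in their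
    span. *)
Lemma young_gen_integral m f : young_gen m f -> kintegral f.
Proof.
move=> [lam [mu [ro [co [ro' [co' [h [h' [_ _ _ [hG h'G] ->]]]]]]]]] x.
move/mem_diagram_gens: hG => [a [b [m1 [c [d [_ _ ->]]]]]].
move/mem_diagram_gens: h'G => [a' [b' [m1' [c' [d' [_ _ ->]]]]]].
rewrite [(diagram_op _ _ _ _ _ _ _ \o _)%VF _]comp_lfunE.
rewrite [(CAPYOUNG _ _ _ _ _ _ _ \o _)%VF _]comp_lfunE.
by apply/tintegral_diagram_op/tintegral_CAPYOUNG/tintegral_diagram_op/tintegral_delta.
Qed.

Lemma kdot_linear f : scalar (kdot f).
Proof.
move=> c g h; rewrite /kdot /cdot mulr_sumr -big_split /=; apply: eq_bigr => p _.
by rewrite kcoord_linear mulrDr mulrCA.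
Qed.

Lemma std_bifilling m T Ts lam mu : (m <= k)%N -> is_partition lam -> is_partition mu ->
  std_tableau T lam (@tail k m) -> std_tableau Ts mu (@tail k m) ->
  [/\ index_ok k lam mu, (k - sumn lam)%N = m &
    bifilling m (nth 0%N lam) (nth 0%N mu) (fun p : 'I_k => rowof T p) (fun p : 'I_k => colof T p)
      (fun p : 'I_k => rowof Ts p) (fun p : 'I_k => colof Ts p)].
Proof.
move=> mk lP mP sT sTs.
have ct : (#|@tail k m| + m)%N = k.
  rewrite -[X in (_ + X)%N = _](sum_lt_card mk) -sum1_card big_mkcond -big_split /=.
  rewrite -[RHS]card_ord -sum1_card; apply: eq_bigr => p _.
  by rewrite unfold_in /tail leqNgt; case: (p < m)%N.
have sl := std_card sT; have sm := std_card sTs.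
have lk : (sumn lam <= k)%N by lia.
split; first by rewrite /index_ok lP mP -sl -sm eqxx sl.
  by lia.
split=> //; [by split=> // i j; apply: partition_noninc|by move=> i j; apply: partition_noninc|exact: std_diagram|exact: std_diagram|].
split=> p tp; apply: leq_trans lk; first exact: (std_row_bound sT).
by rewrite -sl sm; apply: (std_row_bound sTs).
Qed.

(** Removing the orthogonal projection leaves [y] orthogonal to all h D h', hence D h y = 0 for
    every h. Since the symmetrizers jointly detect nonzero capped tensors, the ideal annihilates [y]
    from the left; then [y] is orthogonal to the whole ideal and vanishes. *)
Lemma young_spanning m : exists X : seq 'End(tens),
  (forall x, x \in X -> young_gen m x) /\ (Br m <= <<X>>)%VS.
Proof.
have [X [XP PX]] := span_of_pred (young_gen m); exists X; split=> //.
have XB f : f \in <<X>>%VS -> f \in Br m.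
  by apply: subvP; apply/span_subvP => x /XP /young_gen_mem.
apply/subvP => w wB.
have X_int x : x \in X -> forall p, exists z : int, kcoord p x = z%:~R.
  by move=> /XP /young_gen_integral xi p; apply: xi.
have [v vX orth] := int_span_decomposition char0 (@kcoord_linear F n k) X_int w.
suff y0 : w - v = 0 by rewrite -(subrK v w) y0 add0r.
have yB : w - v \in Br m by rewrite rpredB // XB.
move: (w - v) yB orth => {w v wB vX} y yB orth.
have mB f : f \in Br m -> f \in Br 0 by apply: subvP; apply: BrIdeal_mono.
have orthX f : f \in <<X>>%VS -> kdot y f = 0.
  move: f; apply: span_ind => [|c x g xX gX]; first by rewrite /kdot /cdot big1 // => p _; rewrite /kcoord zero_lfunE ffunE mulr0.
  by rewrite kdot_linear gX addr0 -[kdot y x]/(cdot _ _ _) orth ?mulr0.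
have genX lam mu ro co ro' co' h h' : index_ok k lam mu -> (m <= k - sumn lam)%N ->
    bifilling (k - sumn lam)%N (nth 0%N lam) (nth 0%N mu) ro co ro' co' ->
    h \in Br 0 -> h' \in Br 0 ->
    (h \o (CAPYOUNG F n (k - sumn lam)%N ro co ro' co' \o h'))%VF \in <<X>>%VS.
  move=> ok mm fil hB h'B; move: h' h'B; apply: (@span_lin F _ _ (fun h' => h \o (CAPYOUNG _ _ _ _ _ _ _ \o h'))%VF).
    by move=> c f g; rewrite !comp_lfunDr -!comp_lfunZr.
  move=> h' h'G; move: h hB; apply: (@span_lin F _ _ (fun h => h \o (CAPYOUNG _ _ _ _ _ _ _ \o h'))%VF).
    by move=> c f g; rewrite comp_lfunDl -comp_lfunZl.
  by move=> h hG; apply: PX; exists lam, mu, ro, co, ro', co', h, h'.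
have killed lam mu ro co ro' co' h : index_ok k lam mu -> (m <= k - sumn lam)%N ->
    bifilling (k - sumn lam)%N (nth 0%N lam) (nth 0%N mu) ro co ro' co' -> h \in Br 0 ->
    ((CAPYOUNG F n (k - sumn lam)%N ro co ro' co' \o h) \o y)%VF = 0.
  move=> ok mm fil hB; apply: (BrIdeal_nondegenerate char0 (m := m)) => [|g gB].
    apply: BrIdeal_left => //; apply: BrIdeal_left => //.
    by have [] := bifilling_mem char0 n0 fil.
  rewrite kdot_comp adj_comp.
  have -> : adj (CAPYOUNG F n (k - sumn lam)%N ro co ro' co') = CAPYOUNG F n (k - sumn lam)%N ro co ro' co'.
    by apply: adj_unique => v w; apply: CAPYOUNG_sym.
  rewrite -comp_lfunA; apply: orthX; apply: (genX lam mu) => //.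
    exact: BrIdeal_adj.
  exact: mB.
suff H g : g \in Br m -> (g \o y)%VF = 0.
  apply: (BrIdeal_nondegenerate char0 yB) => g gB.
  (* The form of [y] and [g] is that of [adj g \o y] and the identity. *)
  rewrite -[g]comp_lfun1r -[g]adjK -kdot_comp H; last exact: BrIdeal_adj.
  by rewrite /kdot /cdot big1 // => p _; rewrite /kcoord zero_lfunE ffunE mul0r.
move=> gB; apply/eqP; rewrite -memv0; move: g gB.
apply: (@BrIdeal_lin F n k m _ (fun g => g \o y)%VF) => [|a b m1 c d mm mk].
  by move=> c f g; rewrite comp_lfunDl -comp_lfunZl.
rewrite memv0; apply/eqP/lfunP => v; rewrite zero_lfunE comp_lfunE diagram_opE.
suff -> : cups m1 (permL c (permR d (y v))) = 0.
  by rewrite (lin0 (@permR_linear F n k b)) (lin0 (@permL_linear F n k a)).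
apply: NNPP => z0.
have [mu [Ts [mP sTs]]] := youngR_faithful m1 z0.
move=> /(@youngL_faithful m1) [lam [T [lP sT]]]; apply.
have [ok Em fil] := std_bifilling mk lP mP sT sTs.
have hB : (COLL F n (tail m1) (fun p => colof T p) \o (COLR F n (tail m1) (fun p => colof Ts p) \o
    (PL F n c \o PR F n d)))%VF \in Br 0.
  apply: BrIdeal_left => //; first exact: mem_COLL.
  apply: BrIdeal_left => //; first exact: mem_COLR.
  by apply: BrIdeal_left => //; [exact: mem_PL|exact: mem_PR].
rewrite -Em in fil.
have := killed lam mu _ _ _ _ _ ok _ fil hB; rewrite Em => /(_ mm) /lfunP /(_ v).
rewrite zero_lfunE comp_lfunE [(CAPYOUNG _ _ _ _ _ _ _ \o _)%VF _]comp_lfunE CAPYOUNGE /capYoung.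
rewrite [(COLL _ _ _ _ \o _)%VF _]comp_lfunE [(COLR _ _ _ _ \o _)%VF _]comp_lfunE [(PL _ _ _ \o _)%VF _]comp_lfunE.
rewrite PRE PLE !lin_ofE => <-.
rewrite -colL_cups -colR_cups; congr (youngL _ _ _ _).
rewrite /colL /colsym.
have yRlin := @youngR_linear F n k m1 (fun p : 'I_k => rowof Ts p) (fun p : 'I_k => colof Ts p).
rewrite [RHS](lin_sum yRlin); apply: eq_bigr => s _.
by rewrite [in RHS](linZ yRlin) -permL_youngR.
Qed.

End YoungSpanning.

(** * Simple modules of the centralizer algebra *)

Section Completeness.

Variables (F : fieldType) (n k : nat).
Hypotheses (char0 : [pchar F] =i pred0) (n0 : (0 < n)%N) (hn : (2 * k <= n)%N).

Notation tens := (tens F n k).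
Notation Br := (BrIdeal F n k).
Notation EP := (EP F n k).
Implicit Types (f x y z : 'End(tens)) (t : tens).

Variables (vT : vectType F) (rho : 'End(tens) -> 'End(vT)).
Hypotheses (rhoM : is_Cmodule rho) (rho_irr : abs_irreducible rho).
Implicit Types (u v w : vT).

(** [rho] is constrained on [Calg] only. Precomposed with [corner] it is linear on the diagram
    algebra and satisfies R x R y = R (x e y). *)
Let R x : 'End(vT) := rho (corner x).

Lemma rho_corner f : Calg f -> rho f = R f.
Proof. by move=> fC; rewrite /R Calg_corner. Qed.

Lemma rho_corner_linear c x y : x \in Br 0 -> y \in Br 0 -> R (c *: x + y) = c *: R x + R y.
Proof.
move=> xB yB; have [_ rD rZ _] := rhoM.
have cC := corner_Calg char0 n0.
have cZ : corner (c *: x) = c *: corner x by apply: (linZ (@corner_linear F n k)).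
by rewrite /R corner_linear rD ?rZ -?cZ //; apply: cC; rewrite ?memvZ.
Qed.

Lemma rho_corner0 : R 0 = 0.
Proof.
have [_ _ rZ _] := rhoM; have c0 := lin0 (@corner_linear F n k).
rewrite /R c0 -[X in rho X](scale0r (corner (0 : 'End(tens)))) rZ ?scale0r //.
by apply: corner_Calg; rewrite ?mem0v.
Qed.

Lemma rho_corner_comp x y u : x \in Br 0 -> y \in Br 0 -> R x (R y u) = R (x \o (EP \o y))%VF u.
Proof.
move=> xB yB; have [rM _ _ _] := rhoM.
by rewrite -comp_lfunE /R -rM ?corner_comp //; apply: corner_Calg.
Qed.

Lemma rho_corner1 : R \1%VF = \1%VF.
Proof.
have [_ _ _ r1] := rhoM; apply: r1 => [|v]; first by apply: corner_Calg => //; apply: BrIdeal_id.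
by rewrite cornerE id_lfunE eproj_idem.
Qed.

(** The projection makes the orbit map total and linear on all operators without changing it on the
    diagram algebra. *)
Lemma orbit_linear (q : 'End(tens)) w : q \in Br 0 -> linear (fun x => R (projv (Br 0) x \o q)%VF w).
Proof.
move=> qB c x y; rewrite linearP comp_lfunDl -comp_lfunZl rho_corner_linear ?add_lfunE ?scale_lfunE //.
  by apply: BrIdeal_left => //; apply: memv_proj.
by apply: BrIdeal_left => //; apply: memv_proj.
Qed.

Lemma mem_EP_comp x y : x \in Br 0 -> y \in Br 0 -> (x \o (EP \o y))%VF \in Br 0.
Proof. by move=> xB yB; do 2 (apply: BrIdeal_left => //); apply: mem_EP. Qed.

Lemma orbit_full q w x (qB : q \in Br 0) : x \in Br 0 -> R (x \o q)%VF w <> 0 ->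
  limg (lin_of (orbit_linear w qB)) = fullv.
Proof.
move=> xB xw; set A := lin_of _; have [_ irr] := rho_irr.
have AE z : z \in Br 0 -> A z = R (z \o q)%VF w by move=> zB; rewrite lin_ofE projv_id.
case: (irr (limg A)) => [f fC|A0|//]; last first.
  by case: xw; rewrite -AE //; apply/eqP; rewrite -memv0 -A0 memv_img ?memvf.
apply/subvP => _ /memv_imgP [v /memv_imgP [z _ ->] ->].
have pB : projv (Br 0) z \in Br 0 by apply: memv_proj.
have fB : f \in Br 0 by apply: Calg_mem.
rewrite lin_ofE rho_corner // rho_corner_comp //; last exact: BrIdeal_left.
have -> : (f \o (EP \o (projv (Br 0) z \o q)))%VF = ((f \o (EP \o projv (Br 0) z)) \o q)%VF.
  by rewrite !comp_lfunA.
by rewrite -AE ?memv_img ?memvf //; apply: mem_EP_comp.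
Qed.

Lemma orbit_transitive q w x v : q \in Br 0 -> x \in Br 0 -> R (x \o q)%VF w <> 0 ->
  exists2 z, z \in Br 0 & R (z \o q)%VF w = v.
Proof.
move=> qB xB xw; have : v \in limg (lin_of (orbit_linear w qB)) by rewrite (@orbit_full q w x qB xB xw) memvf.
by move=> /memv_imgP [z _ ->]; rewrite lin_ofE; exists (projv (Br 0) z); rewrite ?memv_proj.
Qed.

Lemma cmodule_transitive u v : u <> 0 -> exists2 z, z \in Br 0 & R z u = v.
Proof.
move=> u0; have [|z zB <-] := @orbit_transitive \1%VF u \1%VF v (BrIdeal_id _ _ _) (BrIdeal_id _ _ _).
  by rewrite comp_lfun1r rho_corner1 id_lfunE.
by exists z => //; rewrite comp_lfun1r.
Qed.

(* The number of caps of the module: its largest [m] with [Br m] acting nontrivially. *)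
Lemma cmodule_caps : exists m, (exists2 x, x \in Br m & R x <> 0) /\
  forall x, x \in Br m.+1 -> R x = 0.
Proof.
apply: NNPP => N.
have all m : exists2 x, x \in Br m & R x <> 0.
  elim: m => [|m IH].
    exists \1%VF; first exact: BrIdeal_id.
    rewrite rho_corner1 => /lfunP E; have [d0 _] := rho_irr.
    have : vpick {: vT} != 0 by rewrite vpick0 -dimv_eq0 -lt0n.
    by have := E (vpick {: vT}); rewrite id_lfunE zero_lfunE => ->; rewrite eqxx.
  apply: NNPP => N1; apply: N; exists m; split=> // x xB.
  by apply: NNPP => x0; apply: N1; exists x.
have [x] := all k.+1; rewrite BrIdeal_top // memv0 => /eqP ->.
by rewrite rho_corner0.
Qed.

Lemma cmodule_young : exists lam mu ro co ro' co' h h' w,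
  [/\ index_ok k lam mu,
      bifilling (k - sumn lam)%N (nth 0%N lam) (nth 0%N mu) ro co ro' co',
      h \in Br 0 /\ h' \in Br 0,
      R (h \o (CAPYOUNG F n (k - sumn lam)%N ro co ro' co' \o h'))%VF w <> 0 &
      forall x, x \in Br (k - sumn lam).+1 -> R x = 0].
Proof.
have [m [[x xB x0] kill]] := cmodule_caps.
have [X [XP BX]] := young_spanning char0 n0 hn m.
have mB f : f \in Br m -> f \in Br 0 by apply: subvP; apply: BrIdeal_mono.
have [g gX g0] : exists2 g, g \in X & R g <> 0.
  apply: NNPP => N; apply: x0.
  suff [] : x \in Br 0 /\ R x = 0 by [].
  move: (subvP BX _ xB) => {xB}; move: x; apply: span_ind => [|c f g fX [gB g0]].
    by rewrite mem0v rho_corner0.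
  have fB : f \in Br 0 by apply/mB/young_gen_mem/XP.
  split; first by rewrite rpredD // memvZ.
  rewrite rho_corner_linear // g0 addr0; suff -> : R f = 0 by rewrite scaler0.
  by apply: NNPP => f0; apply: N; exists f.
have [lam [mu [ro [co [ro' [co' [h [h' [ok mm fil [hG h'G] Eg]]]]]]]]] := XP g gX.
have [w w0] : exists w, R g w <> 0.
  by apply: NNPP => N; apply: g0; apply/lfunP => w; rewrite zero_lfunE; apply: NNPP => H; apply: N; exists w.
exists lam, mu, ro, co, ro', co', h, h', w; split=> //.
- by split; apply: memv_span.
- by rewrite -Eg.
(* More than [m] caps would place [g] in [BrIdeal m.+1], which acts as zero. *)
suff <- : m = (k - sumn lam)%N by [].
apply/eqP; rewrite eqn_leq mm leqNgt; apply/negP => lt; apply: g0.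
apply: kill; apply: (young_gen_mem char0 n0); exists lam, mu, ro, co, ro', co', h, h'.
by split.
Qed.

Section Isomorphism.

Variables (lam mu : seq nat) (ro co ro' co' : 'I_k -> nat) (h h' : 'End(tens)) (w : vT).
Notation m := (k - sumn lam)%N.
Notation D := (CAPYOUNG F n m ro co ro' co').
Notation u0 := (cap_gen F n m ro co ro' co').
Hypotheses (ok : index_ok k lam mu) (fil : bifilling m (nth 0%N lam) (nth 0%N mu) ro co ro' co').
Hypotheses (hB : h \in Br 0) (h'B : h' \in Br 0) (nz : R (h \o (D \o h'))%VF w <> 0).
Hypothesis kill : forall x, x \in Br m.+1 -> R x = 0.

Let DB : D \in Br 0. Proof. by have [] := bifilling_mem char0 n0 fil. Qed.
Let q := (D \o h')%VF.
Let qB : q \in Br 0. Proof. exact: BrIdeal_left. Qed.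

Lemma rho_sandwich x y c : x \in Br 0 -> y \in Br 0 -> (D \o (y \o D))%VF - c *: D \in Br m.+1 ->
  R (x \o (D \o (y \o q)))%VF w = c *: R (x \o q)%VF w.
Proof.
move=> xB yB HB.
have -> : (x \o (D \o (y \o q)))%VF =
    c *: (x \o q)%VF + (x \o (((D \o (y \o D))%VF - c *: D) \o h'))%VF.
  rewrite /q; move: D => d; rewrite comp_lfunDl comp_lfunNl -comp_lfunZl comp_lfunDr comp_lfunNr -comp_lfunZr.
  by rewrite addrC subrK !comp_lfunA.
have zB : (x \o (((D \o (y \o D))%VF - c *: D) \o h'))%VF \in Br m.+1.
  by apply: BrIdeal_left => //; apply: BrIdeal_right.
rewrite rho_corner_linear; first by rewrite (kill zB) addr0 scale_lfunE.
  exact: BrIdeal_left.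
by move: zB; apply: subvP; apply: BrIdeal_mono.
Qed.

(** One scalar controls both sides: with D (y e x) D = c D modulo more caps, R (h D y) R (x q) w = c
    R (h q) w and D (y e x) u0 = c u0. If only the left side vanished, a [y] detecting e x u0 would
    give c <> 0. If only the right side did, y = h' e z with [z] returning R (x q) w to [w] would
    give c = 0 but a nonzero vector. *)
Lemma orbit_kernel x : x \in Br 0 -> R (x \o q)%VF w = 0 <-> EP (x u0) = 0.
Proof.
move=> xB; have u0N := cap_gen_mem F n m ro co ro' co'.
have EPx y : y \in Br 0 -> (y \o (EP \o x))%VF \in Br 0 by move=> yB; apply: mem_EP_comp.
have comp y : y \in Br 0 -> R (h \o (D \o y))%VF (R (x \o q)%VF w) = R (h \o (D \o ((y \o (EP \o x)) \o q)))%VF w.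
  move=> yB; rewrite rho_corner_comp //; last exact: BrIdeal_left.
    by move: D q EP => d q' e; rewrite !comp_lfunA.
  by do 2 (apply: BrIdeal_left => //).
split=> H; apply: NNPP => N.
  have EN : EP (x u0) \in gen_module F n m ro co ro' co'.
    apply: (bifilling_left char0 n0 hn fil); first exact: mem_EP.
    exact: (bifilling_left char0 n0 hn fil).
  have [y yB Dy] := bifilling_detect char0 n0 fil EN N.
  have [c [Hc Ec]] := bifilling_sandwich char0 n0 hn fil (EPx y yB).
  have := comp y yB; rewrite H linear0 (rho_sandwich hB (EPx y yB) Hc) => /esym /eqP.
  rewrite scaler_eq0 => /orP [/eqP c0|/eqP //].
  by apply: Dy; move: Ec; rewrite c0 scale0r => <-; move: D EP => d e; rewrite !comp_lfunE.
have [z zB Ez] := cmodule_transitive w N.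
have yB : (h' \o (EP \o z))%VF \in Br 0 by apply: mem_EP_comp.
have [c [Hc Ec]] := bifilling_sandwich char0 n0 hn fil (EPx _ yB).
have := comp _ yB; rewrite (rho_sandwich hB (EPx _ yB) Hc).
have c0 : c = 0.
  move: Ec; have -> : D ((h' \o (EP \o z) \o (EP \o x))%VF u0) = 0.
    by move: H; move: D EP => d e; rewrite !comp_lfunE => ->; rewrite !linear0.
  move=> /esym /eqP; rewrite scaler_eq0 => /orP [/eqP //|/eqP].
  by move/(bifilling_neq0 char0 n0 hn fil).
rewrite c0 scale0r; have -> : (h \o (D \o (h' \o (EP \o z))))%VF = ((h \o q) \o (EP \o z))%VF.
  by rewrite /q; move: D EP => d e; rewrite !comp_lfunA.
rewrite -rho_corner_comp ?Ez //; first exact: BrIdeal_left.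
Qed.

Lemma evaluation_linear : linear (fun x => EP (projv (Br 0) x u0)).
Proof. by move=> c x y; rewrite linearP add_lfunE scale_lfunE linearP. Qed.

Lemma cmodule_iso : nonzero (@eMlm F n k lam mu) /\ abs_iso rho (@eMlm F n k lam mu).
Proof.
(* [A^-1] picks some preimage under the orbit map; [orbit_kernel] makes the value of [phi]
   independent of the choice. *)
pose A := lin_of (orbit_linear w qB); pose phi := (lin_of evaluation_linear \o A^-1)%VF.
have onto v : exists2 x, x \in Br 0 & R (x \o q)%VF w = v by apply: orbit_transitive nz.
have phiE x : x \in Br 0 -> phi (R (x \o q)%VF w) = EP (x u0).
  move=> xB; rewrite /phi comp_lfunE lin_ofE.
  set z := projv _ _; have zB : z \in Br 0 by apply: memv_proj.
  have Ez : R (z \o q)%VF w = R (x \o q)%VF w.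
    have := limg_lfunVK (f := A) (x := R (x \o q)%VF w).
    by rewrite (@orbit_full q w h qB hB nz) memvf => /(_ isT); rewrite {1}/A lin_ofE.
  apply/eqP; rewrite -subr_eq0 -linearB /= -opp_lfunE -add_lfunE; apply/eqP/orbit_kernel.
    by rewrite rpredB.
  rewrite comp_lfunDl comp_lfunNl addrC -scaleN1r rho_corner_linear; try exact: BrIdeal_left.
  by rewrite add_lfunE scale_lfunE Ez scaleN1r addNr.
have inj u : phi u = 0 -> u = 0.
  by have [x xB <-] := onto u; rewrite phiE // => /orbit_kernel; apply.
have img t : eMlm lam mu t <-> exists u, t = phi u.
  split=> [/(eMlmP char0 n0 hn ok fil) [tN et]|[u ->]].
    have [f fB Ef] := bifilling_irreducible char0 n0 hn fil (cap_gen_mem F n m ro co ro' co')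
      (bifilling_neq0 char0 n0 hn fil) tN.
    by exists (R (f \o q)%VF w); rewrite phiE // Ef EPE et.
  have [x xB <-] := onto u; rewrite phiE //; apply/(eMlmP char0 n0 hn ok fil).
  split; last by rewrite EPE eproj_idem.
  apply: (bifilling_left char0 n0 hn fil); first exact: mem_EP.
  by apply: (bifilling_left char0 n0 hn fil) => //; apply: cap_gen_mem.
split; last first.
  exists phi; split=> // f u fC; have [x xB <-] := onto u.
  have fB : f \in Br 0 by apply: Calg_mem.
  rewrite rho_corner // rho_corner_comp //; last exact: BrIdeal_left.
  have -> : (f \o (EP \o (x \o q)))%VF = ((f \o (EP \o x)) \o q)%VF by rewrite !comp_lfunA.
  rewrite !phiE //; last exact: mem_EP_comp.
  by case: fC => _ _ fe; rewrite [EP (_ u0)]EPE !comp_lfunE fe.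
exists (phi (R (h \o q)%VF w)); split; first by apply/img; exists (R (h \o q)%VF w).
by move/inj.
Qed.

End Isomorphism.

Lemma completeness : exists lam mu, [/\ index_ok k lam mu, nonzero (@eMlm F n k lam mu) &
  abs_iso rho (@eMlm F n k lam mu)].
Proof.
have [lam [mu [ro [co [ro' [co' [h [h' [w [ok fil [hB h'B] nz kill]]]]]]]]]] := cmodule_young.
by have [] := cmodule_iso ok fil hB h'B nz kill; exists lam, mu.
Qed.

End Completeness.

Theorem theorem3p5 (F : closedFieldType) (hchar : [pchar F] =i pred0)
    (n k : nat) (hn0 : (0 < n)%N) (hn : (2 * k <= n)%N) :
  [/\ (forall lam mu, index_ok k lam mu -> nonzero (@eMlm F n k lam mu) ->
         Csubmodule (@eMlm F n k lam mu) /\ Cirreducible (@eMlm F n k lam mu)),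
      (forall lam mu lam' mu', index_ok k lam mu -> index_ok k lam' mu' ->
         nonzero (@eMlm F n k lam mu) -> nonzero (@eMlm F n k lam' mu') ->
         (lam, mu) <> (lam', mu') ->
         ~ Ciso (@eMlm F n k lam mu) (@eMlm F n k lam' mu')) &
      (forall (vT : vectType F) (rho : 'End(tens F n k) -> 'End(vT)),
         is_Cmodule rho -> abs_irreducible rho ->
         exists lam mu, [/\ index_ok k lam mu, nonzero (@eMlm F n k lam mu) &
                            abs_iso rho (@eMlm F n k lam mu)])].
Proof.
split=> [lam mu ok nz|lam mu lam' mu' ok ok' nz nz' ne|vT rho rhoM irr].
- have [ro [co [ro' [co' fil]]]] := eMlm_bifilling hn0 hn ok nz.
  split; first exact: (eMlm_submodule hchar hn0 hn ok fil).
  exact: (eMlm_irreducible hchar hn0 hn ok fil).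
- exact: eMlm_not_iso.
- exact: completeness.
Qed.
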